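(* Let $m\ge2$. Every class-$B$ Hopf hypersurface with constant principal curvatures in $\mathbb{CH}^m(-4)$ is mass-symmetric and of 3-type via $\tilde x$. The same is true for hypersurfaces of class $B$ in $\mathbb{CP}^m(4)$, with the exception of the tubes about the complex quadric $Q^{m-1}$ of radius $r_1=\cot^{-1}(\sqrt m+\sqrt{m+1})$ and of radius $r_2=\cot^{-1}\sqrt{\sqrt{2m^2-1}+\sqrt{2m^2-2}}$, which are mass-symmetric and of 2-type.
   Context: Let $c=\pm1$. On $\mathbb{C}^{m+1}$ let $\Psi_c(z,w)=c\,\bar z_0w_0+\sum_{j=1}^m\bar z_jw_j$, with (pseudo-)Riemannian metric $\operatorname{Re}\Psi_c$. $\mathbb{CQ}^m(4c)$ is the quotient of $\{z:\Psi_c(z,z)=c\}$ by $S^1$ with the submersion metric: it is $\mathbb{CP}^m(4)$ for $c=1$ and $\mathbb{CH}^m(-4)$ for $c=-1$, of constant holomorphic sectional curvature $4c$. $H^{(1)}(m+1)$ is the space of $\Psi_c$-Hermitian complex $(m+1)\times(m+1)$ matrices ($\Psi_c(Az,w)=\Psi_c(z,Aw)$) with metric $\langle A,B\rangle=\frac c2\operatorname{tr}(AB)$. $\Phi:\mathbb{CQ}^m(4c)\to H^{(1)}(m+1)$ is the isometric embedding sending a complex line to the $\Psi_c$-orthogonal projector onto it, $\Phi([z])v=c\,\Psi_c(z,v)z$ for $\Psi_c(z,z)=c$; its image lies in the hyperquadric $\langle P-\frac{I}{m+1},P-\frac{I}{m+1}\rangle=\frac{cm}{2(m+1)}$ centered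 at $I/(m+1)$. A class-$B$ hypersurface is an open portion of: in $\mathbb{CP}^m(4)$, a tube of any radius $r\in(0,\frac\pi4)$ about the complex quadric $Q^{m-1}=\{[z]:\sum_j z_j^2=0\}$; in $\mathbb{CH}^m(-4)$, a tube of any radius $r>0$ about the canonically embedded totally real, totally geodesic $\mathbb{RH}^m=\{[z]: z\text{ real}\}$ (all up to holomorphic isometries). For a real hypersurface given by an isometric immersion $x:M\to\mathbb{CQ}^m(4c)$ put $\tilde x=\Phi\circ x$. The Laplacian of $M$, $\Delta=-\operatorname{tr}\operatorname{Hess}$, acts on matrix-valued functions componentwise. $M$ is of $k$-type via $\tilde x$ if $\tilde x=\tilde x_0+\tilde x_{t_1}+\dots+\tilde x_{t_k}$ with $\tilde x_0$ constant, each $\tilde x_{t_i}$ a nonconstant $H^{(1)}(m+1)$-valued function with $\Delta\tilde x_{t_i}=\lambda_{t_i}\tilde x_{t_i}$, and $\lambda_{t_i}\in\mathbb{R}$ mutually distinct. It is mass-symmetric if $\tilde x_0=I/(m+1)$ (if one of the $\lambda_{t_i}$ is zero, so-called null $k$-type, $\tilde x_0$ is not unique and $M$ is by definition mass-symmetric). *)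

(* Defs.v *)
From HB Require Import structures.
From mathcomp Require Import all_boot all_order all_algebra.
From mathcomp Require Import generic_quotient.
From mathcomp Require Import all_classical all_reals all_analysis.
From mathcomp Require Import complex.

Set Implicit Arguments.
Unset Strict Implicit.
Unset Printing Implicit Defensive.

Import Order.TTheory GRing.Theory Num.Theory.
Import numFieldNormedType.Exports.

Local Open Scope classical_set_scope.
Local Open Scope ring_scope.
Local Open Scope complex_scope.
Local Open Scope quotient_scope.

(* The norm topology on R[i]. *)
HB.instance Definition _ (R : rcfType) := NormedModule.copy R[i] (R[i])^o.

Section Calculus.
Context {R : realType} {n : nat}.
Implicit Types (h : 'rV[R]_n -> R) (U : set 'rV[R]_n).

Definition partial (i : 'I_n) h : 'rV[R]_n -> R :=
  fun u => 'D_(delta_mx 0 i) h u.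

(* C^oo on U: every iterated partial derivative exists and is continuous at
   every point of U. *)
Definition smooth U h := forall (s : seq 'I_n) u, U u ->
  {for u, continuous (foldr partial h s)} /\
  forall i, derivable (foldr partial h s) u (delta_mx 0 i).

Definition smooth_mx a b U (F : 'rV[R]_n -> 'M[R[i]]_(a, b)) :=
  forall i j, smooth U (fun u => complex.Re (F u i j)) /\
              smooth U (fun u => complex.Im (F u i j)).

Definition partial_mx a b (k : 'I_n) (F : 'rV[R]_n -> 'M[R[i]]_(a, b)) :
    'rV[R]_n -> 'M[R[i]]_(a, b) :=
  fun u => \matrix_(i, j) (partial k (fun v => complex.Re (F v i j)) u +i*
                           partial k (fun v => complex.Im (F v i j)) u).

(* Laplace-Beltrami operator, with the sign convention Delta = - tr Hess, of a
   metric given by its coefficient functions g i j. *)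
Section Metric.
Variable g : 'I_n -> 'I_n -> 'rV[R]_n -> R.

Definition metric_inv u : 'M[R]_n := invmx (\matrix_(i, j) g i j u).

Definition christoffel (k i j : 'I_n) u : R :=
  2^-1 * \sum_(l < n) metric_inv u k l *
    (partial i (g j l) u + partial j (g i l) u - partial l (g i j) u).

Definition hessian h (i j : 'I_n) u : R :=
  partial i (partial j h) u - \sum_(k < n) christoffel k i j u * partial k h u.

Definition laplacian h u : R :=
  - \sum_(i < n) \sum_(j < n) metric_inv u i j * hessian h i j u.

Definition laplacian_mx a b (F : 'rV[R]_n -> 'M[R[i]]_(a, b)) u :
    'M[R[i]]_(a, b) :=
  \matrix_(i, j) (laplacian (fun v => complex.Re (F v i j)) u +i*
                  laplacian (fun v => complex.Im (F v i j)) u).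
End Metric.

End Calculus.

(* The complex space form CQ^m(4c); only c = 1 and c = -1 are meaningful. *)

Section SpaceForm.
Context {R : realType}.
Variables (c : R) (m : nat).
Local Notation C := R[i].
Local Notation vec := 'cV[R[i]]_m.+1.
Local Notation mat := 'M[R[i]]_m.+1.

Definition Psi (z w : vec) : C :=
  c%:C * (z ord0 0)^* * w ord0 0 +
  \sum_(j < m) (z (lift ord0 j) 0)^* * w (lift ord0 j) 0.

Definition hyperquadric : set vec := [set z | Psi z z = c%:C].

Definition circle_rel (z w : hyperquadric) : bool :=
  `[< exists2 a : C, `|a| = 1 & set_val w = a *: set_val z >].

Lemma circle_rel_refl : reflexive circle_rel.
Proof. by move=> z; apply/asboolP; exists 1; rewrite ?normr1 ?scale1r. Qed.

Lemma circle_rel_sym : symmetric circle_rel.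
Proof.
have sub z w : circle_rel z w -> circle_rel w z.
  move=> /asboolP[a a1 e]; apply/asboolP; exists a^-1.
    by rewrite normfV a1 invr1.
  by rewrite e scalerA mulVf ?scale1r // -normr_eq0 a1 oner_neq0.
by move=> z w; apply/idP/idP => /sub.
Qed.

Lemma circle_rel_trans : transitive circle_rel.
Proof.
move=> w z y /asboolP[a a1 e] /asboolP[b b1 f]; apply/asboolP.
by exists (b * a); rewrite ?normrM ?a1 ?b1 ?mulr1 // f e scalerA.
Qed.

Canonical circle_equiv :=
  EquivRel circle_rel circle_rel_refl circle_rel_sym circle_rel_trans.

(* Carries the quotient of the topology induced by C^(m+1). *)
Definition CQ := quotient_topology {eq_quot circle_equiv}.
HB.instance Definition _ := Topological.on CQ.
HB.instance Definition _ := Quotient.on CQ.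

Definition cq (z : hyperquadric) : CQ := \pi_CQ z.

(* Phi([z]) v = c Psi(z,v) z, first on representatives. *)
Definition projector (z : vec) : mat :=
  \matrix_(i, j) (c%:C * Psi z (delta_mx j 0) * z i 0).

Definition Phi (p : CQ) : mat := projector (set_val (repr p)).

Lemma projector_circle (z w : hyperquadric) :
  circle_rel z w -> projector (set_val z) = projector (set_val w).
Proof.
move=> /asboolP[a a1 ->]; apply/matrixP => i j; rewrite !mxE.
have aa : a^* * a = 1 by rewrite mulrC -sqr_normc a1 expr1n.
have -> : Psi (a *: set_val z) (delta_mx j 0) =
          a^* * Psi (set_val z) (delta_mx j 0).
  rewrite /Psi mulrDr mulr_sumr !mxE rmorphM /=; congr (_ + _).
    by rewrite !mulrA [_ * a^*]mulrC.
  by apply: eq_bigr => k _; rewrite !mxE rmorphM mulrA.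
by rewrite -mulrA -[RHS]mulrA mulrACA aa mul1r.
Qed.

Lemma Phi_cq (z : hyperquadric) : Phi (cq z) = projector (set_val z).
Proof.
apply: projector_circle; rewrite -[circle_rel _ _]/(circle_equiv _ _).
by apply/eqmodP; rewrite reprK.
Qed.

Definition Psi_hermitian (A : mat) := forall z w, Psi (A *m z) w = Psi z (A *m w).

Definition Psi_unitary (A : mat) := forall z w, Psi (A *m z) (A *m w) = Psi z w.

(* The holomorphic isometries of CQ are the maps [z] |-> [A z] with A
   Psi-unitary. *)
Definition isometry_image (A : mat) (S : set CQ) : set CQ :=
  [set p | exists z w : hyperquadric,
     [/\ S (cq z), set_val w = A *m set_val z & p = cq w]].

(* Component of v orthogonal to the complex line of z, when Psi(z,z) = c.
   At z in the hyperquadric, the vectors Psi-orthogonal to z form the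
   horizontal space of the submersion and are identified with the tangent
   space of CQ at [z]. *)
Definition horizontal (z v : vec) : vec := v - (c%:C * Psi z v) *: z.

Definition velocity (gam : R -> hyperquadric) (t : R) : vec :=
  \matrix_(i, j) ('D_1 (fun s => complex.Re (set_val (gam s) i j)) t +i*
                  'D_1 (fun s => complex.Im (set_val (gam s) i j)) t).

Definition derivable_curve (gam : R -> hyperquadric) := forall t i j,
  derivable (fun s => complex.Re (set_val (gam s) i j)) t 1 /\
  derivable (fun s => complex.Im (set_val (gam s) i j)) t 1.

(* v is the horizontal lift at z of a unit normal vector of S at [z].  The
   curves are lifts of curves of S, and the real part of Psi(v, _) only sees
   the horizontal part of their velocities. *)
Definition unit_normal (S : set CQ) (z : hyperquadric) (v : vec) :=
  [/\ Psi (set_val z) v = 0, Psi v v = 1 &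
      forall gam : R -> hyperquadric, derivable_curve gam ->
        (forall t, S (cq (gam t))) -> gam 0 = z ->
        complex.Re (Psi v (velocity gam 0)) = 0].

Definition gcos (t : R) := if 0 < c then cos t else (expR t + expR (- t)) / 2.
Definition gsin (t : R) := if 0 < c then sin t else (expR t - expR (- t)) / 2.

(* Unit speed geodesics of CQ are the projections of the curves
   t |-> gcos t z + gsin t v with v horizontal and Psi(v,v) = 1. *)
Definition tube (S : set CQ) (r : R) : set CQ :=
  [set p | exists (z y : hyperquadric) (v : vec),
     [/\ S (cq z), unit_normal S z v,
         set_val y = (gcos r)%:C *: set_val z + (gsin r)%:C *: v & p = cq y]].

Local Notation dim := (m.*2.-1).

Section Parametrization.
(* A local parametrization u |-> [zeta u], given through a lift. *)
Variable zeta : 'rV[R]_dim -> hyperquadric.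

Definition chart (u : 'rV[R]_dim) : CQ := cq (zeta u).

(* i-th coordinate vector field, as a horizontal vector at zeta u *)
Definition coord_field (i : 'I_dim) (u : 'rV[R]_dim) : vec :=
  horizontal (set_val (zeta u)) (partial_mx i (fun v => set_val (zeta v)) u).

Definition induced_metric (i j : 'I_dim) (u : 'rV[R]_dim) : R :=
  complex.Re (Psi (coord_field i u) (coord_field j u)).

(* A regular parametrization of a relatively open part of M: a smooth
   immersion that is a homeomorphism onto an open subset of M.  Locally every
   smooth map into CQ has a smooth lift. *)
Definition local_param (M : set CQ) (U : set 'rV[R]_dim) :=
  [/\ open U,
      smooth_mx U (fun u => set_val (zeta u)),
      forall u, U u -> forall a : 'I_dim -> R,
        \sum_(i < dim) (a i)%:C *: coord_field i u = 0 -> forall i, a i = 0,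
      {in U &, injective chart} &
      forall V : set 'rV[R]_dim, open V -> V `<=` U ->
        exists2 W : set CQ, open W & chart @` V = M `&` W].
End Parametrization.

Definition real_hypersurface (M : set CQ) := forall p, M p ->
  exists (zeta : 'rV[R]_dim -> hyperquadric) (U : set 'rV[R]_dim) u,
    [/\ local_param zeta M U, U u & chart zeta u = p].

(* f is smooth on M and Delta f = F, Delta being the Laplacian of M. *)
Definition has_laplacian (M : set CQ) (f F : CQ -> mat) :=
  forall (zeta : 'rV[R]_dim -> hyperquadric) (U : set 'rV[R]_dim),
    local_param zeta M U ->
    smooth_mx U (f \o chart zeta) /\
    forall u, U u ->
      laplacian_mx (induced_metric zeta) (f \o chart zeta) u = F (chart zeta u).

Definition spectral_decomposition (M : set CQ) (k : nat)
    (x0 : mat) (lam : 'I_k -> R) (xt : 'I_k -> CQ -> mat) :=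
  [/\ Psi_hermitian x0,
      forall i p, M p -> Psi_hermitian (xt i p),
      forall i, exists p q, [/\ M p, M q & xt i p <> xt i q],
      injective lam &
      (forall i, has_laplacian M (xt i) (fun p => (lam i)%:C *: xt i p)) /\
      forall p, M p -> Phi p = x0 + \sum_(i < k) xt i p].

Definition of_type (M : set CQ) (k : nat) :=
  exists x0 lam xt, @spectral_decomposition M k x0 lam xt.

(* The second alternative is the null case, in which x0 is not unique. *)
Definition mass_symmetric (M : set CQ) :=
  exists k x0 lam xt, @spectral_decomposition M k x0 lam xt /\
    (x0 = (m.+1%:R^-1)%:M \/ exists i, lam i = 0).

(* A real hypersurface that is an open portion of the tube, up to a holomorphic
   isometry of CQ. *)
Definition tube_portion (S : set CQ) (r : R) (M : set CQ) :=
  [/\ real_hypersurface M, M !=set0 &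
      exists2 A : mat, Psi_unitary A &
      exists2 W : set CQ, open W & M = isometry_image A (tube S r) `&` W].

Definition complex_quadric : set CQ :=
  [set p | exists2 z : hyperquadric,
     \sum_(j < m.+1) (set_val z j 0) ^+ 2 = 0 & p = cq z].

Definition real_form : set CQ :=
  [set p | exists2 z : hyperquadric,
     (forall j, complex.Im (set_val z j 0) = 0) & p = cq z].

End SpaceForm.

Arguments complex_quadric {R} c m.
Arguments real_form {R} c m.

(* The branch of cot^-1 with values in (0, pi). *)
Definition acot {R : realType} (x : R) : R := pi / 2 - atan x.

(* Main.v *)
Require Import Defs.
From mathcomp Require Import all_boot all_order all_algebra.
From mathcomp Require Import all_classical all_reals all_analysis.
From mathcomp Require Import complex ring lra.

(* Let J be the antilinear involution z |-> conj z, transported by the isometry,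
   and q(z) = Psi(J z, z).  Then |q|^2 is constant on the tube, equal to
   x = sin(2r)^2 for the tubes about the quadric and to x = cosh(2r)^2 for those
   about RH^m.  Indeed a unit normal v at a point z of the core satisfies
   c v = Psi(J z, v) J z - q(z) J v, as the core is invariant under the rotations
   and boosts in the real coordinate planes, and this determines q along the
   normal geodesic.

   Put X = Phi and Y = J X J.  On a hypersurface |q|^2 = x the matrix
   B = - Delta X is determined by: the Laplacian of X X = X; the orthogonality of
   B to the tangent space; the Laplacian of the constant tr(X Y).  Hence the
   span of X, Y, S = X Y + Y X and I is invariant under Delta, with constant
   coefficients.  X - Y is an eigenvector, with eigenvalue l0, and the traceless
   parts of X + Y and S span an invariant plane with eigenvalues lp and lm, so
   that X - I/(m+1) has at most three spectral components.  Two of them merge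
   exactly if l0 = lm, i.e. (m^2-1) x^2 + 2 x = 2, and one of them vanishes exactly
   if (m+1) x = 1; these are the two exceptional radii. *)

Set Implicit Arguments.
Unset Strict Implicit.
Unset Printing Implicit Defensive.

Import Order.TTheory GRing.Theory Num.Theory.
Import numFieldNormedType.Exports.
Local Open Scope classical_set_scope.
Local Open Scope ring_scope.

(** * Smooth functions *)

Section SmoothFunctions.
Context {R : realType} {n : nat}.
Variable U : set 'rV[R]_n.
Hypothesis openU : open U.
Implicit Types (f g h : 'rV[R]_n -> R) (u : 'rV[R]_n).

Lemma partial_eq i f g u : U u -> {in U, f =1 g} -> partial i f u = partial i g u.
Proof.
move=> Uu fg; apply: near_eq_derive.
have: nbhs u U by apply: open_nbhs_nbhs.
by apply: filterS => v Uv; rewrite fg ?inE.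
Qed.

Lemma derivable_eq i f g u : U u -> {in U, f =1 g} ->
  derivable f u (delta_mx 0 i) -> derivable g u (delta_mx 0 i).
Proof.
move=> Uu fg; apply: near_eq_derivable.
have: nbhs u U by apply: open_nbhs_nbhs.
by apply: filterS => v Uv; rewrite fg ?inE.
Qed.

Lemma continuous_eq f g u : U u -> {in U, f =1 g} ->
  {for u, continuous f} -> {for u, continuous g}.
Proof.
move=> Uu fg; rewrite /prop_for /continuous_at -(fg u) ?inE // => cf.
have NU : nbhs u U by apply: open_nbhs_nbhs.
have fgu : \forall v \near u, f v = g v.
  by apply: filterS NU => v Uv; rewrite fg ?inE.
by apply: cvg_trans cf; apply: near_eq_cvg fgu.
Qed.

Lemma smooth_continuous h u : smooth U h -> U u -> {for u, continuous h}.
Proof. by move=> + Uu => /(_ [::] u Uu)[]. Qed.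

Lemma smooth_derivable h u i :
  smooth U h -> U u -> derivable h u (delta_mx 0 i).
Proof. by move=> + Uu => /(_ [::] u Uu)[_ /(_ i)]. Qed.

Lemma smooth_partial h i : smooth U h -> smooth U (partial i h).
Proof. by move=> sh s; have := sh (rcons s i); rewrite foldr_rcons. Qed.

Lemma smooth_coind (P : ('rV[R]_n -> R) -> Prop) :
  (forall h, P h ->
     (forall u, U u -> {for u, continuous h} /\
        forall i, derivable h u (delta_mx 0 i)) /\
     forall i, exists2 g, P g & {in U, partial i h =1 g}) ->
  forall h, P h -> smooth U h.
Proof.
move=> step h Ph s.
have [g Pg hg] : exists2 g, P g & {in U, foldr partial h s =1 g}.
  elim: s => [|i s [g Pg hg]] /=; first by exists h.
  have [_ /(_ i)[g' Pg' gg']] := step _ Pg.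
  by exists g' => // u Uu; rewrite -gg' //; apply: partial_eq => //; rewrite -inE.
move=> u Uu; have [/(_ u Uu)[cg dg] _] := step _ Pg.
split; first by apply: continuous_eq cg => // v Uv; rewrite hg.
by move=> i; apply: derivable_eq (dg i) => // v Uv; rewrite hg.
Qed.

Lemma partialD i f g u : derivable f u (delta_mx 0 i) ->
  derivable g u (delta_mx 0 i) ->
  partial i (fun v => f v + g v) u = partial i f u + partial i g u.
Proof. exact: deriveD. Qed.

Lemma partialM i f g u : derivable f u (delta_mx 0 i) ->
  derivable g u (delta_mx 0 i) ->
  partial i (fun v => f v * g v) u = f u * partial i g u + g u * partial i f u.
Proof. exact: deriveM. Qed.

Lemma partial_cst i (k : R) u : partial i (fun=> k) u = 0.
Proof. exact: derive_cst. Qed.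

Inductive smooth_gen : ('rV[R]_n -> R) -> Prop :=
| SmoothBase h : smooth U h -> smooth_gen h
| SmoothCst k : smooth_gen (fun=> k)
| SmoothAdd f g : smooth_gen f -> smooth_gen g -> smooth_gen (fun u => f u + g u)
| SmoothMul f g : smooth_gen f -> smooth_gen g -> smooth_gen (fun u => f u * g u).

Lemma smooth_genP h : smooth_gen h -> smooth U h.
Proof.
apply: smooth_coind => {}h; elim=> {h}.
- move=> h sh; split=> [u Uu|i].
    by split=> [|i]; [exact: smooth_continuous|exact: smooth_derivable].
  by exists (partial i h) => //; apply: SmoothBase; apply: smooth_partial.
- move=> k; split=> [u _|i]; last first.
    by exists (fun=> 0) => [|u _]; [exact: SmoothCst|rewrite partial_cst].
  by split=> [|i]; [exact: cst_continuous|exact: derivable_cst].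
- move=> f g _ [cf pf] _ [cg pg]; split=> [u Uu|i].
    have [[fu df] [gu dg]] := (cf u Uu, cg u Uu).
    split=> [|i]; first exact: (cvgD fu gu).
    exact: (derivableD (df i) (dg i)).
  have [[f' sf' ef] [g' sg' eg]] := (pf i, pg i).
  exists (fun u => f' u + g' u); first exact: SmoothAdd.
  move=> u Uu; have Uu' : U u by rewrite -inE.
  have [[_ df] [_ dg]] := (cf u Uu', cg u Uu').
  by rewrite partialD // ef // eg.
- move=> f g sf [cf pf] sg [cg pg]; split=> [u Uu|i].
    have [[fu df] [gu dg]] := (cf u Uu, cg u Uu).
    split=> [|i]; first exact: (cvgM fu gu).
    exact: (derivableM (df i) (dg i)).
  have [[f' sf' ef] [g' sg' eg]] := (pf i, pg i).
  exists (fun u => f u * g' u + g u * f' u).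
    by apply: SmoothAdd; apply: SmoothMul.
  move=> u Uu; have Uu' : U u by rewrite -inE.
  have [[_ df] [_ dg]] := (cf u Uu', cg u Uu').
  by rewrite partialM // ef // eg.
Qed.

Lemma smooth_cst (k : R) : smooth U (fun=> k).
Proof. exact/smooth_genP/SmoothCst. Qed.

Lemma smoothD f g : smooth U f -> smooth U g -> smooth U (fun u => f u + g u).
Proof. by move=> sf sg; apply/smooth_genP/SmoothAdd; apply: SmoothBase. Qed.

Lemma smoothM f g : smooth U f -> smooth U g -> smooth U (fun u => f u * g u).
Proof. by move=> sf sg; apply/smooth_genP/SmoothMul; apply: SmoothBase. Qed.

Lemma smoothN f : smooth U f -> smooth U (fun u => - f u).
Proof.
move=> sf; rewrite (_ : (fun u => _) = fun u => -1 * f u).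
  exact: (smoothM (smooth_cst (-1)) sf).
by apply/funext => u; rewrite mulN1r.
Qed.

Lemma smooth_sum (I : Type) (r : seq I) (F : I -> 'rV[R]_n -> R) :
  (forall k, smooth U (F k)) -> smooth U (fun u => \sum_(k <- r) F k u).
Proof.
move=> sF; elim: r => [|k r IH].
  rewrite (_ : (fun u => _) = fun=> 0); first exact: smooth_cst.
  by apply/funext => u; rewrite big_nil.
rewrite (_ : (fun u => _) = fun u => F k u + \sum_(l <- r) F l u).
  exact: (smoothD (sF k) IH).
by apply/funext => u; rewrite big_cons.
Qed.

Lemma partialN i f u : smooth U f -> U u ->
  partial i (fun v => - f v) u = - partial i f u.
Proof. by move=> sf Uu; apply: deriveN; apply: smooth_derivable. Qed.

Lemma partial_sum i (I : Type) (r : seq I) (F : I -> 'rV[R]_n -> R) u :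
  (forall k, smooth U (F k)) -> U u ->
  partial i (fun v => \sum_(k <- r) F k v) u = \sum_(k <- r) partial i (F k) u.
Proof.
move=> sF Uu; elim: r => [|k r IH].
  rewrite big_nil (_ : (fun v => _) = fun=> 0) ?partial_cst //.
  by apply/funext => v; rewrite big_nil.
rewrite big_cons -IH -partialD.
- by congr (partial i _ u); apply/funext => v; rewrite big_cons.
- exact: smooth_derivable (sF k) Uu.
- exact: smooth_derivable (smooth_sum _ sF) Uu.
Qed.

Lemma is_derive_line h (p v : 'rV[R]_n) x : derivable h (p + x *: v) v ->
  is_derive x 1 (fun y : R => h (p + y *: v)) ('D_v h (p + x *: v)).
Proof.
have E : (fun k : R => k^-1 *: (((fun y : R => h (p + y *: v)) \o shift x) (k *: 1)
            - h (p + x *: v))) =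
         (fun k : R => k^-1 *: ((h \o shift (p + x *: v)) (k *: v)
            - h (p + x *: v))).
  apply/funext => k /=; congr (_ *: (h _ - _)).
  by rewrite [k *: 1]mulr1 scalerDl addrCA.
by move=> dh; apply: DeriveDef; rewrite /derivable /derive E.
Qed.

Lemma second_difference h u i j (s : R) : smooth U h -> 0 < s ->
  (forall x y, 0 <= x <= s -> 0 <= y <= s ->
     U (u + y *: delta_mx 0 j + x *: delta_mx 0 i)) ->
  exists x y, [/\ 0 <= x <= s, 0 <= y <= s &
    h (u + s *: delta_mx 0 j + s *: delta_mx 0 i) - h (u + s *: delta_mx 0 i)
    - h (u + s *: delta_mx 0 j) + h u =
    partial j (partial i h) (u + y *: delta_mx 0 j + x *: delta_mx 0 i) * s ^+ 2].
Proof.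
move=> sh s0 box.
have ss : 0 <= s <= s by apply/andP; split=> //; apply: ltW.
have s00 : 0 <= (0 : R) <= s by apply/andP; split=> //; apply: ltW.
pose phi (x : R) := h (u + s *: delta_mx 0 j + x *: delta_mx 0 i)
                    - h (u + 0 *: delta_mx 0 j + x *: delta_mx 0 i).
pose dphi (x : R) :=
  partial i h (u + s *: delta_mx 0 j + x *: delta_mx 0 i)
  - partial i h (u + 0 *: delta_mx 0 j + x *: delta_mx 0 i).
have dP x : 0 <= x <= s -> is_derive x 1 phi (dphi x).
  move=> xs.
  have d y : 0 <= y <= s -> derivable h
      (u + y *: delta_mx 0 j + x *: delta_mx 0 i) (delta_mx 0 i).
    by move=> ys; apply: (smooth_derivable sh); apply: box.
  exact: (@is_deriveB _ _ _ _ _ _ _ _ _ (is_derive_line (d s ss))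
            (is_derive_line (d 0 s00))).
have [||x xs E] := @MVT_segment _ phi dphi 0 s (ltW s0).
- by move=> x; rewrite in_itv /= => /andP[? ?]; apply: dP; rewrite !ltW.
- apply: derivable_within_continuous => x; rewrite in_itv /= => xs.
  by have [] := dP x xs.
rewrite in_itv /= in xs.
pose psi (y : R) := partial i h (u + x *: delta_mx 0 i + y *: delta_mx 0 j).
pose dpsi (y : R) := partial j (partial i h) (u + x *: delta_mx 0 i + y *: delta_mx 0 j).
have dQ y : 0 <= y <= s -> is_derive y 1 psi (dpsi y).
  move=> ys; apply: is_derive_line; apply: smooth_derivable.
    exact: smooth_partial.
  by rewrite addrAC; apply: box.
have [||y ys E'] := @MVT_segment _ psi dpsi 0 s (ltW s0).
- by move=> y; rewrite in_itv /= => /andP[? ?]; apply: dQ; rewrite !ltW.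
- apply: derivable_within_continuous => y; rewrite in_itv /= => ys.
  by have [] := dQ y ys.
rewrite in_itv /= in ys.
exists x, y; split=> //.
move: E E'; rewrite /phi /psi /dphi /dpsi !subr0 !scale0r !addr0.
rewrite (addrAC _ (x *: _) (s *: _)) (addrAC _ (x *: _) (y *: _)) => E E'.
rewrite -addrA -opprB in E *; move: E; rewrite E' => E.
by rewrite expr2 mulrA -E; ring.
Qed.

Lemma partialC h u i j : smooth U h -> U u ->
  partial i (partial j h) u = partial j (partial i h) u.
Proof.
move=> sh Uu; apply/eqP; rewrite -subr_eq0 -normr_le0; apply/ler_addgt0Pr => e e0.
rewrite add0r.
pose a := partial i (partial j h); pose b := partial j (partial i h).
have ca : {for u, continuous a}.
  by apply: smooth_continuous Uu; do 2 apply: smooth_partial.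
have cb : {for u, continuous b}.
  by apply: smooth_continuous Uu; do 2 apply: smooth_partial.
have e2 : 0 < e / 2 by rewrite divr_gt0.
have /nbhs_ballP[d /= d0 dU] : nbhs u
    [set v | [/\ U v, `|a u - a v| < e / 2 & `|b u - b v| < e / 2]].
  have NU : nbhs u U by apply: open_nbhs_nbhs.
  have /cvgrPdist_lt/(_ _ e2) Na := ca; have /cvgrPdist_lt/(_ _ e2) Nb := cb.
  apply: filterS (filterI NU (filterI Na Nb)) => v [Uv [av bv]].
  exact: And3 Uv av bv.
pose s := d / 3.
have s0 : 0 < s by rewrite divr_gt0.
have box k l x y : 0 <= x <= s -> 0 <= y <= s ->
    ball u d (u + y *: delta_mx 0 k + x *: delta_mx 0 l).
  move=> /andP[x0 xs] /andP[y0 ys]; split=> // p r; rewrite -ball_normE /= !mxE.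
  rewrite -addrA opprD addNKr normrN.
  have nd (z : R) (t : bool) : 0 <= z <= s -> 0 <= z * t%:R <= s.
    by case: t => /andP[z0 zs]; rewrite ?mulr1 ?mulr0 ?z0 ?lexx ?(le_trans z0 zs).
  have := nd y ((p == 0) && (r == k)); have := nd x ((p == 0) && (r == l)).
  rewrite x0 y0 xs ys /= => /(_ isT)/andP[a0 a1] /(_ isT)/andP[b0 b1].
  by rewrite ger0_norm ?addr_ge0 // /s in a1 b1 *; lra.
have [x [y [xs ys E1]]] := second_difference sh s0
  (fun x y hx hy => let: And3 A _ _ := dU _ (box j i x y hx hy) in A).
have [x' [y' [xs' ys' E2]]] := second_difference sh s0
  (fun x y hx hy => let: And3 A _ _ := dU _ (box i j x y hx hy) in A).
have [_ _ B] := dU _ (box j i x y xs ys).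
have [_ A _] := dU _ (box i j x' y' xs' ys').
have E : b (u + y *: delta_mx 0 j + x *: delta_mx 0 i) =
         a (u + y' *: delta_mx 0 i + x' *: delta_mx 0 j).
  apply: (mulIf (lt0r_neq0 (exprn_gt0 2 s0))).
  apply: etrans (esym E1) _; apply: etrans _ E2.
  by rewrite (addrAC u (s *: delta_mx 0 i)); congr (_ + _); apply: addrAC.
rewrite E in B; rewrite -/a -/b.
apply: le_trans (ler_distD (a (u + y' *: delta_mx 0 i + x' *: delta_mx 0 j)) _ _) _.
rewrite (splitr e); apply: lerD; apply: ltW; first exact: A.
by rewrite distrC; exact: B.
Qed.

End SmoothFunctions.

(** * Complex matrix-valued functions and their Laplacian *)

Section ComplexParts.
Context {R : rcfType}.
Implicit Types x y : R[i].

Lemma ReD x y : complex.Re (x + y) = complex.Re x + complex.Re y.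
Proof. by case: x; case: y. Qed.

Lemma ImD x y : complex.Im (x + y) = complex.Im x + complex.Im y.
Proof. by case: x; case: y. Qed.

Lemma ReN x : complex.Re (- x) = - complex.Re x.
Proof. by case: x. Qed.

Lemma ImN x : complex.Im (- x) = - complex.Im x.
Proof. by case: x. Qed.

Lemma cReM x y : complex.Re (x * y) =
  complex.Re x * complex.Re y - complex.Im x * complex.Im y.
Proof. by case: x; case: y. Qed.

Lemma cImM x y : complex.Im (x * y) =
  complex.Re x * complex.Im y + complex.Im x * complex.Re y.
Proof. by case: x; case: y. Qed.

Lemma ReZ (a : R) x : complex.Re (a%:C%C * x) = a * complex.Re x.
Proof. by rewrite cReM /= mul0r subr0. Qed.

Lemma ImZ (a : R) x : complex.Im (a%:C%C * x) = a * complex.Im x.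
Proof. by rewrite cImM /= mul0r addr0. Qed.

Lemma ReJ x : complex.Re x^* = complex.Re x.
Proof. by case: x. Qed.

Lemma ImJ x : complex.Im x^* = - complex.Im x.
Proof. by case: x. Qed.

Lemma Re_sum (I : Type) (r : seq I) (F : I -> R[i]) :
  complex.Re (\sum_(i <- r) F i) = \sum_(i <- r) complex.Re (F i).
Proof. by elim/big_rec2: _ => //= i y x _ <-; rewrite ReD. Qed.

Lemma Im_sum (I : Type) (r : seq I) (F : I -> R[i]) :
  complex.Im (\sum_(i <- r) F i) = \sum_(i <- r) complex.Im (F i).
Proof. by elim/big_rec2: _ => //= i y x _ <-; rewrite ImD. Qed.

Lemma complex_eq x y :
  complex.Re x = complex.Re y -> complex.Im x = complex.Im y -> x = y.
Proof. by case: x => a b; case: y => a' b' /= -> ->. Qed.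

Lemma conjCR (a : R) : (a%:C%C)^* = a%:C%C.
Proof. by apply: complex_eq; rewrite ?ReJ ?ImJ //= oppr0. Qed.

End ComplexParts.

Section ComplexFunctions.
Context {R : realType} {n : nat}.
Variable U : set 'rV[R]_n.
Hypothesis openU : open U.
Implicit Types (f g : 'rV[R]_n -> R[i]) (u : 'rV[R]_n).

Definition csmooth f := smooth U (fun u => complex.Re (f u)) /\
                        smooth U (fun u => complex.Im (f u)).

Definition cpartial i f u : R[i] :=
  Complex (partial i (fun v => complex.Re (f v)) u)
          (partial i (fun v => complex.Im (f v)) u).

Lemma csmooth_ext f g : f =1 g -> csmooth f -> csmooth g.
Proof. by move=> /funext ->. Qed.

Lemma csmooth_cst (k : R[i]) : csmooth (fun=> k).
Proof. by split; apply: smooth_cst. Qed.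

Lemma csmoothD f g : csmooth f -> csmooth g -> csmooth (fun u => f u + g u).
Proof.
move=> [rf mf] [rg mg]; split.
  rewrite (_ : (fun u => _) = fun u => complex.Re (f u) + complex.Re (g u)).
    exact: smoothD.
  by apply/funext => u; rewrite ReD.
rewrite (_ : (fun u => _) = fun u => complex.Im (f u) + complex.Im (g u)).
  exact: smoothD.
by apply/funext => u; rewrite ImD.
Qed.

Lemma csmoothM f g : csmooth f -> csmooth g -> csmooth (fun u => f u * g u).
Proof.
move=> [rf mf] [rg mg]; split.
  rewrite (_ : (fun u => _) = fun u => complex.Re (f u) * complex.Re (g u)
                                     + - (complex.Im (f u) * complex.Im (g u))).
    exact: (smoothD openU (smoothM openU rf rg) (smoothN openU (smoothM openU mf mg))).
  by apply/funext => u; rewrite cReM.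
rewrite (_ : (fun u => _) = fun u => complex.Re (f u) * complex.Im (g u)
                                   + complex.Im (f u) * complex.Re (g u)).
  exact: (smoothD openU (smoothM openU rf mg) (smoothM openU mf rg)).
by apply/funext => u; rewrite cImM.
Qed.

Lemma csmoothJ f : csmooth f -> csmooth (fun u => (f u)^*).
Proof.
move=> [rf mf]; split.
  rewrite (_ : (fun u => _) = fun u => complex.Re (f u)); first exact: rf.
  by apply/funext => u; rewrite ReJ.
rewrite (_ : (fun u => _) = fun u => - complex.Im (f u)); first exact: smoothN.
by apply/funext => u; rewrite ImJ.
Qed.

Lemma csmooth_sum (I : Type) (r : seq I) (F : I -> 'rV[R]_n -> R[i]) :
  (forall k, csmooth (F k)) -> csmooth (fun u => \sum_(k <- r) F k u).
Proof.
move=> sF; split.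
  rewrite (_ : (fun u => _) = fun u => \sum_(k <- r) complex.Re (F k u)).
    by apply: smooth_sum => // k; have [] := sF k.
  by apply/funext => u; rewrite Re_sum.
rewrite (_ : (fun u => _) = fun u => \sum_(k <- r) complex.Im (F k u)).
  by apply: smooth_sum => // k; have [] := sF k.
by apply/funext => u; rewrite Im_sum.
Qed.

Lemma cpartial_ext i f g u : f =1 g -> cpartial i f u = cpartial i g u.
Proof. by move=> /funext ->. Qed.

Lemma cpartial_cst i (k : R[i]) u : cpartial i (fun=> k) u = 0.
Proof. by apply: complex_eq; apply: partial_cst. Qed.

Lemma cpartialD i f g u : csmooth f -> csmooth g -> U u ->
  cpartial i (fun v => f v + g v) u = cpartial i f u + cpartial i g u.
Proof.
move=> [rf mf] [rg mg] Uu.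
have d h (sh : smooth U h) := @smooth_derivable _ _ U h u i sh Uu.
apply: complex_eq; rewrite ?ReD ?ImD /=.
  rewrite -(partialD (d _ rf) (d _ rg)).
  by congr (partial i _ u); apply/funext => v; rewrite ReD.
rewrite -(partialD (d _ mf) (d _ mg)).
by congr (partial i _ u); apply/funext => v; rewrite ImD.
Qed.

Lemma cpartialM i f g u : csmooth f -> csmooth g -> U u ->
  cpartial i (fun v => f v * g v) u = cpartial i f u * g u + f u * cpartial i g u.
Proof.
move=> [rf mf] [rg mg] Uu.
have d h (sh : smooth U h) := @smooth_derivable _ _ U h u i sh Uu.
apply: complex_eq; rewrite ?(ReD, ImD, cReM, cImM) /=.
  rewrite (_ : (fun v => _) = fun v => complex.Re (f v) * complex.Re (g v)
                                     + - (complex.Im (f v) * complex.Im (g v))).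
    rewrite (partialD (d _ (smoothM openU rf rg))
                      (d _ (smoothN openU (smoothM openU mf mg)))).
    rewrite (partialN _ (smoothM openU mf mg) Uu).
    by rewrite (partialM (d _ rf) (d _ rg)) (partialM (d _ mf) (d _ mg)); ring.
  by apply/funext => v; rewrite cReM.
rewrite (_ : (fun v => _) = fun v => complex.Re (f v) * complex.Im (g v)
                                   + complex.Im (f v) * complex.Re (g v)).
  rewrite (partialD (d _ (smoothM openU rf mg)) (d _ (smoothM openU mf rg))).
  by rewrite (partialM (d _ rf) (d _ mg)) (partialM (d _ mf) (d _ rg)); ring.
by apply/funext => v; rewrite cImM.
Qed.

Lemma cpartialJ i f u : csmooth f -> U u ->
  cpartial i (fun v => (f v)^*) u = (cpartial i f u)^*.
Proof.
move=> [rf mf] Uu; apply: complex_eq; rewrite ?ReJ ?ImJ /=.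
  by congr (partial i _ u); apply/funext => v; rewrite ReJ.
rewrite -(partialN _ mf Uu).
by congr (partial i _ u); apply/funext => v; rewrite ImJ.
Qed.

Lemma cpartial_sum i (I : Type) (r : seq I) (F : I -> 'rV[R]_n -> R[i]) u :
  (forall k, csmooth (F k)) -> U u ->
  cpartial i (fun v => \sum_(k <- r) F k v) u = \sum_(k <- r) cpartial i (F k) u.
Proof.
move=> sF Uu; apply: complex_eq; rewrite ?Re_sum ?Im_sum /=.
  rewrite -(partial_sum openU).
  - by congr (partial i _ u); apply/funext => v; rewrite Re_sum.
  - by move=> k; have [] := sF k.
  - exact: Uu.
rewrite -(partial_sum openU).
- by congr (partial i _ u); apply/funext => v; rewrite Im_sum.
- by move=> k; have [] := sF k.
- exact: Uu.
Qed.

Lemma partial_mxE a b k (F : 'rV[R]_n -> 'M[R[i]]_(a, b)) u i j :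
  partial_mx k F u i j = cpartial k (fun v => F v i j) u.
Proof. by rewrite mxE. Qed.

Lemma smooth_mx_cst a b (A : 'M[R[i]]_(a, b)) : smooth_mx U (fun=> A).
Proof. by move=> i j; apply: csmooth_cst. Qed.

Lemma smooth_mxD a b (F G : 'rV[R]_n -> 'M[R[i]]_(a, b)) :
  smooth_mx U F -> smooth_mx U G -> smooth_mx U (fun u => F u + G u).
Proof.
move=> sF sG i j; apply: (csmooth_ext _ (csmoothD (sF i j) (sG i j))) => u.
by rewrite mxE.
Qed.

Lemma smooth_mxM a b d (F : 'rV[R]_n -> 'M[R[i]]_(a, b)) (G : 'rV[R]_n -> 'M[R[i]]_(b, d)) :
  smooth_mx U F -> smooth_mx U G -> smooth_mx U (fun u => F u *m G u).
Proof.
move=> sF sG i j.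
have s k : csmooth (fun u => F u i k * G u k j) by exact: (csmoothM (sF i k) (sG k j)).
by apply: (csmooth_ext _ (csmooth_sum _ s)) => u; rewrite mxE.
Qed.

Lemma smooth_mxJ a b (F : 'rV[R]_n -> 'M[R[i]]_(a, b)) :
  smooth_mx U F -> smooth_mx U (fun u => map_mx Num.conj (F u)).
Proof.
by move=> sF i j; apply: (csmooth_ext _ (csmoothJ (sF i j))) => u; rewrite mxE.
Qed.

Lemma smooth_mx_tr a b (F : 'rV[R]_n -> 'M[R[i]]_(a, b)) :
  smooth_mx U F -> smooth_mx U (fun u => (F u)^T).
Proof.
by move=> sF i j; apply: (csmooth_ext _ (sF j i)) => u; rewrite mxE.
Qed.

Lemma smooth_mxZ a b (k : R[i]) (F : 'rV[R]_n -> 'M[R[i]]_(a, b)) :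
  smooth_mx U F -> smooth_mx U (fun u => k *: F u).
Proof.
move=> sF i j; apply: (csmooth_ext _ (csmoothM (csmooth_cst k) (sF i j))) => u.
by rewrite mxE.
Qed.

Lemma smooth_partial_mx a b k (F : 'rV[R]_n -> 'M[R[i]]_(a, b)) :
  smooth_mx U F -> smooth_mx U (partial_mx k F).
Proof.
move=> sF i j; have [sr si] := sF i j; split.
  rewrite (_ : (fun u => _) = partial k (fun v => complex.Re (F v i j))).
    exact: smooth_partial.
  by apply/funext => u; rewrite mxE.
rewrite (_ : (fun u => _) = partial k (fun v => complex.Im (F v i j))).
  exact: smooth_partial.
by apply/funext => u; rewrite mxE.
Qed.

Lemma partial_mx_eq a b k (F G : 'rV[R]_n -> 'M[R[i]]_(a, b)) u :
  U u -> {in U, F =1 G} -> partial_mx k F u = partial_mx k G u.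
Proof.
move=> Uu FG; apply/matrixP => i j; rewrite !mxE.
by congr Complex; apply: (@partial_eq _ _ U openU _ _ _ u Uu) => v Uv; rewrite (FG v Uv).
Qed.

Lemma partial_mx_cst a b k (A : 'M[R[i]]_(a, b)) u : partial_mx k (fun=> A) u = 0.
Proof. by apply/matrixP => i j; rewrite partial_mxE cpartial_cst mxE. Qed.

Lemma partial_mxD a b k (F G : 'rV[R]_n -> 'M[R[i]]_(a, b)) u :
  smooth_mx U F -> smooth_mx U G -> U u ->
  partial_mx k (fun v => F v + G v) u = partial_mx k F u + partial_mx k G u.
Proof.
move=> sF sG Uu; apply/matrixP => i j; rewrite [RHS]mxE !partial_mxE.
rewrite -(cpartialD _ (sF i j) (sG i j) Uu).
by apply: cpartial_ext => v; rewrite mxE.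
Qed.

Lemma partial_mxM a b d k (F : 'rV[R]_n -> 'M[R[i]]_(a, b)) (G : 'rV[R]_n -> 'M[R[i]]_(b, d)) u :
  smooth_mx U F -> smooth_mx U G -> U u ->
  partial_mx k (fun v => F v *m G v) u =
    partial_mx k F u *m G u + F u *m partial_mx k G u.
Proof.
move=> sF sG Uu; apply/matrixP => i j; rewrite partial_mxE.
rewrite (@cpartial_ext _ _ (fun v => \sum_l F v i l * G v l j)); last first.
  by move=> v; rewrite mxE.
rewrite (cpartial_sum _ _ _ Uu); last by move=> l; exact: (csmoothM (sF i l) (sG l j)).
rewrite !mxE -big_split /=.
by apply: eq_bigr => l _; rewrite (cpartialM _ (sF i l) (sG l j) Uu) !partial_mxE.
Qed.

Lemma partial_mxJ a b k (F : 'rV[R]_n -> 'M[R[i]]_(a, b)) u :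
  smooth_mx U F -> U u ->
  partial_mx k (fun v => map_mx Num.conj (F v)) u = map_mx Num.conj (partial_mx k F u).
Proof.
move=> sF Uu; apply/matrixP => i j; rewrite [RHS]mxE !partial_mxE.
rewrite -(cpartialJ _ (sF i j) Uu).
by apply: cpartial_ext => v; rewrite mxE.
Qed.

Lemma partial_mx_tr a b k (F : 'rV[R]_n -> 'M[R[i]]_(a, b)) u :
  partial_mx k (fun v => (F v)^T) u = (partial_mx k F u)^T.
Proof.
apply/matrixP => i j; rewrite [RHS]mxE !partial_mxE.
by apply: cpartial_ext => v; rewrite mxE.
Qed.

Lemma partial_mxZ a b k (c : R[i]) (F : 'rV[R]_n -> 'M[R[i]]_(a, b)) u :
  smooth_mx U F -> U u ->
  partial_mx k (fun v => c *: F v) u = c *: partial_mx k F u.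
Proof.
move=> sF Uu; apply/matrixP => i j; rewrite [RHS]mxE !partial_mxE.
rewrite (@cpartial_ext _ _ (fun v => c * F v i j)); last by move=> v; rewrite mxE.
by rewrite (cpartialM _ (csmooth_cst c) (sF i j) Uu) cpartial_cst mul0r add0r.
Qed.

Lemma partial_mxC a b k l (F : 'rV[R]_n -> 'M[R[i]]_(a, b)) u :
  smooth_mx U F -> U u ->
  partial_mx k (partial_mx l F) u = partial_mx l (partial_mx k F) u.
Proof.
move=> sF Uu; apply/matrixP => i j; have [sr si] := sF i j.
have E p q : partial_mx p (partial_mx q F) u i j =
    Complex (partial p (partial q (fun v => complex.Re (F v i j))) u)
            (partial p (partial q (fun v => complex.Im (F v i j))) u).
  by rewrite mxE; congr Complex; congr (partial p _ u); apply/funext => v; rewrite mxE.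
apply: etrans (E k l) _; apply: etrans _ (esym (E l k)).
exact: (f_equal2 (@Complex R) (partialC openU k l sr Uu) (partialC openU k l si Uu)).
Qed.

Section Laplacian.
Variable g : 'I_n -> 'I_n -> 'rV[R]_n -> R.

Definition covariant_hessian_mx a b (F : 'rV[R]_n -> 'M[R[i]]_(a, b)) i j u :=
  partial_mx i (partial_mx j F) u -
  \sum_k (christoffel g k i j u)%:C%C *: partial_mx k F u.

Lemma laplacian_mxE a b (F : 'rV[R]_n -> 'M[R[i]]_(a, b)) u :
  laplacian_mx g F u =
  - \sum_i \sum_j (metric_inv g u i j)%:C%C *: covariant_hessian_mx F i j u.
Proof.
apply/matrixP => p q; rewrite !mxE summxE; apply: complex_eq.
  rewrite ReN Re_sum /=; congr (- _); apply: eq_bigr => i _.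
  rewrite summxE Re_sum; apply: eq_bigr => j _.
  rewrite !mxE ReZ ReD ReN summxE Re_sum /=; congr (_ * (_ - _)).
    by congr (partial i _ u); apply/funext => v; rewrite mxE.
  by apply: eq_bigr => k _; rewrite !mxE ReZ.
rewrite ImN Im_sum /=; congr (- _); apply: eq_bigr => i _.
rewrite summxE Im_sum; apply: eq_bigr => j _.
rewrite !mxE ImZ ImD ImN summxE Im_sum /=; congr (_ * (_ - _)).
  by congr (partial i _ u); apply/funext => v; rewrite mxE.
by apply: eq_bigr => k _; rewrite !mxE ImZ.
Qed.

End Laplacian.
End ComplexFunctions.

Section LaplacianRules.
Context {R : realType} {n : nat}.
Variables (U : set 'rV[R]_n) (g : 'I_n -> 'I_n -> 'rV[R]_n -> R).
Hypothesis openU : open U.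

Local Notation hess := (covariant_hessian_mx g).

Lemma covariant_hessian_mx_eq a b (F G : 'rV[R]_n -> 'M[R[i]]_(a, b)) i j u :
  U u -> {in U, F =1 G} -> hess F i j u = hess G i j u.
Proof.
move=> Uu FG; rewrite /covariant_hessian_mx.
have dFG (k : 'I_n) v : v \in U -> partial_mx k F v = partial_mx k G v.
  by move=> /set_mem Uv; exact: (partial_mx_eq openU k Uv FG).
rewrite (partial_mx_eq openU i Uu (dFG j)); apply: (congr1 (fun A => _ - A)).
by apply: eq_bigr => k _; rewrite (dFG k u (mem_set Uu)).
Qed.

Lemma laplacian_mx_eq a b (F G : 'rV[R]_n -> 'M[R[i]]_(a, b)) u :
  U u -> {in U, F =1 G} -> laplacian_mx g F u = laplacian_mx g G u.
Proof.
move=> Uu FG; rewrite (laplacian_mxE g F u) (laplacian_mxE g G u).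
apply: (congr1 (fun A => - A)); apply: eq_bigr => i _; apply: eq_bigr => j _.
by rewrite (covariant_hessian_mx_eq i j Uu FG).
Qed.

Lemma laplacian_mx_cst a b (A : 'M[R[i]]_(a, b)) u : laplacian_mx g (fun=> A) u = 0.
Proof.
rewrite laplacian_mxE big1 ?oppr0 // => i _; apply: big1 => j _.
have dA (k : 'I_n) : partial_mx k (fun=> A) = fun=> 0.
  by apply/funext => v; exact: partial_mx_cst.
rewrite /covariant_hessian_mx (dA j) partial_mx_cst big1 ?subrr ?scaler0 // => k _.
by rewrite (dA k) scaler0.
Qed.

Lemma covariant_hessian_mxD a b (F G : 'rV[R]_n -> 'M[R[i]]_(a, b)) i j u :
  smooth_mx U F -> smooth_mx U G -> U u ->
  hess (fun v => F v + G v) i j u = hess F i j u + hess G i j u.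
Proof.
move=> sF sG Uu; rewrite /covariant_hessian_mx.
have dD (k : 'I_n) v : v \in U ->
    partial_mx k (fun w => F w + G w) v = partial_mx k F v + partial_mx k G v.
  by move=> /set_mem Uv; exact: (partial_mxD k sF sG Uv).
rewrite (partial_mx_eq openU i Uu (dD j)).
rewrite (partial_mxD i (smooth_partial_mx j sF) (smooth_partial_mx j sG) Uu).
rewrite [RHS]addrACA -opprD -big_split /=; apply: (congr1 (fun A => _ - A)).
by apply: eq_bigr => k _; rewrite (dD k u (mem_set Uu)) scalerDr.
Qed.

Lemma laplacian_mxD a b (F G : 'rV[R]_n -> 'M[R[i]]_(a, b)) u :
  smooth_mx U F -> smooth_mx U G -> U u ->
  laplacian_mx g (fun v => F v + G v) u = laplacian_mx g F u + laplacian_mx g G u.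
Proof.
move=> sF sG Uu; rewrite (laplacian_mxE g (fun v => F v + G v) u).
rewrite (laplacian_mxE g F u) (laplacian_mxE g G u) -opprD -big_split /=.
apply: (congr1 (fun A => - A)); apply: eq_bigr => i _; rewrite -big_split /=.
by apply: eq_bigr => j _; rewrite (covariant_hessian_mxD i j sF sG Uu) scalerDr.
Qed.

Lemma map_conjZ a b (x : R) (A : 'M[R[i]]_(a, b)) :
  map_mx Num.conj (x%:C%C *: A) = x%:C%C *: map_mx Num.conj A.
Proof. by apply/matrixP => i j; rewrite !mxE rmorphM /= conjCR. Qed.

Lemma exchange_symmetric (V : lmodType R[i]) (T : 'I_n -> 'I_n -> V) (A : 'M[R]_n) :
  (forall i j, A i j = A j i) ->
  \sum_i \sum_j (A i j)%:C%C *: T j i = \sum_i \sum_j (A i j)%:C%C *: T i j.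
Proof.
move=> As; rewrite exchange_big; apply: eq_bigr => i _; apply: eq_bigr => j _.
by rewrite (As j i).
Qed.

Lemma addr_regroup (V : zmodType) (a b c d x y : V) :
  a + b + (c + d) - (x + y) = a - x + (d - y) + (c + b).
Proof.
rewrite [c + d]addrC (addrACA a) -(addrA (a + d)) [b + c - _]addrC.
by rewrite (addrA (a + d)) opprD (addrACA a d) [b + c]addrC.
Qed.

Lemma covariant_hessian_mxM a b d (F : 'rV[R]_n -> 'M[R[i]]_(a, b))
    (G : 'rV[R]_n -> 'M[R[i]]_(b, d)) i j u :
  smooth_mx U F -> smooth_mx U G -> U u ->
  hess (fun v => F v *m G v) i j u =
    hess F i j u *m G u + F u *m hess G i j u +
    (partial_mx i F u *m partial_mx j G u + partial_mx j F u *m partial_mx i G u).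
Proof.
move=> sF sG Uu; rewrite /covariant_hessian_mx.
have dM (k : 'I_n) v : v \in U -> partial_mx k (fun w => F w *m G w) v =
    partial_mx k F v *m G v + F v *m partial_mx k G v.
  by move=> /set_mem Uv; exact: (partial_mxM openU k sF sG Uv).
have dF := smooth_partial_mx j sF; have dG := smooth_partial_mx j sG.
rewrite (partial_mx_eq openU i Uu (dM j)).
rewrite (partial_mxD i (smooth_mxM openU dF sG) (smooth_mxM openU sF dG) Uu).
rewrite (partial_mxM openU i dF sG Uu) (partial_mxM openU i sF dG Uu).
rewrite mulmxBl mulmxBr mulmx_suml mulmx_sumr.
have -> : \sum_k (christoffel g k i j u)%:C%C *: partial_mx k (fun v => F v *m G v) u =
    \sum_k ((christoffel g k i j u)%:C%C *: partial_mx k F u) *m G u +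
    \sum_k F u *m ((christoffel g k i j u)%:C%C *: partial_mx k G u).
  rewrite -big_split /=; apply: eq_bigr => k _.
  by rewrite (dM k u (mem_set Uu)) scalerDr scalemxAl scalemxAr.
exact: addr_regroup.
Qed.

Lemma laplacian_mxM a b d (F : 'rV[R]_n -> 'M[R[i]]_(a, b))
    (G : 'rV[R]_n -> 'M[R[i]]_(b, d)) u :
  smooth_mx U F -> smooth_mx U G -> U u ->
  (forall i j, metric_inv g u i j = metric_inv g u j i) ->
  laplacian_mx g (fun v => F v *m G v) u =
    laplacian_mx g F u *m G u + F u *m laplacian_mx g G u -
    (\sum_i \sum_j (metric_inv g u i j)%:C%C *:
        (partial_mx i F u *m partial_mx j G u)) *+ 2.
Proof.
move=> sF sG Uu gs; rewrite (laplacian_mxE g (fun v => F v *m G v) u).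
rewrite (laplacian_mxE g F u) (laplacian_mxE g G u) mulNmx mulmxN -!opprD.
apply: (congr1 (fun A => - A)); rewrite mulmx_suml mulmx_sumr mulr2n.
have gsw := exchange_symmetric (fun i j => partial_mx i F u *m partial_mx j G u) gs.
rewrite -[X in _ + _ + (_ + X)]gsw -!big_split /=; apply: eq_bigr => i _.
rewrite mulmx_suml mulmx_sumr -!big_split /=; apply: eq_bigr => j _.
rewrite (covariant_hessian_mxM i j sF sG Uu); move: (hess F i j u) (hess G i j u).
by move=> HF HG; rewrite !scalerDr scalemxAl scalemxAr.
Qed.

Lemma covariant_hessian_mxJ a b (F : 'rV[R]_n -> 'M[R[i]]_(a, b)) i j u :
  smooth_mx U F -> U u ->
  hess (fun v => map_mx Num.conj (F v)) i j u = map_mx Num.conj (hess F i j u).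
Proof.
move=> sF Uu; rewrite /covariant_hessian_mx.
have dJ (k : 'I_n) v : v \in U -> partial_mx k (fun w => map_mx Num.conj (F w)) v =
    map_mx Num.conj (partial_mx k F v).
  by move=> /set_mem Uv; exact: (partial_mxJ k sF Uv).
rewrite (partial_mx_eq openU i Uu (dJ j)).
rewrite (partial_mxJ i (smooth_partial_mx j sF) Uu) map_mxB map_mx_sum.
apply: (congr1 (fun A => _ - A)); apply: eq_bigr => k _.
by rewrite (dJ k u (mem_set Uu)) map_conjZ.
Qed.

Lemma laplacian_mxJ a b (F : 'rV[R]_n -> 'M[R[i]]_(a, b)) u :
  smooth_mx U F -> U u ->
  laplacian_mx g (fun v => map_mx Num.conj (F v)) u =
    map_mx Num.conj (laplacian_mx g F u).
Proof.
move=> sF Uu; rewrite (laplacian_mxE g (fun v => map_mx Num.conj (F v)) u).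
rewrite (laplacian_mxE g F u) map_mxN map_mx_sum; apply: (congr1 (fun A => - A)).
apply: eq_bigr => i _; rewrite map_mx_sum; apply: eq_bigr => j _.
by rewrite (covariant_hessian_mxJ i j sF Uu) map_conjZ.
Qed.

End LaplacianRules.

(** * Pseudo-Hermitian algebra *)

Fact Psi_key : unit. Proof. by []. Qed.

(* Psi over an arbitrary closed field; locked, like outer below, so that
   unification does not unfold the sum. *)
Definition Psi_form {K : numClosedFieldType} (c : K) {m : nat} (z w : 'cV[K]_m.+1) : K :=
  locked_with Psi_key (c * (z ord0 0)^* * w ord0 0 +
  \sum_(j < m) (z (lift ord0 j) 0)^* * w (lift ord0 j) 0).

Lemma Psi_formE {K : numClosedFieldType} (c : K) {m : nat} (z w : 'cV[K]_m.+1) :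
  Psi_form c z w = c * (z ord0 0)^* * w ord0 0 +
  \sum_(j < m) (z (lift ord0 j) 0)^* * w (lift ord0 j) 0.
Proof. by rewrite /Psi_form unlock. Qed.

Section PseudoHermitian.
Context {K : numClosedFieldType} (c : K) {m : nat}.
Local Notation vec := 'cV[K]_m.+1.
Local Notation mat := 'M[K]_m.+1.
Local Notation Psi := (Psi_form c).
Hypothesis cJ : c^* = c.
Implicit Types (z w u v : vec) (A B : mat) (a b : K).

Definition gram : mat := diag_mx (\row_j (if j == ord0 then c else 1)).

Definition star z : 'rV[K]_m.+1 := (map_mx Num.conj z)^T *m gram.

Definition outer z w : mat := locked_with Psi_key (z *m star w).

Lemma outerE z w : outer z w = z *m star w.
Proof. by rewrite /outer unlock. Qed.

Lemma starE z j : star z 0 j = (z j 0)^* * (if j == ord0 then c else 1).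
Proof. by rewrite /star mul_mx_diag !mxE. Qed.

Lemma PsiE z w : Psi z w = (star z *m w) 0 0.
Proof.
rewrite Psi_formE mxE big_ord_recl starE eqxx [c * _]mulrC; congr (_ + _).
by apply: eq_bigr => j _; rewrite starE /= mulr1.
Qed.

Lemma star_mul z w : star z *m w = (Psi z w)%:M.
Proof. by rewrite [LHS]mx11_scalar PsiE. Qed.

Lemma starD z w : star (z + w) = star z + star w.
Proof. by rewrite /star raddfD /= linearD /= mulmxDl. Qed.

Lemma starZ a z : star (a *: z) = a^* *: star z.
Proof. by rewrite /star map_mxZ linearZ /= -scalemxAl. Qed.

Lemma PsiDl z w v : Psi (z + w) v = Psi z v + Psi w v.
Proof. by rewrite !PsiE starD mulmxDl mxE. Qed.

Lemma PsiDr z w v : Psi v (z + w) = Psi v z + Psi v w.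
Proof. by rewrite !PsiE mulmxDr mxE. Qed.

Lemma PsiZl a z v : Psi (a *: z) v = a^* * Psi z v.
Proof. by rewrite !PsiE starZ -scalemxAl mxE. Qed.

Lemma PsiNl z v : Psi (- z) v = - Psi z v.
Proof. by rewrite -scaleN1r PsiZl rmorphN rmorph1 mulN1r. Qed.

Lemma PsiZr a z v : Psi v (a *: z) = a * Psi v z.
Proof. by rewrite !PsiE -scalemxAr mxE. Qed.

Lemma PsiNr z v : Psi v (- z) = - Psi v z.
Proof. by rewrite -scaleN1r PsiZr mulN1r. Qed.

Lemma Psi0r v : Psi v 0 = 0.
Proof. by rewrite !PsiE mulmx0 mxE. Qed.

Lemma Psi_sumr (I : Type) (r : seq I) (F : I -> vec) v :
  Psi v (\sum_(i <- r) F i) = \sum_(i <- r) Psi v (F i).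
Proof.
elim: r => [|i r IH]; last by rewrite !big_cons PsiDr IH.
by rewrite !big_nil Psi0r.
Qed.

Lemma PsiJ z w : (Psi z w)^* = Psi w z.
Proof.
rewrite !Psi_formE rmorphD rmorph_sum !rmorphM /= conjCK cJ; congr (_ + _).
  by rewrite -!mulrA; congr (_ * _); rewrite mulrC.
by apply: eq_bigr => j _; rewrite rmorphM /= conjCK mulrC.
Qed.

Lemma Psi_suml (I : Type) (r : seq I) (F : I -> vec) v :
  Psi (\sum_(i <- r) F i) v = \sum_(i <- r) Psi (F i) v.
Proof.
by rewrite -PsiJ Psi_sumr rmorph_sum; apply: eq_bigr => i _; rewrite /= PsiJ.
Qed.

Lemma outer_mulv z w v : outer z w *m v = Psi w v *: z.
Proof. by rewrite outerE -mulmxA star_mul mul_mx_scalar. Qed.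

Lemma outerM z w z' w' : outer z w *m outer z' w' = Psi w z' *: outer z w'.
Proof. by rewrite (outerE z') mulmxA outer_mulv outerE -scalemxAl. Qed.

Lemma tr_outer z w : \tr (outer z w) = Psi w z.
Proof. by rewrite outerE mxtrace_mulC star_mul mxtrace_scalar. Qed.

Lemma tr_mulmx_outer A z w : \tr (A *m outer z w) = Psi w (A *m z).
Proof. by rewrite outerE mulmxA -outerE tr_outer. Qed.

Lemma outerDl z w v : outer (z + w) v = outer z v + outer w v.
Proof. by rewrite !outerE mulmxDl. Qed.

Lemma outerDr z w v : outer v (z + w) = outer v z + outer v w.
Proof. by rewrite !outerE starD mulmxDr. Qed.

Lemma outerZl a z v : outer (a *: z) v = a *: outer z v.
Proof. by rewrite !outerE -scalemxAl. Qed.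

Lemma outerZr a z v : outer v (a *: z) = a^* *: outer v z.
Proof. by rewrite !outerE starZ -scalemxAr. Qed.

Lemma outerNl z v : outer (- z) v = - outer z v.
Proof. by rewrite !outerE mulNmx. Qed.

Lemma outerNr z v : outer v (- z) = - outer v z.
Proof. by rewrite -[- z]scaleN1r outerZr rmorphN rmorph1 scaleN1r. Qed.

Lemma mx_eqv A B : (forall v, A *m v = B *m v) -> A = B.
Proof. move=> AB; apply/matrixP => i j; have /colP/(_ i) := AB (delta_mx j 0).
by rewrite -!colE !mxE. Qed.

Definition padj A : mat := gram *m (map_mx Num.conj A)^T *m gram.

Lemma padjZ a A : padj (a *: A) = a^* *: padj A.
Proof. by rewrite /padj map_mxZ linearZ /= -scalemxAr -scalemxAl. Qed.

Lemma padjN A : padj (- A) = - padj A.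
Proof. by rewrite -scaleN1r padjZ rmorphN rmorph1 scaleN1r. Qed.

Hypothesis cc : c * c = 1.

Lemma gramK : gram *m gram = 1%:M.
Proof.
rewrite /gram mulmx_diag -diag_const_mx; congr diag_mx.
by apply/rowP => j; rewrite !mxE; case: eqP => _; rewrite ?mulr1 // cc.
Qed.

Lemma gram_adj : (map_mx Num.conj gram)^T = gram.
Proof.
rewrite /gram map_diag_mx tr_diag_mx; congr diag_mx.
by apply/rowP => j; rewrite !mxE; case: (j == ord0); [exact: cJ|exact: rmorph1].
Qed.

Lemma conjmx_trK p q (A : 'M[K]_(p, q)) :
  (map_mx Num.conj (map_mx Num.conj A)^T)^T = A.
Proof. by apply/matrixP => i j; rewrite !mxE conjCK. Qed.

Lemma star_padj A z : star (padj A *m z) = star z *m A.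
Proof.
rewrite /star /padj !map_mxM !trmx_mul gram_adj conjmx_trK.
by rewrite -!mulmxA gramK mulmx1.
Qed.

Lemma Psi_padj A z w : Psi (padj A *m z) w = Psi z (A *m w).
Proof. by rewrite !PsiE star_padj mulmxA. Qed.

Lemma outer_mulmx z w A : outer z w *m A = outer z (padj A *m w).
Proof. by rewrite !outerE star_padj mulmxA. Qed.

Lemma mulmx_outer z w A : A *m outer z w = outer (A *m z) w.
Proof. by rewrite !outerE mulmxA. Qed.

Lemma padj_outer z w : padj (outer z w) = outer w z.
Proof.
rewrite /padj !outerE /star !map_mxM !trmx_mul gram_adj conjmx_trK.
by rewrite !mulmxA gramK mul1mx.
Qed.

End PseudoHermitian.

(** * Frames of a hypersurface *)

Section Horizontal.
Context {R : realType} (c : R) {m : nat}.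
Local Notation vec := 'cV[R[i]]_m.+1.
Local Notation Psi := (Psi_form (c%:C%C : R[i])).
Hypothesis cc : c * c = 1.

Let cJ : (c%:C%C)^* = c%:C%C :> R[i].
Proof. exact: conjCR. Qed.

Lemma Re_PsiC (z w : vec) : complex.Re (Psi z w) = complex.Re (Psi w z).
Proof. by rewrite -(PsiJ cJ) ReJ. Qed.

Lemma Psi_head0 (v : vec) : v ord0 0 = 0 ->
  Psi v v = \sum_(j < m) (v (lift ord0 j) 0)^* * v (lift ord0 j) 0.
Proof. by move=> v0; rewrite Psi_formE v0 mulr0 add0r. Qed.

Lemma Psi_head0_ge0 (v : vec) : v ord0 0 = 0 -> 0 <= Psi v v.
Proof.
move=> /Psi_head0 ->; apply: sumr_ge0 => j _.
by rewrite mulrC mul_conjC_ge0.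
Qed.

Lemma Psi_head0_eq0 (v : vec) : v ord0 0 = 0 -> Psi v v = 0 -> v = 0.
Proof.
move=> v0; rewrite Psi_head0 // => /eqP; rewrite psumr_eq0; last first.
  by move=> j _; rewrite mulrC mul_conjC_ge0.
move=> /allP s; apply/colP => i; rewrite mxE.
have [j ->|->] := unliftP ord0 i; last by [].
have := s j (mem_index_enum _); rewrite /= mulrC mul_conjC_eq0.
by move/eqP.
Qed.

(* The vector z_0 e - e_0 z has head 0, hence nonnegative square. *)
Lemma horizontal_isotropic_eq0 (z e : vec) :
  Psi z z = c%:C%C -> Psi z e = 0 -> Psi e e = 0 -> e = 0.
Proof.
move=> zz ze ee; apply: Psi_head0_eq0 => //.
have /eqP : (c - 1) * (c + 1) = 0 by rewrite mulrDr !mulrBl cc; ring.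
rewrite mulf_eq0 subr_eq0 addr_eq0 => /orP[] /eqP c1.
  move: ee; rewrite Psi_formE c1 mul1r => /eqP; rewrite paddr_eq0.
  - by case/andP => + _; rewrite mulrC mul_conjC_eq0 => /eqP.
  - by rewrite mulrC mul_conjC_ge0.
  - by apply: sumr_ge0 => j _; rewrite mulrC mul_conjC_ge0.
pose w := z ord0 0 *: e + (- e ord0 0) *: z.
have w0 : w ord0 0 = 0 by rewrite !mxE; ring.
have := Psi_head0_ge0 w0.
have ez : Psi e z = 0 by rewrite -(PsiJ cJ) ze rmorph0.
rewrite /w !(PsiDl, PsiDr, PsiZl, PsiZr) zz ze ez ee c1 !(mulr0, addr0, add0r).
have -> : (-1 : R)%:C%C = -1 by rewrite rmorphN rmorph1.
rewrite rmorphN mulrN1 opprK mulNr mulrC oppr_ge0.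
by move=> le0; apply/eqP; rewrite -mul_conjC_eq0 eq_le le0 mul_conjC_ge0.
Qed.

End Horizontal.

Section Resolution.
Context {R : realType} (c : R) {m : nat}.
Local Notation vec := 'cV[R[i]]_m.+1.
Local Notation mat := 'M[R[i]]_m.+1.
Local Notation Psi := (Psi_form (c%:C%C : R[i])).
Local Notation dim := (m.*2.-1).
Local Notation Cc := (c%:C%C : R[i]).
Variables (E : 'I_dim -> vec) (z n : vec) (t : R).
Hypotheses (cc : c * c = 1) (m0 : (0 < m)%N) (t0 : t != 0).
Hypotheses (zz : Psi z z = Cc) (zE : forall i, Psi z (E i) = 0)
  (zn : Psi z n = 0) (nn : Psi n n = t%:C%C)
  (nE : forall i, complex.Re (Psi n (E i)) = 0).
Hypothesis Efree : forall a : 'I_dim -> R,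
  \sum_i (a i)%:C%C *: E i = 0 -> forall i, a i = 0.

Let cC2 : Cc * Cc = 1.
Proof. by rewrite -rmorphM cc. Qed.

Let cJ : Cc^* = Cc.
Proof. exact: conjCR. Qed.

Let gm : 'M[R]_dim := \matrix_(i, j) complex.Re (Psi (E i) (E j)).

Lemma gram_matrix_unit : gm \in unitmx.
Proof.
rewrite -row_free_unit; apply: inj_row_free => v vg.
pose e := \sum_i (v 0 i)%:C%C *: E i.
suff e0 : e = 0 by apply/rowP => i; rewrite mxE (Efree e0).
have ze : Psi z e = 0.
  by rewrite Psi_sumr big1 // => i _; rewrite PsiZr zE mulr0.
have ee : complex.Re (Psi e e) = 0.
  rewrite Psi_sumr Re_sum big1 // => j _; rewrite PsiZr ReZ (Psi_suml cJ) Re_sum.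
  rewrite (_ : \sum_i _ = (v *m gm) 0 j); first by rewrite vg mxE mulr0.
  by rewrite mxE; apply: eq_bigr => i _; rewrite mxE PsiZl conjCR ReZ.
have ie : complex.Im (Psi e e) = 0.
  have := congr1 (@complex.Im R) (PsiJ cJ e e); rewrite ImJ => /eqP.
  by rewrite eq_sym -subr_eq0 opprK -mulr2n mulrn_eq0 /= => /eqP.
by apply: (horizontal_isotropic_eq0 cc zz ze); apply: complex_eq.
Qed.

Lemma gram_matrix_sym : gm^T = gm.
Proof. by apply/matrixP => i j; rewrite !mxE Re_PsiC. Qed.

Lemma gram_inv_sym i j : invmx gm i j = invmx gm j i.
Proof. by rewrite -{1}gram_matrix_sym -trmx_inv mxE. Qed.

Let realify (v : vec) : 'rV[R]_(m.+1 + m.+1) :=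
  row_mx (\row_i complex.Re (v i 0)) (\row_i complex.Im (v i 0)).

Let realify_inj v w : realify v = realify w -> v = w.
Proof.
move=> /eq_row_mx[/rowP hr /rowP hi]; apply/colP => i; apply: complex_eq.
  by have := hr i; rewrite !mxE.
by have := hi i; rewrite !mxE.
Qed.

Let realifyD v w : realify (v + w) = realify v + realify w.
Proof.
rewrite /realify add_row_mx; congr row_mx; apply/rowP => i.
  by rewrite !mxE ReD.
by rewrite !mxE ImD.
Qed.

Let realifyZ (a : R) v : realify (a%:C%C *: v) = a *: realify v.
Proof.
rewrite /realify scale_row_mx; congr row_mx; apply/rowP => i.
  by rewrite !mxE ReZ.
by rewrite !mxE ImZ.
Qed.

Let realify0 : realify 0 = 0.
Proof. by have := realifyZ 0 0; rewrite !scale0r. Qed.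

Let realify_sum (I : finType) (a : I -> R) (F : I -> vec) :
  realify (\sum_i (a i)%:C%C *: F i) = \sum_i a i *: realify (F i).
Proof.
rewrite (big_morph realify realifyD realify0).
by apply: eq_bigr => i _; rewrite realifyZ.
Qed.

Let frame (s : 'I_dim + 'I_3) : vec :=
  match s with inl i => E i | inr k => [tuple z; 'i%C *: z; n]`_k end.

Let frame_sum (a : 'I_dim + 'I_3 -> R) :
  \sum_s (a s)%:C%C *: frame s = \sum_i (a (inl i))%:C%C *: E i +
    ((a (inr 0))%:C%C + (a (inr 1))%:C%C * 'i%C) *: z + (a (inr 2))%:C%C *: n.
Proof.
rewrite big_sumType /= !big_ord_recl big_ord0 addr0 scalerDl -scalerA !addrA.
rewrite /frame /=.
have -> : lift ord0 (lift ord0 ord0) = 2 :> 'I_3 by apply: val_inj.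
by have -> : lift ord0 ord0 = 1 :> 'I_3 by apply: val_inj.
Qed.

Lemma frame_span (v : vec) : exists (a : 'I_dim -> R) (b : R[i]) (b' : R),
  v = \sum_i (a i)%:C%C *: E i + b *: z + b'%:C%C *: n.
Proof.
pose N := #|{: 'I_dim + 'I_3}|.
pose A : 'M[R]_(N, m.+1 + m.+1) := \matrix_i realify (frame (enum_val i)).
have comb (y : 'rV[R]_N) :
    y *m A = realify (\sum_s (y 0 (enum_rank s))%:C%C *: frame s).
  rewrite realify_sum mulmx_sum_row (reindex _ (onW_bij _ (@enum_rank_bij _))) /=.
  by apply: eq_bigr => s _; rewrite rowK enum_rankK.
have An : N = (m.+1 + m.+1)%N.
  by rewrite /N card_sum !card_ord addn3 prednK ?double_gt0 // -addnn addSn addnS.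
have Af : row_full A.
  suff /eqP rA : row_free A by apply/eqP; rewrite rA.
  apply: inj_row_free => y; rewrite comb -realify0 => /realify_inj; rewrite frame_sum.
  set b0 := y 0 _; set b1 := y 0 _; set b2 := y 0 _; set S := \sum_i _ => S0.
  have zS : Psi z S = 0 by rewrite Psi_sumr big1 // => i _; rewrite PsiZr zE mulr0.
  have := congr1 (Psi z) S0; rewrite !PsiDr !PsiZr zS zz zn mulr0 addr0 add0r.
  rewrite Psi0r => /(congr1 ( *%R^~ Cc)).
  rewrite mul0r -mulrA cC2 mulr1 => b01.
  have [b00 b10] : b0 = 0 /\ b1 = 0.
    have := congr1 (@complex.Re R) b01; have := congr1 (@complex.Im R) b01.
    by rewrite ReD ImD ReZ ImZ /= !mulr0 !mulr1 addr0 add0r.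
  have nz : Psi n z = 0 by rewrite -(PsiJ cJ) zn rmorph0.
  have nS : complex.Re (Psi n S) = 0.
    by rewrite Psi_sumr Re_sum big1 // => i _; rewrite PsiZr ReZ nE mulr0.
  have := congr1 (fun x => complex.Re (Psi n x)) S0.
  rewrite !PsiDr !ReD nS !PsiZr nz mulr0 nn ReZ /= !add0r.
  rewrite Psi0r => /eqP.
  rewrite mulf_eq0 (negPf t0) orbF => /eqP b20.
  move: S0; rewrite b01 b20 !scale0r !addr0 => /Efree y0.
  apply/rowP => k; rewrite mxE -(enum_valK k); case: (enum_val k) => [i|[[|[|[|]]] // ?]].
  - exact: y0.
  - by rewrite -[RHS]b00; congr (y 0 (enum_rank (inr _))); apply: val_inj.
  - by rewrite -[RHS]b10; congr (y 0 (enum_rank (inr _))); apply: val_inj.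
  - by rewrite -[RHS]b20; congr (y 0 (enum_rank (inr _))); apply: val_inj.
have /submxP[y] : (realify v <= A)%MS by apply: submx_full.
rewrite comb frame_sum; set b := (X in X *: z); set b' := y 0 _.
by move=> /realify_inj vE; exists (fun i => y 0 (enum_rank (inl i))), b, b'.
Qed.

Lemma frame_resolution (v : vec) :
  v = \sum_k \sum_l (invmx gm k l)%:C%C *:
        ((complex.Re (Psi (E k) v))%:C%C *: E l) +
      (Cc * Psi z v) *: z + (complex.Re (Psi n v) / t)%:C%C *: n.
Proof.
have [a [b [b' ->]]] := frame_span v; set S := \sum_i (a i)%:C%C *: E i.
have zS : Psi z S = 0 by rewrite Psi_sumr big1 // => i _; rewrite PsiZr zE mulr0.
have nz : Psi n z = 0 by rewrite -(PsiJ cJ) zn rmorph0.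
have nS : complex.Re (Psi n S) = 0.
  by rewrite Psi_sumr Re_sum big1 // => i _; rewrite PsiZr ReZ nE mulr0.
congr (_ + _ *: _ + _%:C%C *: _); last first.
- by rewrite !PsiDr !ReD nS !PsiZr nz mulr0 nn ReZ /= !add0r mulfK.
- by rewrite !PsiDr !PsiZr zS zn zz mulr0 addr0 add0r mulrC -mulrA cC2 mulr1.
rewrite exchange_big; apply: eq_bigr => l _ /=.
under eq_bigr => k _ do rewrite scalerA -rmorphM.
rewrite -scaler_suml -rmorph_sum; congr (_%:C%C *: _).
have Ek k : complex.Re (Psi (E k) (S + b *: z + b'%:C%C *: n)) =
    \sum_i a i * gm i k.
  have Ez : Psi (E k) z = 0 by rewrite -(PsiJ cJ) zE rmorph0.
  rewrite !PsiDr !ReD !PsiZr Ez mulr0 ReZ (Re_PsiC _ (E k) n) nE mulr0 !addr0.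
  by rewrite Psi_sumr Re_sum; apply: eq_bigr => i _; rewrite PsiZr ReZ mxE Re_PsiC.
under eq_bigr => k _ do rewrite Ek mulr_sumr.
rewrite exchange_big /= (bigD1 l) //= [X in _ + X]big1 ?addr0.
  under eq_bigr => k _ do rewrite mulrCA [_ * gm _ _]mulrC.
  rewrite -mulr_sumr; have := congr1 (fun B : 'M[R]_dim => B l l) (mulmxV gram_matrix_unit).
  by rewrite !mxE eqxx => ->; rewrite mulr1.
move=> i il; under eq_bigr => k _ do rewrite mulrCA [_ * gm _ _]mulrC.
rewrite -mulr_sumr; have := congr1 (fun B : 'M[R]_dim => B i l) (mulmxV gram_matrix_unit).
by rewrite !mxE (negPf il) => ->; rewrite mulr0.
Qed.

End Resolution.

Lemma combine_linear (K : comPzRingType) p (v z n : 'cV[K]_p) (I a b b' c t : K) :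
  I * I = -1 ->
  v - (c * a) *: z - (b * t) *: n +
    - I *: (I *: v - (c * (I * a)) *: z - (b' * t) *: n) =
  2 *: v - (2 * c * a) *: z - ((b - I * b') * t) *: n.
Proof.
move=> II; apply/colP => i; rewrite !mxE; apply/eqP; rewrite -subr_eq0; apply/eqP.
move: (v i 0) (z i 0) (n i 0) => vi zi ni.
by transitivity ((I * I + 1) * (c * a * zi - vi)); [ring | rewrite II addNr mul0r].
Qed.

Lemma combine_antilinear (K : comPzRingType) p (v z n : 'cV[K]_p) (I a b b' c t : K) :
  I * I = -1 ->
  v - (c * a) *: z - (b * t) *: n +
    I *: (I *: v - (c * (I * a)) *: z - (b' * t) *: n) =
  - ((b + I * b') * t) *: n.
Proof.
move=> II; apply/colP => i; rewrite !mxE; apply/eqP; rewrite -subr_eq0; apply/eqP.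
move: (v i 0) (z i 0) (n i 0) => vi zi ni.
by transitivity ((I * I + 1) * (vi - c * a * zi)); [ring | rewrite II addNr mul0r].
Qed.

Section ContractedResolution.
Context {R : realType} (c : R) {m d : nat}.
Local Notation vec := 'cV[R[i]]_m.+1.
Local Notation Psi := (Psi_form (c%:C%C : R[i])).
Local Notation Cc := (c%:C%C : R[i]).
Variables (E : 'I_d -> vec) (gI : 'M[R]_d) (z n : vec) (t : R).
Hypothesis resolution : forall v : vec,
  v = \sum_k \sum_l (gI k l)%:C%C *: ((complex.Re (Psi (E k) v))%:C%C *: E l) +
      (Cc * Psi z v) *: z + (complex.Re (Psi n v) / t)%:C%C *: n.

Let I : R[i] := 'i%C.
Let II : I * I = -1.
Proof. by rewrite -sqr_i expr2. Qed.

Let realify (a : R[i]) : (complex.Re a)%:C%C - I * (complex.Re (I * a))%:C%C = a.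
Proof. by case: a => a b; apply: complex_eq; rewrite /I /=; ring. Qed.

Let realifyJ (a : R[i]) : (complex.Re a)%:C%C + I * (complex.Re (I * a))%:C%C = a^*.
Proof. by case: a => a b; apply: complex_eq; rewrite ?ReJ ?ImJ /I /=; ring. Qed.

Let real_part (v : vec) :=
  \sum_k \sum_l (gI k l)%:C%C *: ((complex.Re (Psi (E k) v))%:C%C *: E l).

Let real_partE (v : vec) :
  real_part v = v - (Cc * Psi z v) *: z - (complex.Re (Psi n v) / t)%:C%C *: n.
Proof. by rewrite {2}(resolution v) -/(real_part v) addrAC addrK addrK. Qed.

Let contraction_split (F : R[i] -> R[i]) (a : R[i]) (v : vec) :
  (forall x, F x = (complex.Re x)%:C%C + a * (complex.Re (I * x))%:C%C) ->
  \sum_k \sum_l (gI k l)%:C%C *: (F (Psi (E k) v) *: E l) =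
  real_part v + a *: real_part (I *: v).
Proof.
move=> FE; rewrite /real_part scaler_sumr -big_split; apply: eq_bigr => k _ /=.
rewrite scaler_sumr -big_split; apply: eq_bigr => l _ /=.
by rewrite PsiZr FE scalerDl scalerDr !scalerA; congr (_ + _ *: _); ring.
Qed.

Lemma contraction_linear (v : vec) :
  \sum_k \sum_l (gI k l)%:C%C *: (Psi (E k) v *: E l) =
  2 *: v - (2 * Cc * Psi z v) *: z - (Psi n v / t%:C%C) *: n.
Proof.
rewrite (@contraction_split id (- I)); last by move=> x; rewrite mulNr realify.
rewrite !real_partE !PsiZr -[in RHS](realify (Psi n v)) !rmorphM /= !fmorphV.
exact: combine_linear.
Qed.

Lemma contraction_antilinear (v : vec) :
  \sum_k \sum_l (gI k l)%:C%C *: (Psi v (E k) *: E l) = - (Psi v n / t%:C%C) *: n.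
Proof.
transitivity (\sum_k \sum_l (gI k l)%:C%C *: ((Psi (E k) v)^* *: E l)).
  by apply: eq_bigr => k _; apply: eq_bigr => l _; rewrite (PsiJ (conjCR c)).
rewrite (@contraction_split Num.conj I); last by move=> x; rewrite realifyJ.
rewrite !real_partE !PsiZr -[in RHS](PsiJ (conjCR c)) -[in RHS](realifyJ (Psi n v)) !rmorphM /= !fmorphV.
exact: combine_antilinear.
Qed.

End ContractedResolution.

Lemma mxtraceB (K : pzRingType) p (A B : 'M[K]_p) : \tr (A - B) = \tr A - \tr B.
Proof. exact: raddfB. Qed.

Lemma mxtrace_sum (K : pzRingType) p (I : Type) (r : seq I) (F : I -> 'M[K]_p) :
  \tr (\sum_(i <- r) F i) = \sum_(i <- r) \tr (F i).
Proof. exact: raddf_sum. Qed.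

Section Contraction.
Context {K : numClosedFieldType} (c : K) {m d : nat}.
Local Notation vec := 'cV[K]_m.+1.
Local Notation mat := 'M[K]_m.+1.
Local Notation Psi := (Psi_form c).
Local Notation outer := (outer c).
Variables (E : 'I_d -> vec) (gI : 'I_d -> 'I_d -> K) (z n : vec) (t : K).
Hypotheses (cJ : c^* = c) (cc : c * c = 1) (t0 : t != 0).
Hypothesis gIs : forall k l, gI k l = gI l k.
Hypothesis contraction_linear : forall v,
  \sum_k \sum_l gI k l *: (Psi (E k) v *: E l) =
  2 *: v - (2 * c * Psi z v) *: z - (Psi n v / t) *: n.
Hypothesis contraction_antilinear : forall v,
  \sum_k \sum_l gI k l *: (Psi v (E k) *: E l) = - (Psi v n / t) *: n.
Hypotheses (zz : Psi z z = c) (zE : forall i, Psi z (E i) = 0)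
  (zn : Psi z n = 0) (nn : Psi n n = t).

Local Notation C1 := (1%:M : mat).

Lemma contraction_outer :
  \sum_k \sum_l gI k l *: outer (E k) (E l) =
  2 *: C1 - (2 * c) *: outer z z - t^-1 *: outer n n.
Proof.
apply: mx_eqv => v.
have -> : (2 *: C1 - (2 * c) *: outer z z - t^-1 *: outer n n) *m v =
    2 *: v - (2 * c * Psi z v) *: z - (Psi n v / t) *: n.
  rewrite 2!mulmxBl -3!scalemxAl mul1mx 2!outer_mulv !scalerA.
  by rewrite [_^-1 * _]mulrC.
rewrite -contraction_linear mulmx_suml exchange_big; apply: eq_bigr => k _ /=.
rewrite mulmx_suml; apply: eq_bigr => l _.
by rewrite -scalemxAl outer_mulv (gIs k l).
Qed.

Let Ez k : Psi (E k) z = 0.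
Proof. by rewrite -(PsiJ cJ) zE rmorph0. Qed.

Lemma contraction_trace :
  \sum_k \sum_l gI k l * Psi (E k) (E l) = (2 * m)%:R - 1.
Proof.
have -> : (2 * m)%:R - 1 = \tr (2 *: C1 - (2 * c) *: outer z z - t^-1 *: outer n n).
  rewrite 2!mxtraceB 3!mxtraceZ mxtrace1 2!tr_outer zz nn mulVf // -mulrA cc mulr1.
  by rewrite -natrM mulnS natrD; ring.
rewrite -contraction_outer raddf_sum exchange_big /=.
apply: eq_bigr => k _; rewrite raddf_sum; apply: eq_bigr => l _ /=.
by rewrite mxtraceZ tr_outer (gIs l k).
Qed.

(* The derivative of the projector onto the line of z in the direction E k. *)
Definition tangent (k : 'I_d) : mat := c *: (outer (E k) z + outer z (E k)).

Lemma trace_tangent i j :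
  \tr (tangent i *m tangent j) = c * (Psi (E j) (E i) + Psi (E i) (E j)).
Proof.
rewrite /tangent -scalemxAl -scalemxAr scalerA cc scale1r.
rewrite mulmxDl !mulmxDr !outerM zE Ez !scale0r add0r addr0.
by rewrite mxtraceD !mxtraceZ !tr_outer zz; ring.
Qed.

Lemma contraction_tangent :
  \sum_k \sum_l gI k l *: (tangent k *m tangent l) =
  c *: (2 *: C1 - (2 * c) *: outer z z - t^-1 *: outer n n) +
  ((2 * m)%:R - 1) *: outer z z.
Proof.
rewrite -contraction_outer -contraction_trace scaler_sumr scaler_suml -big_split.
apply: eq_bigr => k _ /=; rewrite scaler_sumr scaler_suml -big_split.
apply: eq_bigr => l _ /=.
rewrite /tangent -scalemxAl -scalemxAr [c *: (c *: _)]scalerA cc scale1r.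
rewrite mulmxDl !mulmxDr !outerM zE Ez zz !scale0r add0r addr0.
by rewrite scalerDr !scalerA [gI k l * c]mulrC.
Qed.

Section Mixed.
Variables (J : vec -> vec) (x : K).
Hypotheses (JK : involutive J) (PsiJJ : forall u v, Psi (J u) (J v) = Psi v u).
Hypotheses (JD : {morph J : u v / u + v}) (JZ : forall a v, J (a *: v) = a^* *: J v).
Local Notation w := (J z).
Local Notation q := (Psi w z).
Hypotheses (qq : q * q^* = x) (x0 : x != 0) (x1 : 1 - x != 0).
Hypotheses (nE : n = q *: w - (c * x) *: z) (tE : t = c * x * (1 - x)).

Definition tangentJ (k : 'I_d) : mat := c *: (outer (J (E k)) w + outer w (J (E k))).

Let xJ : x^* = x.
Proof. by rewrite -qq rmorphM /= conjCK mulrC. Qed.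

Let ww : Psi w w = c.
Proof. by rewrite PsiJJ. Qed.

Let zw : Psi z w = q^*.
Proof. by rewrite PsiJ. Qed.

Let nw : Psi n w = c * (1 - x) * q^*.
Proof.
rewrite nE PsiDl PsiNl !PsiZl ww zw !rmorphM /= cJ xJ; ring.
Qed.

Let Jn : J n = q^* *: z - (c * x) *: w.
Proof. by rewrite nE JD -scaleNr !JZ JK rmorphN rmorphM /= cJ xJ scaleNr. Qed.

Let c0 : c != 0.
Proof. by apply: contra_eq_neq cc => ->; rewrite mul0r eq_sym oner_eq0. Qed.

Let c_sign : c = 1 \/ c = -1.
Proof.
have /eqP : (c - 1) * (c + 1) = 0 by rewrite mulrDr !mulrBl cc; ring.
by rewrite mulf_eq0 subr_eq0 addr_eq0 => /orP[] /eqP; [left|right].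
Qed.

Let q0 : q != 0.
Proof. by apply: contraNneq x0 => q0; rewrite -qq q0 mul0r. Qed.

Let qJ : q^* = x / q.
Proof. by rewrite -qq [q * _]mulrC mulfK. Qed.

Let PsiJl u v : Psi (J u) v = Psi (J v) u.
Proof. by rewrite -{1}[v]JK PsiJJ. Qed.

Let a : vec := w - (c * q^*) *: z.

Let contraction_w : \sum_k \sum_l gI k l *: (Psi (E l) w *: E k) = a.
Proof.
rewrite exchange_big /=; under eq_bigr do under eq_bigr do rewrite gIs.
rewrite contraction_linear nw zw tE /a {1}nE qJ; move: (q) q0 => Q Q0.
by apply/colP => i; rewrite !mxE; field; rewrite c0 x0 x1 Q0.
Qed.

Let contraction_EJ u :
  \sum_k \sum_l gI k l *: (Psi (J (E l)) u *: E k) = - (Psi (J n) u / t) *: n.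
Proof.
rewrite exchange_big /= [in RHS]PsiJl -contraction_antilinear.
by apply: eq_bigr => k _; apply: eq_bigr => l _; rewrite gIs PsiJl.
Qed.

Let contraction_JE : \sum_k \sum_l gI k l * Psi (J (E l)) (E k) = - (Psi (J n) n / t).
Proof.
have F : \sum_k \sum_l gI k l *: outer (E k) (J (E l)) = - t^-1 *: outer n (J n).
  apply: mx_eqv => u; rewrite -scalemxAl outer_mulv scalerA.
  transitivity (- (Psi (J n) u / t) *: n); last by congr (_ *: _); ring.
  rewrite -contraction_EJ mulmx_suml; apply: eq_bigr => k _.
  by rewrite mulmx_suml; apply: eq_bigr => l _; rewrite -scalemxAl outer_mulv.
transitivity (\tr (- t^-1 *: outer n (J n))); last first.
  by rewrite mxtraceZ tr_outer; ring.
rewrite -F raddf_sum; apply: eq_bigr => k _; rewrite raddf_sum /=.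
by apply: eq_bigr => l _; rewrite mxtraceZ tr_outer.
Qed.

Hypothesis gIJ : forall k l, (gI k l)^* = gI k l.

Let contraction_JEJ :
  \sum_k \sum_l gI k l * Psi (E k) (J (E l)) = c * q^*.
Proof.
have e : Psi (J n) n / t = - (c * q).
  rewrite Jn PsiDl PsiNl !PsiZl zn mulr0 add0r.
  rewrite -(PsiJ cJ n w) nw !(rmorphN, rmorphM) /= conjCK cJ ?(rmorphB, rmorph1) /= xJ tE.
  by field; rewrite c0 x0 x1.
have -> : c * q^* = (c * q)^* by rewrite rmorphM /= cJ.
rewrite -[c * q]opprK -e -contraction_JE rmorph_sum.
apply: eq_bigr => k _; rewrite rmorph_sum; apply: eq_bigr => l _ /=.
by rewrite rmorphM /= gIJ PsiJ.
Qed.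

Let contraction_wJ u :
  \sum_k \sum_l gI k l * (Psi (J (E l)) u * Psi (E k) w) = Psi (J a) u.
Proof.
rewrite PsiJl -contraction_w Psi_sumr exchange_big; apply: eq_bigr => k _ /=.
rewrite Psi_sumr; apply: eq_bigr => l _.
by rewrite !PsiZr gIs PsiJl (mulrC (Psi _ w)).
Qed.

Lemma contraction_mixed :
  \sum_k \sum_l gI k l *: (tangent k *m tangentJ l) =
  (1 - x)^-1 *: (outer z z + outer w w - (c * q^*) *: outer z w
                 - (c * q) *: outer w z).
Proof.
apply: mx_eqv => u.
transitivity (\sum_k \sum_l (Psi w u *: (gI k l *: (Psi (E l) w *: E k)) +
    (gI k l * Psi (E k) (J (E l))) *: (Psi w u *: z) +
    q^* *: (gI k l *: (Psi (J (E l)) u *: E k)) +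
    (gI k l * (Psi (J (E l)) u * Psi (E k) w)) *: z)).
  rewrite mulmx_suml; apply: eq_bigr => k _; rewrite mulmx_suml; apply: eq_bigr => l _.
  rewrite -scalemxAl /tangent /tangentJ -scalemxAl -scalemxAr [c *: (c *: _)]scalerA.
  rewrite cc scale1r.
  rewrite mulmxDl !mulmxDr !outerM 3!mulmxDl -!scalemxAl !outer_mulv.
  have -> : Psi z (J (E l)) = Psi (E l) w by rewrite -(PsiJJ w (E l)) JK.
  rewrite zw; move: (Psi _ _) (Psi _ _) (Psi _ _) (Psi _ _) (q^* ) => b1 b2 b3 b4 b5.
  by apply/colP => i; rewrite !mxE; ring.
under eq_bigr do rewrite !big_split /= -!scaler_sumr -!scaler_suml.
rewrite !big_split /= -!scaler_sumr -!scaler_suml.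
rewrite contraction_w contraction_JEJ contraction_EJ contraction_wJ.
have Ja : J a = z - (c * q) *: w.
  by rewrite /a JD -scaleNr !JZ JK rmorphN rmorphM /= conjCK cJ scaleNr.
rewrite Ja Jn /a nE tE !(PsiDl, PsiNl, PsiZl).
rewrite -!scalemxAl 3!mulmxDl !mulNmx -!scalemxAl !outer_mulv.
rewrite !rmorphM /= conjCK cJ xJ qJ; move: (q) q0 (Psi w u) (Psi z u) => Q Q0 b1 b2.
apply/colP => i; rewrite !mxE; move: (z i 0) (w i 0) => zi wi.
by case: c_sign => ->; field; rewrite x0 x1 Q0.
Qed.

End Mixed.
End Contraction.

Section ProjectorLaplacian.
Context {K : numClosedFieldType} (c : K) {m : nat}.
Local Notation vec := 'cV[K]_m.+1.
Local Notation mat := 'M[K]_m.+1.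
Local Notation Psi := (Psi_form c).
Local Notation outer := (outer c).
Local Notation M := (m%:R : K).
Variables (z w n : vec) (t x h b : K) (B : mat).
Hypotheses (cJ : c^* = c) (cc : c * c = 1).
Hypotheses (zz : Psi z z = c) (ww : Psi w w = c).
Local Notation q := (Psi w z).
Hypotheses (qq : q * q^* = x) (x0 : x != 0) (x1 : 1 - x != 0).
Hypotheses (nE : n = q *: w - (c * x) *: z) (tE : t = c * x * (1 - x)).
Let xJ : x^* = x.
Proof. by rewrite -qq rmorphM /= conjCK mulrC. Qed.

Let zw : Psi z w = q^*.
Proof. by rewrite PsiJ. Qed.

Lemma normal_orthogonal : Psi z n = 0.
Proof.
rewrite nE PsiDr PsiNr !PsiZr zz zw qq -[X in X + _]mulr1 -cc; ring.
Qed.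

Let nz : Psi n z = 0.
Proof. by rewrite -(PsiJ cJ) normal_orthogonal rmorph0. Qed.

Let c0 : c != 0.
Proof. by apply: contra_eq_neq cc => ->; rewrite mul0r eq_sym oner_eq0. Qed.

Let q0 : q != 0.
Proof. by apply: contraNneq x0 => q0; rewrite -qq q0 mul0r. Qed.

Let qJ : q^* = x / q.
Proof. by rewrite -qq [q * _]mulrC mulfK. Qed.

Let c_sign : c = 1 \/ c = -1.
Proof.
have /eqP : (c - 1) * (c + 1) = 0 by rewrite mulrDr !mulrBl cc; ring.
by rewrite mulf_eq0 subr_eq0 addr_eq0 => /orP[] /eqP; [left|right].
Qed.

Lemma normal_square : Psi n n = t.
Proof.
rewrite {2}nE PsiDr PsiNr !PsiZr nz mulr0 subr0 nE PsiDl PsiNl !PsiZl ww zw.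
rewrite rmorphM /= cJ xJ qJ tE; move: (q) q0 => Q Q0.
by case: c_sign => ->; field.
Qed.

Lemma trace_mixed :
  \tr ((1 - x)^-1 *: (outer z z + outer w w
     - (c * q^*) *: outer z w - (c * q) *: outer w z)) = 2 * c.
Proof.
rewrite mxtraceZ 2!mxtraceB mxtraceD 2!mxtraceZ !tr_outer zz ww zw qJ.
by move: (q) q0 => Q Q0; field; rewrite x1 Q0.
Qed.

(* B is the value of - Delta X: Bz says that it is orthogonal to the tangent
   space, Bprod comes from X X = X and Btr from tr(X Y) being constant. *)
Hypotheses (Bsa : padj c B = B) (hJ : h^* = h) (Bz : B *m z = b *: z + h *: n).
Hypothesis Bprod : B = B *m (c *: outer z z) + (c *: outer z z) *m B +
  2 *: (c *: (2 *: 1%:M - (2 * c) *: outer z z - t^-1 *: outer n n) +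
        ((2 * m)%:R - 1) *: outer z z).
Hypothesis Btr : c * Psi w (B *m w) + c * (Psi w (B *m w))^* + 4 * c = 0.

Let BE : B = (c * (b + b^*)) *: outer z z + (c * h) *: (outer n z + outer z n) +
  2 *: (c *: (2 *: 1%:M - (2 * c) *: outer z z - t^-1 *: outer n n) +
        ((2 * m)%:R - 1) *: outer z z).
Proof.
rewrite {1}Bprod -scalemxAl -scalemxAr mulmx_outer (outer_mulmx cJ cc) Bsa Bz.
rewrite outerDl outerDr !outerZl !outerZr hJ; congr (_ + _).
move: (outer z z) (outer n z) (outer z n) => P1 P2 P3.
by apply/matrixP => i j; rewrite !mxE; ring.
Qed.

Let BvE v : B *m v = (c * (b + b^*) * Psi z v) *: z +
  (c * h) *: (Psi z v *: n + Psi n v *: z) +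
  2 *: (c *: (2 *: v - (2 * c) *: (Psi z v *: z) - t^-1 *: (Psi n v *: n)) +
        ((2 * m)%:R - 1) *: (Psi z v *: z)).
Proof.
by rewrite BE !(mulmxDl, mulNmx, =^~ scalemxAl, mul1mx, outer_mulv) scalerA.
Qed.

Let bE : b^* = - (2 * (2 * M - 1) * c).
Proof.
have z0 : Psi z z != 0 by rewrite zz.
have /(congr1 (Psi z)) := Bz; rewrite BvE nz !scale0r.
rewrite !(PsiDr, PsiZr, PsiNr, Psi0r) normal_orthogonal zz natrM => e.
have {}e : (b + b^* + 2 * (2 * M - 1) * c) * c = b * c.
  rewrite -[b * c]addr0 -[in RHS](mulr0 h) -e.
  by case: c_sign => ->; ring.
have /eqP : (b^* + 2 * (2 * M - 1) * c) * c = 0.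
  by transitivity ((b + b^* + 2 * (2 * M - 1) * c) * c - b * c); [ring|rewrite e subrr].
by rewrite mulf_eq0 (negPf c0) orbF addr_eq0 => /eqP.
Qed.

Let bE' : b = - (2 * (2 * M - 1) * c).
Proof.
rewrite -[b]conjCK bE !(rmorphN, rmorphM, rmorphB) /= cJ.
by rewrite !(rmorph_nat, rmorph1).
Qed.

Local Notation kap := (c / (1 - x)).
Local Notation S := (q^* *: outer z w + q *: outer w z).

Let nzE : outer n z + outer z n = S - (2 * c * x) *: outer z z.
Proof.
rewrite nE outerDl outerDr outerNl outerNr !outerZl !outerZr rmorphM /= cJ xJ.
move: (outer z z) (outer w z) (outer z w) => P1 P2 P3.
by apply/matrixP => i j; rewrite !mxE; ring.
Qed.

Let nnE : outer n n = x *: outer w w - (c * x) *: S + x ^+ 2 *: outer z z.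
Proof.
rewrite nE !(outerDl, outerDr, outerNl, outerNr, outerZl, outerZr) rmorphM /= cJ xJ qJ.
move: (outer z z) (outer w z) (outer z w) (outer w w) => P1 P2 P3 P4.
apply/matrixP => i j; rewrite !mxE; move: (q) q0 => Q Q0.
by case: c_sign => ->; field.
Qed.

Let wn : Psi w n = c * (1 - x) * q.
Proof. by rewrite nE PsiDr PsiNr !PsiZr ww; ring. Qed.

Let nw : Psi n w = c * (1 - x) * q^*.
Proof. by rewrite -(PsiJ cJ) wn !(rmorphM, rmorphB, rmorph1) /= cJ xJ. Qed.

Let wBw : Psi w (B *m w) = 2 - 4 * M * x + 2 * h * x * (1 - x).
Proof.
rewrite BvE !(PsiDr, PsiZr, PsiNr) ww wn nw zw bE bE' natrM tE qJ; move: (q) q0 => Q Q0.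
by case: c_sign => ->; field; rewrite x0 x1 Q0.
Qed.

Let hE : h = 2 * (M * x - 1) / (x * (1 - x)).
Proof.
have wJ : (Psi w (B *m w))^* = Psi w (B *m w).
  by rewrite wBw !(rmorphD, rmorphN, rmorphM, rmorphB) /= !(rmorph_nat, rmorph1) xJ hJ.
move: Btr; rewrite wJ wBw => e.
apply: (mulfI (_ : 4 * c * x * (1 - x) != 0)).
  by rewrite !mulf_neq0 // pnatr_eq0.
by apply/eqP; rewrite -subr_eq0 -e; apply/eqP; field; rewrite x0 x1.
Qed.

Lemma projector_laplacianE :
  B = (4 * c) *: 1%:M - (kap * (4 * M - 2) * c) *: outer z z
      - (2 * kap * c) *: outer w w + (2 * kap * ((M + 1) * x - 1) / x) *: S.
Proof.
rewrite BE bE bE' nzE nnE hE tE natrM.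
move: (outer z z) (outer w w) S => P1 P2 P3.
apply/matrixP => i j; rewrite !mxE.
by case: c_sign => ->; field; rewrite x0 x1.
Qed.

End ProjectorLaplacian.

Lemma opp_regroup (K : comPzRingType) p q (a b d e : K) (A B C D : 'M[K]_(p, q)) :
  - (- a *: A + b *: B + d *: C - e *: D) = a *: A - b *: B - d *: C + e *: D.
Proof. by apply/matrixP => i j; rewrite !mxE; ring. Qed.

Lemma opp_product_rule (K : comPzRingType) p (A B C D E : 'M[K]_p) :
  - (A *m B + C *m D - E) = - A *m B + C *m - D + E.
Proof. by rewrite mulNmx mulmxN opprB opprD addrC. Qed.

Lemma symmetrize (K : comPzRingType) p (a a' b d e : K) (X Y P Q : 'M[K]_p) :
  a' = a + a -> e = d - b ->
  - a *: (X + Y) - b *: P + d *: Q + (- a *: (Y + X) - b *: Q + d *: P) =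
  - a' *: (X + Y) + e *: (P + Q).
Proof. by move=> -> ->; apply/matrixP => i j; rewrite !mxE; ring. Qed.

Lemma collect_combination (K0 K : comPzRingType) (f : {rmorphism K0 -> K}) p
    (a b d c4 k k2 sig w v : K0) (I X Y S : 'M[K]_p) :
  f a *: (- f c4 *: I + f k *: X + f k2 *: Y - f sig *: S) +
  f b *: (- f c4 *: I + f k *: Y + f k2 *: X - f sig *: S) +
  f d *: (- f w *: (X + Y) + f v *: S) =
  f (k * a + k2 * b - w * d) *: X + f (k * b + k2 * a - w * d) *: Y +
  f (v * d - sig * (a + b)) *: S + f (- (c4 * (a + b))) *: I.
Proof.
rewrite !(rmorphN, rmorphB, rmorphD, rmorphM).
by apply/matrixP => i j; rewrite !mxE; ring.
Qed.

Lemma opp_regroup3 (K : comPzRingType) p q (a b d : K) (A B C : 'M[K]_(p, q)) :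
  - (- a *: A - b *: B + d *: C) = a *: A + b *: B - d *: C.
Proof. by apply/matrixP => i j; rewrite !mxE; ring. Qed.

Lemma distribute_scale (K : comPzRingType) p q (k c a b d : K) (A B C D : 'M[K]_(p, q)) :
  c * c = 1 -> d = k * c ->
  d *: (A + B - (c * a) *: C - (c * b) *: D) =
  k *: (c *: A + c *: B - a *: C - b *: D).
Proof.
move=> cc ->; apply/matrixP => i j; rewrite !mxE.
have e y z : k * c * (c * y * z) = k * (y * z) by rewrite !mulrA -(mulrA k) cc mulr1.
by rewrite 2!mulrBr !e; ring.
Qed.

Section ProductLaplacian.
Context {K : fieldType} {p : nat}.
Variables (X Y LX LY : 'M[K]_p) (c kap sig x a : K).
Hypotheses (XX : X *m X = X) (YY : Y *m Y = Y).
Hypotheses (XYX : X *m Y *m X = x *: X) (YXY : Y *m X *m Y = x *: Y).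
Hypothesis LXE : LX = (4 * c) *: 1%:M - (kap * (4 * a - 2)) *: X - (2 * kap) *: Y
  + sig *: (X *m Y + Y *m X).
Hypothesis LYE : LY = (4 * c) *: 1%:M - (kap * (4 * a - 2)) *: Y - (2 * kap) *: X
  + sig *: (Y *m X + X *m Y).

Lemma product_laplacianE :
  LX *m Y + X *m LY + 2 *: (kap *: (X + Y - X *m Y - Y *m X)) =
  (4 * c + sig * x) *: (X + Y) + (2 * sig - kap * (8 * a - 2)) *: (X *m Y)
  - (2 * kap) *: (Y *m X).
Proof.
have -> : LX *m Y = (4 * c) *: Y - (kap * (4 * a - 2)) *: (X *m Y) - (2 * kap) *: Y
  + sig *: (X *m Y + x *: Y).
  rewrite LXE !(mulmxDl, mulNmx, =^~ scalemxAl, mul1mx) YY YXY.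
  by rewrite -(mulmxA X Y Y) YY.
have -> : X *m LY = (4 * c) *: X - (kap * (4 * a - 2)) *: (X *m Y) - (2 * kap) *: X
  + sig *: (x *: X + X *m Y).
  by rewrite LYE !(mulmxDr, mulmxN, =^~ scalemxAr, mulmx1, mulmxA) XX XYX.
move: (X *m Y) (Y *m X) => P Q.
by apply/matrixP => i j; rewrite !mxE; ring.
Qed.

End ProductLaplacian.

Section LaplacianLinear.
Context {R : realType} {n : nat}.
Variables (U : set 'rV[R]_n) (g : 'I_n -> 'I_n -> 'rV[R]_n -> R).
Hypothesis openU : open U.

Lemma laplacian_mx_tr a b (F : 'rV[R]_n -> 'M[R[i]]_(a, b)) u :
  laplacian_mx g (fun v => (F v)^T) u = (laplacian_mx g F u)^T.
Proof.
apply/matrixP => i j; rewrite !mxE.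
have e (h : R[i] -> R) : (fun v => h ((F v)^T i j)) = (fun v => h (F v j i)).
  by apply/funext => v; rewrite mxE.
by rewrite (e (@complex.Re R)) (e (@complex.Im R)).
Qed.

Lemma laplacian_mx_sum a b (I : Type) (r : seq I) (F : I -> 'rV[R]_n -> 'M[R[i]]_(a, b)) u :
  (forall k, smooth_mx U (F k)) -> U u ->
  smooth_mx U (fun v => \sum_(k <- r) F k v) /\
  laplacian_mx g (fun v => \sum_(k <- r) F k v) u = \sum_(k <- r) laplacian_mx g (F k) u.
Proof.
move=> sF Uu; elim: r => [|k r [sr IH]].
  rewrite big_nil (_ : (fun v => _) = fun=> 0); last first.
    by apply/funext => v; rewrite big_nil.
  by split; [exact: smooth_mx_cst|exact: laplacian_mx_cst].
rewrite (_ : (fun v => _) = fun v => F k v + \sum_(l <- r) F l v); last first.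
  by apply/funext => v; rewrite big_cons.
split; first exact: (smooth_mxD openU (sF k) sr).
by rewrite big_cons -IH; exact: (laplacian_mxD g openU (sF k) sr Uu).
Qed.

Section Symmetric.
Variable u : 'rV[R]_n.
Hypotheses (Uu : U u) (gs : forall i j, metric_inv g u i j = metric_inv g u j i).

Lemma laplacian_mxMl a b d (A : 'M[R[i]]_(a, b)) (F : 'rV[R]_n -> 'M[R[i]]_(b, d)) :
  smooth_mx U F -> laplacian_mx g (fun v => A *m F v) u = A *m laplacian_mx g F u.
Proof.
move=> sF; rewrite (laplacian_mxM openU (smooth_mx_cst openU A) sF Uu gs).
rewrite laplacian_mx_cst mul0mx add0r big1 ?mul0rn ?subr0 // => i _.
by apply: big1 => j _; rewrite partial_mx_cst mul0mx scaler0.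
Qed.

Lemma laplacian_mxMr a b d (F : 'rV[R]_n -> 'M[R[i]]_(a, b)) (A : 'M[R[i]]_(b, d)) :
  smooth_mx U F -> laplacian_mx g (fun v => F v *m A) u = laplacian_mx g F u *m A.
Proof.
move=> sF; rewrite (laplacian_mxM openU sF (smooth_mx_cst openU A) Uu gs).
rewrite laplacian_mx_cst mulmx0 addr0 big1 ?mul0rn ?subr0 // => i _.
by apply: big1 => j _; rewrite partial_mx_cst mulmx0 scaler0.
Qed.

Lemma laplacian_mxZ a b (k : R[i]) (F : 'rV[R]_n -> 'M[R[i]]_(a, b)) :
  smooth_mx U F -> laplacian_mx g (fun v => k *: F v) u = k *: laplacian_mx g F u.
Proof.
move=> sF; rewrite -mul_scalar_mx -(laplacian_mxMl _ sF); congr (laplacian_mx g _ u).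
by apply/funext => v; rewrite mul_scalar_mx.
Qed.

Lemma laplacian_trace a (F : 'rV[R]_n -> 'M[R[i]]_a) :
  smooth_mx U F ->
  laplacian_mx g (fun v => (\tr (F v))%:M : 'M[R[i]]_1) u = (\tr (laplacian_mx g F u))%:M.
Proof.
move=> sF.
have tE (A : 'M[R[i]]_a) : (\tr A)%:M =
    \sum_i (delta_mx 0 i : 'rV[R[i]]_a) *m A *m (delta_mx i 0 : 'cV[R[i]]_a).
  rewrite [RHS]mx11_scalar summxE; congr (_%:M); apply: eq_bigr => i _.
  by rewrite -rowE -colE !mxE.
have sFi i : smooth_mx U (fun v => (delta_mx 0 i : 'rV[R[i]]_a) *m F v *m (delta_mx i 0 : 'cV[R[i]]_a)).
  have sl := smooth_mxM openU (smooth_mx_cst openU (delta_mx 0 i : 'rV[R[i]]_a)) sF.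
  exact: (smooth_mxM openU sl (smooth_mx_cst openU _)).
rewrite tE (eq_bigr (fun i => laplacian_mx g (fun v =>
    (delta_mx 0 i : 'rV[R[i]]_a) *m F v *m (delta_mx i 0 : 'cV[R[i]]_a)) u)); last first.
  move=> i _; rewrite -(laplacian_mxMl _ sF) -laplacian_mxMr //.
  exact: (smooth_mxM openU (smooth_mx_cst openU _) sF).
rewrite -(laplacian_mx_sum _ sFi Uu).2; congr (laplacian_mx g _ u).
by apply/funext => v; rewrite tE.
Qed.

End Symmetric.

Lemma smooth_Re_trace a (F : 'rV[R]_n -> 'M[R[i]]_a) :
  smooth_mx U F -> smooth U (fun v => complex.Re (\tr (F v))).
Proof.
move=> sF; rewrite (_ : (fun v => _) = fun v => \sum_i complex.Re (F v i i)).
  by apply: (smooth_sum openU) => i; have [] := sF i i.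
by apply/funext => v; rewrite Re_sum.
Qed.

Lemma partial_Re_trace a k (F : 'rV[R]_n -> 'M[R[i]]_a) u :
  smooth_mx U F -> U u ->
  partial k (fun v => complex.Re (\tr (F v))) u = complex.Re (\tr (partial_mx k F u)).
Proof.
move=> sF Uu; rewrite /mxtrace Re_sum.
rewrite (_ : (fun v => _) = fun v => \sum_i complex.Re (F v i i)); last first.
  by apply/funext => v; rewrite Re_sum.
rewrite (partial_sum openU) //; first by apply: eq_bigr => i _; rewrite mxE.
by move=> i; have [] := sF i i.
Qed.

End LaplacianLinear.

(** * The Laplacian of the projector *)

Section Hypersurface.
Context {R : realType} (c : R) {m : nat}.
Local Notation C := R[i].
Local Notation vec := 'cV[R[i]]_m.+1.
Local Notation mat := 'M[R[i]]_m.+1.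
Local Notation dim := (m.*2.-1).
Local Notation Cc := (c%:C%C : R[i]).
Local Notation Psi := (Psi_form Cc).
Local Notation outer := (outer Cc).
Hypotheses (cc : c * c = 1) (m0 : (0 < m)%N).

Let cJ : Cc^* = Cc.
Proof. exact: conjCR. Qed.

Let ccC : Cc * Cc = 1.
Proof. by rewrite -rmorphM cc. Qed.

Lemma Psi_formC (z w : vec) : Defs.Psi c z w = Psi z w.
Proof. by rewrite Psi_formE. Qed.

Lemma Psi_hyperquadric (z : @hyperquadric R c m) :
  Psi (set_val z) (set_val z) = Cc.
Proof. by rewrite -Psi_formC; have := set_valP z; apply. Qed.

Lemma projectorE (z : vec) : projector c z = Cc *: outer z z.
Proof.
apply/matrixP => i j; rewrite mxE Psi_formC outerE !mxE big_ord1 -mulrA.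
by congr (_ * _); rewrite mulrC; congr (_ * _); rewrite PsiE -colE mxE.
Qed.

Variable T : mat.
Definition antilinear (v : vec) : vec := T *m map_mx Num.conj v.
Local Notation J := antilinear.
Hypothesis TT : T *m map_mx Num.conj T = 1%:M.
Hypothesis PsiJJ : forall u v, Psi (J u) (J v) = Psi v u.

Definition conj_mx (A : mat) : mat := T *m map_mx Num.conj A *m map_mx Num.conj T.

Lemma map_conj_mul1C : map_mx Num.conj T *m T = 1%:M.
Proof. exact: mulmx1C. Qed.

Lemma map_conj_mxK a b (A : 'M[C]_(a, b)) : map_mx Num.conj (map_mx Num.conj A) = A.
Proof. by apply/matrixP => i j; rewrite !mxE conjCK. Qed.

Lemma antilinearK : involutive J.
Proof. by move=> v; rewrite /J map_mxM map_conj_mxK mulmxA TT mul1mx. Qed.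

Lemma antilinearD : {morph J : u v / u + v}.
Proof. by move=> u v; rewrite /J map_mxD mulmxDr. Qed.

Lemma antilinearZ a v : J (a *: v) = a^* *: J v.
Proof. by rewrite /J map_mxZ -scalemxAr. Qed.

Lemma conj_mx_mulv A v : conj_mx A *m v = J (A *m J v).
Proof. by rewrite /J /conj_mx !map_mxM map_conj_mxK !mulmxA. Qed.

Lemma conj_mxM A B : conj_mx (A *m B) = conj_mx A *m conj_mx B.
Proof.
rewrite /conj_mx map_mxM !mulmxA.
by rewrite -(mulmxA (T *m map_mx Num.conj A) (map_mx Num.conj T) T) map_conj_mul1C mulmx1.
Qed.

Lemma conj_mxK A : conj_mx (conj_mx A) = A.
Proof. by apply: mx_eqv => v; rewrite !conj_mx_mulv !antilinearK. Qed.

Lemma Psi_antilinear u v : Psi (J u) v = Psi (J v) u.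
Proof. by rewrite -{1}[v]antilinearK PsiJJ. Qed.

Lemma conj_mx_outer u v : conj_mx (outer u v) = outer (J u) (J v).
Proof.
apply: mx_eqv => y; rewrite conj_mx_mulv !outer_mulv antilinearZ PsiJ //.
by rewrite Psi_antilinear.
Qed.

Variables (zeta : 'rV[R]_dim -> @hyperquadric R c m) (U : set 'rV[R]_dim).
Hypothesis openU : open U.
Local Notation Z := (fun u => set_val (zeta u)).
Hypothesis sZ : smooth_mx U Z.
Hypothesis Efree : forall u, U u -> forall a : 'I_dim -> R,
  \sum_(i < dim) (a i)%:C%C *: coord_field zeta i u = 0 -> forall i, a i = 0.

Let ZZ u : Psi (Z u) (Z u) = Cc.
Proof. exact: Psi_hyperquadric. Qed.

Let X u : mat := projector c (Z u).

Let W u := star Cc (Z u).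

Let XE : X = fun u => Cc *: (Z u *m W u).
Proof. by apply/funext => u; rewrite /X projectorE outerE. Qed.

Let sstar (V : 'rV[R]_dim -> vec) : smooth_mx U V -> smooth_mx U (fun u => star Cc (V u)).
Proof.
move=> sV; apply: (smooth_mxM openU _ (smooth_mx_cst openU _)).
exact: (smooth_mx_tr (smooth_mxJ openU sV)).
Qed.

Let dstar (V : 'rV[R]_dim -> vec) k u : smooth_mx U V -> U u ->
  partial_mx k (fun u => star Cc (V u)) u = star Cc (partial_mx k V u).
Proof.
move=> sV Uu; have sc := smooth_mx_tr (smooth_mxJ openU sV).
rewrite [LHS](partial_mxM openU k sc (smooth_mx_cst openU _) Uu).
by rewrite partial_mx_cst mulmx0 addr0 partial_mx_tr (partial_mxJ k sV Uu).
Qed.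

Let sW : smooth_mx U W.
Proof. exact: sstar. Qed.

Let sX : smooth_mx U X.
Proof. by rewrite XE; apply: (smooth_mxZ openU _ (smooth_mxM openU sZ sW)). Qed.

Let dW k u : U u -> partial_mx k W u = star Cc (partial_mx k Z u).
Proof. exact: dstar. Qed.

Local Notation E k u := (coord_field zeta k u).

Let ver k u := Cc * Psi (Z u) (partial_mx k Z u).

Let EE k u : E k u = partial_mx k Z u - ver k u *: Z u.
Proof. by rewrite /coord_field /horizontal Psi_formC. Qed.

Let verJ k u : U u -> (ver k u)^* = - ver k u.
Proof.
move=> Uu; apply/eqP; rewrite -addr_eq0 /ver rmorphM /= cJ -mulrDr PsiJ //.
have e : star Cc (partial_mx k Z u) *m Z u + star Cc (Z u) *m partial_mx k Z u = 0.
  rewrite -(dW k Uu) -(partial_mxM openU k sW sZ Uu).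
  rewrite (_ : (fun v => _) = fun=> Cc%:M) ?partial_mx_cst //.
  by apply/funext => v; rewrite [LHS]star_mul ZZ.
have /(congr1 (fun A : 'M[R[i]]_1 => A 0 0)) := e.
by rewrite !star_mul !mxE !mulr1n addrC => ->; rewrite mulr0.
Qed.

Let ZE k u : Psi (Z u) (E k u) = 0.
Proof. by rewrite EE PsiDr PsiNr PsiZr ZZ /ver mulrAC ccC mul1r subrr. Qed.

Let dX k u : U u -> partial_mx k X u = tangent Cc (fun i => E i u) (Z u) k.
Proof.
move=> Uu; rewrite XE (partial_mxZ openU k _ (smooth_mxM openU sZ sW) Uu).
rewrite (partial_mxM openU k sZ sW Uu) (dW k Uu) /tangent.
transitivity (Cc *: (outer (partial_mx k Z u) (Z u) + outer (Z u) (partial_mx k Z u))).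
  by rewrite 2!outerE.
apply: congr1; have -> : partial_mx k Z u = E k u + ver k u *: Z u by rewrite EE subrK.
rewrite outerDl outerDr outerZl outerZr (verJ k Uu) scaleNr addrACA.
by rewrite subrr addr0.
Qed.

Variable x : R.
Hypotheses (x0 : x != 0) (x1 : 1 - x != 0).
Local Notation Xc := (x%:C%C : R[i]).
Local Notation q u := (Psi (J (Z u)) (Z u)).
Hypothesis level : forall u, U u -> q u * (q u)^* = Xc.

Let nrm u : vec := q u *: J (Z u) - (Cc * Xc) *: Z u.
Let t := c * x * (1 - x).

Let t0 : t != 0.
Proof.
rewrite !mulf_neq0 //; apply/eqP => c0.
by move: cc; rewrite c0 mul0r => /eqP; rewrite eq_sym oner_eq0.
Qed.

Let tE : t%:C%C = Cc * Xc * (1 - Xc).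
Proof. by rewrite !rmorphM rmorphB rmorph1. Qed.

Let tC0 : t%:C%C != 0 :> C.
Proof. by rewrite (inj_eq (@complexI R)). Qed.

Let xC0 : Xc != 0.
Proof. by rewrite (inj_eq (@complexI R)). Qed.

Let xC1 : 1 - Xc != 0.
Proof. by rewrite -(rmorph1 (real_complex R)) -rmorphB (inj_eq (@complexI R)). Qed.

Let WW u : Psi (J (Z u)) (J (Z u)) = Cc.
Proof. by rewrite PsiJJ ZZ. Qed.

Let zn u : U u -> Psi (Z u) (nrm u) = 0.
Proof. by move=> Uu; exact: (normal_orthogonal cJ ccC (ZZ u) (level Uu) erefl). Qed.

Let nn u : U u -> Psi (nrm u) (nrm u) = t%:C%C.
Proof.
by move=> Uu; exact: (normal_square cJ ccC (ZZ u) (WW u) (level Uu) xC0 erefl tE).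
Qed.

Let JZ u := J (Z u).

Let sJZ : smooth_mx U JZ.
Proof. exact: (smooth_mxM openU (smooth_mx_cst openU T) (smooth_mxJ openU sZ)). Qed.

Let dJZ k u : U u -> partial_mx k JZ u = J (partial_mx k Z u).
Proof.
move=> Uu.
rewrite [LHS](partial_mxM openU k (smooth_mx_cst openU T) (smooth_mxJ openU sZ) Uu).
by rewrite partial_mx_cst mul0mx add0r (partial_mxJ k sZ Uu).
Qed.

Let dq k u : U u ->
  complex.Re ((q u)^* * Psi (J (Z u)) (partial_mx k Z u)) = 0.
Proof.
move=> Uu; pose Q v : 'M[R[i]]_1 := star Cc (JZ v) *m Z v.
have sQ : smooth_mx U Q := smooth_mxM openU (sstar sJZ) sZ.
have QE v : Q v = (q v)%:M by rewrite /Q star_mul.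
have dQ : partial_mx k Q u = (2 * Psi (J (Z u)) (partial_mx k Z u))%:M.
  rewrite [LHS](partial_mxM openU k (sstar sJZ) sZ Uu) (dstar k sJZ Uu) (dJZ k Uu).
  by rewrite !star_mul Psi_antilinear -raddfD /= mulr2n mulrDl !mul1r.
have : partial_mx k (fun v => Q v *m map_mx Num.conj (Q v)) u = 0.
  rewrite -(partial_mx_cst k (Xc%:M : 'M[R[i]]_1) u).
  apply: (partial_mx_eq openU k Uu) => v /set_mem Uv.
  by rewrite QE map_scalar_mx -scalar_mxM level.
rewrite (partial_mxM openU k sQ (smooth_mxJ openU sQ) Uu) (partial_mxJ k sQ Uu).
rewrite QE dQ !map_scalar_mx -!scalar_mxM -raddfD /=.
move=> /(congr1 (fun A : 'M[R[i]]_1 => complex.Re (A 0 0))); rewrite !mxE !mulr1n.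
rewrite ReD => e; apply: (mulfI (_ : (4 : R) != 0)); first by rewrite pnatr_eq0.
rewrite mulr0 -[RHS]e; move: (q u) (Psi _ (partial_mx k Z u)) => a b.
by rewrite rmorphM /= rmorph_nat !cReM !cImM !ReJ !ImJ /=; ring.
Qed.

Let nE k u : U u -> complex.Re (Psi (nrm u) (E k u)) = 0.
Proof.
move=> Uu; rewrite /nrm PsiDl PsiNl !PsiZl ZE mulr0 subr0 EE PsiDr PsiNr PsiZr.
rewrite mulrBr ReD ReN dq // add0r mulrCA mulrC [_^* * _]mulrC level // cReM /= mul0r subr0.
have := congr1 (@complex.Re R) (verJ k Uu); rewrite ReJ ReN => /eqP.
by rewrite -addr_eq0 -mulr2n mulrn_eq0 /= => /eqP ->; rewrite mulr0 oppr0.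
Qed.

Local Notation g := (induced_metric zeta).
Local Notation gI u := (metric_inv g u).

Let gE u i j : g i j u = complex.Re (Psi (E i u) (E j u)).
Proof. by rewrite /induced_metric Psi_formC. Qed.

Let gIE u : gI u = invmx (\matrix_(i, j) complex.Re (Psi (E i u) (E j u))).
Proof. by rewrite /metric_inv; congr invmx; apply/matrixP => i j; rewrite !mxE gE. Qed.

Let gIs u k l : gI u k l = gI u l k.
Proof. by rewrite gIE; exact: gram_inv_sym. Qed.

Let gIg u k l : U u -> \sum_p gI u k p * g p l u = (k == l)%:R.
Proof.
move=> Uu; have gu := gram_matrix_unit cc (ZZ u) (ZE ^~ u) (Efree Uu).
have := congr1 (fun A : 'M[R]_dim => A k l) (mulVmx gu); rewrite !mxE -gIE => <-.
by apply: eq_bigr => p _; rewrite mxE gE.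
Qed.

Let res u (Uu : U u) := @frame_resolution R c m (fun k => E k u) (Z u) (nrm u) t
  cc m0 t0 (ZZ u) (ZE ^~ u) (zn Uu) (nn Uu) (fun k => nE k Uu) (Efree Uu).

Let gC u k l : C := (gI u k l)%:C%C.

Let gCs u k l : gC u k l = gC u l k.
Proof. by rewrite /gC gIs. Qed.

Let clin u (Uu : U u) v :
  \sum_k \sum_l gC u k l *: (Psi (E k u) v *: E l u) =
  2 *: v - (2 * Cc * Psi (Z u) v) *: Z u - (Psi (nrm u) v / t%:C%C) *: nrm u.
Proof. by rewrite /gC gIE; exact: (contraction_linear (res Uu)). Qed.

Let canti u (Uu : U u) v :
  \sum_k \sum_l gC u k l *: (Psi v (E k u) *: E l u) =
  - (Psi v (nrm u) / t%:C%C) *: nrm u.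
Proof. by rewrite /gC gIE; exact: (contraction_antilinear (res Uu)). Qed.

Let contraction_X u (Uu : U u) :
  \sum_k \sum_l gC u k l *: (partial_mx k X u *m partial_mx l X u) =
  Cc *: (2 *: 1%:M - (2 * Cc) *: outer (Z u) (Z u) -
         (t%:C%C)^-1 *: outer (nrm u) (nrm u)) +
  ((2 * m)%:R - 1) *: outer (Z u) (Z u).
Proof.
rewrite -(contraction_tangent cJ ccC tC0 (gCs u) (clin Uu) (ZZ u) (ZE ^~ u) (nn Uu)).
by apply: eq_bigr => k _; apply: eq_bigr => l _; rewrite (dX k Uu) (dX l Uu).
Qed.

Let polarization (e f : vec) :
  complex.Re (Psi e f) = c / 2 * complex.Re (Cc * (Psi f e + Psi e f)).
Proof.
rewrite ReZ ReD -(PsiJ cJ e f) ReJ; move: (complex.Re _) => a.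
by transitivity ((c * c) * a); [rewrite cc mul1r|field].
Qed.

Let gX i j u : U u ->
  g i j u = c / 2 * complex.Re (\tr (partial_mx i X u *m partial_mx j X u)).
Proof.
move=> Uu; rewrite (dX i Uu) (dX j Uu) gE.
have -> := @trace_tangent C Cc m dim (fun k => E k u) (Z u) cJ ccC (ZZ u) (ZE ^~ u) i j.
exact: polarization.
Qed.

Let tt u i j l : R :=
  c / 2 * complex.Re (\tr (partial_mx i (partial_mx j X) u *m partial_mx l X u)).

Let ttC u i j l : U u -> tt u i j l = tt u j i l.
Proof. by move=> Uu; rewrite /tt (partial_mxC openU i j sX Uu). Qed.

Let dg k i j u : U u -> partial k (g i j) u = tt u k i j + tt u k j i.
Proof.
move=> Uu; have dXi := smooth_partial_mx i sX; have dXj := smooth_partial_mx j sX.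
have sF := smooth_mxM openU dXi dXj.
rewrite (@partial_eq _ _ U openU k (g i j) (fun v => c / 2 *
  complex.Re (\tr (partial_mx i X v *m partial_mx j X v))) u Uu); last first.
  by move=> v /set_mem Uv; exact: gX.
rewrite (partialM (derivable_cst _ _ _) (smooth_derivable (smooth_Re_trace openU sF) Uu)).
rewrite partial_cst mulr0 addr0 (partial_Re_trace openU k sF Uu).
rewrite (partial_mxM openU k dXi dXj Uu) raddfD /= ReD mulrDr; congr (_ + _).
by rewrite /tt mxtrace_mulC.
Qed.

Let christ k i j u : U u ->
  christoffel g k i j u = \sum_l gI u k l * tt u i j l.
Proof.
move=> Uu; rewrite /christoffel mulr_sumr; apply: eq_bigr => l _.
rewrite (dg i j l Uu) (dg j i l Uu) (dg l i j Uu).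
rewrite (ttC j i l Uu) (ttC l i j Uu) (ttC l j i Uu).
by move: (gI u k l) (tt u i j l) (tt u i l j) (tt u j l i) => a b1 b2 b3; field.
Qed.

Let raise_lower (A : 'M[R]_dim) (l : 'I_dim) (f b : 'I_dim -> R) :
  (forall k p, A k p = A p k) -> (forall k, \sum_p A k p * b p = (k == l)%:R) ->
  \sum_k (\sum_p A k p * f p) * b k = f l.
Proof.
move=> As Ab; under eq_bigr => k _ do rewrite mulr_suml.
rewrite exchange_big /= (eq_bigr (fun p => f p * (p == l)%:R)).
  rewrite (bigD1 l) //= eqxx mulr1 big1 ?addr0 // => p /negPf ->.
  by rewrite mulr0.
by move=> p _; rewrite -Ab mulr_sumr; apply: eq_bigr => k _; rewrite (As k p); ring.
Qed.

Let hess_orth i j l u : U u ->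
  complex.Re (\tr (covariant_hessian_mx g X i j u *m partial_mx l X u)) = 0.
Proof.
move=> Uu; have c0 : c / 2 != 0.
  by rewrite mulf_neq0 ?invr_eq0 ?pnatr_eq0 //; apply: contraNneq t0 => c0;
     rewrite /t c0 !mul0r.
apply: (mulfI c0); rewrite mulr0 /covariant_hessian_mx mulmxBl mxtraceB ReD ReN mulrBr.
rewrite -/(tt u i j l) mulmx_suml mxtrace_sum Re_sum mulr_sumr.
apply/eqP; rewrite subr_eq0; apply/eqP.
transitivity (\sum_k christoffel g k i j u * g k l u); last first.
  apply: eq_bigr => k _; rewrite -scalemxAl /= mxtraceZ ReZ mulrCA; congr (_ * _).
  exact: gX.
have -> : \sum_k christoffel g k i j u * g k l u =
    \sum_k (\sum_p gI u k p * tt u i j p) * g k l u.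
  by apply: eq_bigr => k _; rewrite (christ k i j Uu).
by rewrite (raise_lower _ (gIs u) (fun k => gIg k l Uu)).
Qed.

Let B u : mat := - laplacian_mx g X u.

Let BE u : B u = \sum_i \sum_j gC u i j *: covariant_hessian_mx g X i j u.
Proof. by rewrite /B laplacian_mxE opprK. Qed.

Let adjX u : padj Cc (X u) = X u.
Proof. by rewrite /X projectorE padjZ cJ (padj_outer cJ ccC). Qed.

Let adjB u : U u -> padj Cc (B u) = B u.
Proof.
move=> Uu; rewrite /B padjN; apply: (congr1 (fun A => - A)).
have sJ := smooth_mx_tr (smooth_mxJ openU sX).
have sl := smooth_mxM openU (smooth_mx_cst openU (gram Cc : mat)) sJ.
rewrite /padj -(laplacian_mxJ g openU sX Uu) -laplacian_mx_tr.
rewrite -(laplacian_mxMl openU Uu (gIs u) _ sJ) -(laplacian_mxMr openU Uu (gIs u) _ sl).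
by apply: (laplacian_mx_eq g openU Uu) => v _; exact: adjX.
Qed.

Let re_trace_tangent (A : mat) (e z : vec) : padj Cc A = A ->
  complex.Re (\tr (A *m (Cc *: (outer e z + outer z e)))) =
  2 * c * complex.Re (Psi e (A *m z)).
Proof.
move=> Aa; rewrite -scalemxAr mxtraceZ ReZ mulmxDr !mulmx_outer mxtraceD !tr_outer.
by rewrite ReD -(Psi_padj cJ ccC) Aa -(PsiJ cJ e) ReJ; ring.
Qed.

Let orth u l : U u -> complex.Re (Psi (E l u) (B u *m Z u)) = 0.
Proof.
move=> Uu; have c2 : 2 * c != 0.
  by rewrite mulf_neq0 ?pnatr_eq0 //; apply: contraNneq t0 => c0; rewrite /t c0 !mul0r.
apply: (mulfI c2); rewrite mulr0 -(re_trace_tangent _ _ (adjB Uu)).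
rewrite -[Cc *: _](dX l Uu) BE mulmx_suml mxtrace_sum Re_sum; apply: big1 => i _.
rewrite mulmx_suml mxtrace_sum Re_sum; apply: big1 => j _.
by rewrite -scalemxAl mxtraceZ ReZ (hess_orth i j l Uu) mulr0.
Qed.

Let Bz u : U u -> B u *m Z u = (Cc * Psi (Z u) (B u *m Z u)) *: Z u +
  (complex.Re (Psi (nrm u) (B u *m Z u)) / t)%:C%C *: nrm u.
Proof.
move=> Uu; rewrite {1}(res Uu (B u *m Z u)) big1 ?add0r // => k _.
by apply: big1 => l _; rewrite orth // scale0r scaler0.
Qed.

Let XZ u : X u = Cc *: outer (Z u) (Z u).
Proof. exact: projectorE. Qed.

Let XX u : X u *m X u = X u.
Proof. by rewrite XZ -scalemxAl -scalemxAr outerM ZZ scalerA ccC scale1r. Qed.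

Let Bprod u : U u -> B u = B u *m (Cc *: outer (Z u) (Z u)) +
  (Cc *: outer (Z u) (Z u)) *m B u +
  2 *: (Cc *: (2 *: 1%:M - (2 * Cc) *: outer (Z u) (Z u) -
        (t%:C%C)^-1 *: outer (nrm u) (nrm u)) +
        ((2 * m)%:R - 1) *: outer (Z u) (Z u)).
Proof.
move=> Uu; have := laplacian_mxM openU sX sX Uu (gIs u).
rewrite (@laplacian_mx_eq _ _ U g openU _ _ _ X u Uu); last by move=> v _; exact: XX.
rewrite -/(gC u) contraction_X // -XZ => LE; rewrite {1}/B LE mulmxN mulNmx.
by rewrite opprB [RHS]addrC -scaler_nat; congr (_ + _); rewrite opprD.
Qed.

Let Y u : mat := conj_mx (X u).

Let sY : smooth_mx U Y.
Proof.
have sT A := smooth_mx_cst openU (A : mat).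
exact: (smooth_mxM openU (smooth_mxM openU (sT T) (smooth_mxJ openU sX)) (sT _)).
Qed.

Let dY k u : U u -> partial_mx k Y u = conj_mx (partial_mx k X u).
Proof.
move=> Uu; have sT A := smooth_mx_cst openU (A : mat).
have sJ := smooth_mxJ openU sX; have sl := smooth_mxM openU (sT T) sJ.
rewrite [LHS](partial_mxM openU k sl (sT _) Uu) (partial_mxM openU k (sT T) sJ Uu).
by rewrite !partial_mx_cst mul0mx add0r mulmx0 addr0 (partial_mxJ k sX Uu).
Qed.

Let lapJ (F : 'rV[R]_dim -> mat) u : smooth_mx U F -> U u ->
  laplacian_mx g (fun v => conj_mx (F v)) u = conj_mx (laplacian_mx g F u).
Proof.
move=> sF Uu; have sJ := smooth_mxJ openU sF.
have sl := smooth_mxM openU (smooth_mx_cst openU T) sJ.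
rewrite [LHS](laplacian_mxMr openU Uu (gIs u) _ sl).
by rewrite (laplacian_mxMl openU Uu (gIs u) _ sJ) (laplacian_mxJ g openU sF Uu).
Qed.

Lemma conj_mxZ a A : conj_mx (a *: A) = a^* *: conj_mx A.
Proof. by rewrite /conj_mx map_mxZ -scalemxAr -scalemxAl. Qed.

Lemma conj_mxD A A' : conj_mx (A + A') = conj_mx A + conj_mx A'.
Proof. by rewrite /conj_mx map_mxD mulmxDr mulmxDl. Qed.

Lemma conj_mxN A : conj_mx (- A) = - conj_mx A.
Proof. by rewrite -scaleN1r conj_mxZ rmorphN rmorph1 scaleN1r. Qed.

Lemma conj_mx1 : conj_mx 1%:M = 1%:M.
Proof. by rewrite /conj_mx map_mx1 mulmx1. Qed.

Let YW u : Y u = Cc *: outer (J (Z u)) (J (Z u)).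
Proof. by rewrite /Y XZ conj_mxZ cJ conj_mx_outer. Qed.

Let conj_tangent (e z : vec) :
  conj_mx (Cc *: (outer e z + outer z e)) = Cc *: (outer (J e) (J z) + outer (J z) (J e)).
Proof. by rewrite conj_mxZ cJ conj_mxD !conj_mx_outer. Qed.

Let gCJ u k l : (gC u k l)^* = gC u k l.
Proof. exact: conjCR. Qed.

Let contraction_XY u : U u ->
  \sum_k \sum_l gC u k l *: (partial_mx k X u *m partial_mx l Y u) =
  (1 - Xc)^-1 *: (outer (Z u) (Z u) + outer (J (Z u)) (J (Z u))
     - (Cc * (q u)^*) *: outer (Z u) (J (Z u)) - (Cc * q u) *: outer (J (Z u)) (Z u)).
Proof.
move=> Uu; have <- := contraction_mixed cJ ccC (gCs u) (clin Uu) (canti Uu)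
  (ZZ u) (zn Uu) antilinearK PsiJJ antilinearD antilinearZ
  (level Uu) xC0 xC1 erefl tE (gCJ u).
apply: eq_bigr => k _; apply: eq_bigr => l _.
by rewrite (dY l Uu) (dX k Uu) (dX l Uu) /tangentJ -conj_tangent.
Qed.

Let trXY u : U u -> \tr (X u *m Y u) = Xc.
Proof.
move=> Uu; rewrite XZ YW -scalemxAl -scalemxAr scalerA ccC scale1r outerM.
by rewrite mxtraceZ tr_outer mulrC -(PsiJ cJ (J (Z u))) level.
Qed.

Let Btr u : U u -> Cc * Psi (J (Z u)) (B u *m J (Z u)) +
   Cc * (Psi (J (Z u)) (B u *m J (Z u)))^* + 4 * Cc = 0.
Proof.
move=> Uu; have sXY := smooth_mxM openU sX sY.
have := laplacian_trace openU Uu (gIs u) sXY.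
rewrite (@laplacian_mx_eq _ _ U g openU _ _ _ (fun=> Xc%:M) u Uu); last first.
  by move=> v /set_mem Uv; rewrite trXY.
rewrite laplacian_mx_cst => /(congr1 (fun A : 'M[R[i]]_1 => - A 0 0)).
rewrite !mxE mulr1n oppr0 (laplacian_mxM openU sX sY Uu (gIs u)) -/(gC u).
rewrite contraction_XY // mxtraceB mxtraceD mulr2n mxtraceD.
rewrite (trace_mixed cJ (ZZ u) (WW u) (level Uu) xC0 xC1) [laplacian_mx g Y u](lapJ sX Uu).
rewrite YW XZ /B; move: (laplacian_mx g X u) (J (Z u)) (Z u) => L w z.
rewrite -scalemxAr -scalemxAl !mxtraceZ [\tr (outer z z *m _)]mxtrace_mulC.
rewrite !tr_mulmx_outer mulNmx PsiNr conj_mx_mulv.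
have -> : Psi z (J (L *m J z)) = (Psi (J z) (L *m J z))^*.
  by rewrite (PsiJ cJ) -(PsiJJ (J z) (L *m J z)) antilinearK.
move: (Psi (J z) (L *m J z)) => b e; rewrite [RHS]e rmorphN /=.
by move: (Cc) (b^* ) => c' b'; ring.
Qed.

Local Notation kap := (Cc / (1 - Xc)).
Local Notation Mc := (m%:R : C).
Local Notation sig := (2 * kap * ((Mc + 1) * Xc - 1) / Xc).

Let XYE u : X u *m Y u = (q u)^* *: outer (Z u) (J (Z u)).
Proof.
rewrite XZ YW -scalemxAl -scalemxAr scalerA ccC scale1r outerM.
by rewrite -(PsiJ cJ (J (Z u))).
Qed.

Let YXE u : Y u *m X u = q u *: outer (J (Z u)) (Z u).
Proof. by rewrite XZ YW -scalemxAl -scalemxAr scalerA ccC scale1r outerM. Qed.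

Let lapX u : U u -> - laplacian_mx g X u =
  (4 * Cc) *: 1%:M - (kap * (4 * Mc - 2)) *: X u - (2 * kap) *: Y u
  + sig *: (X u *m Y u + Y u *m X u).
Proof.
move=> Uu; have BJ := conjCR (complex.Re (Psi (nrm u) (B u *m Z u)) / t).
have := projector_laplacianE cJ ccC (ZZ u) (WW u) (level Uu) xC0 xC1 erefl tE
  (adjB Uu) BJ (Bz Uu) (Bprod Uu) (Btr Uu).
by rewrite XYE YXE XZ YW !scalerA.
Qed.

Let YJ u : conj_mx (Y u) = X u.
Proof. exact: conj_mxK. Qed.

Let realJ (a : R) (A : mat) : conj_mx (a%:C%C *: A) = a%:C%C *: conj_mx A.
Proof. by rewrite conj_mxZ conjCR. Qed.

Let kR := c / (1 - x).
Let sR := 2 * kR * ((m%:R + 1) * x - 1) / x.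

Let kE : kap = kR%:C%C.
Proof. by rewrite fmorph_div rmorphB rmorph1. Qed.

Let sE : sig = sR%:C%C.
Proof. by rewrite kE !(rmorphM, fmorphV, rmorphB, rmorphD, rmorph1, rmorph_nat). Qed.

Let S u := X u *m Y u + Y u *m X u.

Let SJ u : conj_mx (S u) = S u.
Proof. by rewrite conj_mxD (conj_mxM (X u)) (conj_mxM (Y u)) YJ addrC. Qed.

Let real4c : (4 * c)%:C%C = 4 * Cc.
Proof. by rewrite rmorphM rmorph_nat. Qed.

Let realkm : (kR * (4 * m%:R - 2))%:C%C = kR%:C%C * (4 * Mc - 2).
Proof. by rewrite !(rmorphM, rmorphB, rmorph_nat). Qed.

Let real2k : (2 * kR)%:C%C = 2 * kR%:C%C.
Proof. by rewrite rmorphM rmorph_nat. Qed.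

Let lapXE u : U u -> laplacian_mx g X u =
  - (4 * c)%:C%C *: 1%:M + (kR * (4 * m%:R - 2))%:C%C *: X u +
  (2 * kR)%:C%C *: Y u - sR%:C%C *: S u.
Proof.
move=> Uu; apply: oppr_inj; rewrite (lapX Uu) sE kE -/(S u).
by rewrite opp_regroup real4c realkm real2k.
Qed.

Let lapYE u : U u -> laplacian_mx g Y u =
  - (4 * c)%:C%C *: 1%:M + (kR * (4 * m%:R - 2))%:C%C *: Y u +
  (2 * kR)%:C%C *: X u - sR%:C%C *: S u.
Proof.
move=> Uu; rewrite [LHS](lapJ sX Uu) (lapXE Uu) !(conj_mxD, conj_mxN).
by rewrite scaleNr conj_mxN !realJ conj_mx1 SJ YJ.
Qed.

Let YY u : Y u *m Y u = Y u.
Proof. by rewrite -conj_mxM XX. Qed.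

Let XYX u : U u -> X u *m Y u *m X u = Xc *: X u.
Proof.
move=> Uu; rewrite XYE XZ -scalemxAl -scalemxAr outerM !scalerA.
by rewrite mulrAC [_^* * _]mulrC level // mulrC.
Qed.

Let lapXYE u : U u -> laplacian_mx g (fun v => X v *m Y v) u =
  - (4 * c + sR * x)%:C%C *: (X u + Y u)
  - (2 * sR - kR * (8 * m%:R - 2))%:C%C *: (X u *m Y u)
  + (2 * kR)%:C%C *: (Y u *m X u).
Proof.
move=> Uu; rewrite (laplacian_mxM openU sX sY Uu (gIs u)) -/(gC u) contraction_XY //.
have YXY : Y u *m X u *m Y u = Xc *: Y u.
  by have := congr1 conj_mx (XYX Uu); rewrite (conj_mxM (X u *m Y u)) (conj_mxM (X u)) YJ realJ.
have LX : - laplacian_mx g X u = (4 * Cc) *: 1%:M - (kR%:C%C * (4 * Mc - 2)) *: X u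
    - (2 * kR%:C%C) *: Y u + sR%:C%C *: S u.
  by rewrite (lapX Uu) sE kE.
have LY : - laplacian_mx g Y u = (4 * Cc) *: 1%:M - (kR%:C%C * (4 * Mc - 2)) *: Y u
    - (2 * kR%:C%C) *: X u + sR%:C%C *: (Y u *m X u + X u *m Y u).
  by rewrite (lapYE Uu) opp_regroup real4c realkm real2k /S [X u *m Y u + _]addrC.
have KE : (1 - Xc)^-1 *: (outer (Z u) (Z u) + outer (J (Z u)) (J (Z u))
     - (Cc * (q u)^*) *: outer (Z u) (J (Z u)) - (Cc * q u) *: outer (J (Z u)) (Z u)) =
    kR%:C%C *: (X u + Y u - X u *m Y u - Y u *m X u).
  rewrite XYE YXE XZ YW; apply: distribute_scale ccC _.
  by rewrite -kE mulrAC ccC mul1r.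
have PE := product_laplacianE (XX u) (YY u) (XYX Uu) YXY LX LY.
rewrite KE -scaler_nat; apply: oppr_inj; apply: etrans (etrans _ PE) _.
  exact: opp_product_rule.
have r1 : (4 * c + sR * x)%:C%C = 4 * Cc + sR%:C%C * Xc.
  by rewrite rmorphD /= real4c rmorphM.
have r2 : (2 * sR - kR * (8 * m%:R - 2))%:C%C = 2 * sR%:C%C - kR%:C%C * (8 * Mc - 2).
  by rewrite !(rmorphB, rmorphM, rmorph_nat).
by rewrite opp_regroup3 r1 r2 real2k.
Qed.

Definition combination (a b d e : R) (A : mat) : mat :=
  a%:C%C *: A + b%:C%C *: conj_mx A +
  d%:C%C *: (A *m conj_mx A + conj_mx A *m A) + e%:C%C *: 1%:M.

Let sS : smooth_mx U S.
Proof. exact: (smooth_mxD openU (smooth_mxM openU sX sY) (smooth_mxM openU sY sX)). Qed.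

Lemma smooth_combination a b d e :
  smooth_mx U (fun u => combination a b d e (projector c (Z u))).
Proof.
apply: (smooth_mxD openU _ (smooth_mx_cst openU _)).
apply: (smooth_mxD openU _ (smooth_mxZ openU _ sS)).
exact: (smooth_mxD openU (smooth_mxZ openU _ sX) (smooth_mxZ openU _ sY)).
Qed.

Let lapSE u : U u -> laplacian_mx g S u =
  - (8 * c + 2 * sR * x)%:C%C *: (X u + Y u)
  + (8 * m%:R * kR - 2 * sR)%:C%C *: S u.
Proof.
move=> Uu; have sXY := smooth_mxM openU sX sY.
have YXE' v : Y v *m X v = conj_mx (X v *m Y v) by rewrite conj_mxM YJ.
rewrite [LHS](laplacian_mxD g openU sXY (smooth_mxM openU sY sX) Uu).
rewrite (@laplacian_mx_eq _ _ U g openU _ _ (fun v => Y v *m X v)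
  (fun v => conj_mx (X v *m Y v)) u Uu (fun v _ => YXE' v)).
have realJN (b : R) A : conj_mx (- b%:C%C *: A) = - b%:C%C *: conj_mx A.
  by rewrite scaleNr conj_mxN realJ -scaleNr.
rewrite (lapJ sXY Uu) (lapXYE Uu) !(conj_mxD, conj_mxN) realJN !realJ conj_mxD YJ.
rewrite -(YXE' u) [conj_mx (Y u *m X u)]conj_mxM YJ -/(Y u).
apply: symmetrize; rewrite -?rmorphD -?rmorphB; apply: congr1; ring.
Qed.

Let combE a b d e u :
  combination a b d e (X u) = a%:C%C *: X u + b%:C%C *: Y u + d%:C%C *: S u + e%:C%C *: 1%:M.
Proof. by []. Qed.

Lemma laplacian_combination a b d e u : U u ->
  laplacian_mx g (fun v => combination a b d e (projector c (Z v))) u =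
  combination (kR * (4 * m%:R - 2) * a + 2 * kR * b - (8 * c + 2 * sR * x) * d)
              (kR * (4 * m%:R - 2) * b + 2 * kR * a - (8 * c + 2 * sR * x) * d)
              ((8 * m%:R * kR - 2 * sR) * d - sR * (a + b))
              (- (4 * c * (a + b))) (projector c (Z u)).
Proof.
move=> Uu; have s1 := smooth_mxZ openU a%:C%C sX; have s2 := smooth_mxZ openU b%:C%C sY.
have s3 := smooth_mxZ openU d%:C%C sS; have s4 := smooth_mx_cst openU (e%:C%C *: (1%:M : mat)).
have s12 := smooth_mxD openU s1 s2; have s123 := smooth_mxD openU s12 s3.
rewrite [LHS](laplacian_mxD g openU s123 s4 Uu) laplacian_mx_cst addr0.
rewrite [LHS](laplacian_mxD g openU s12 s3 Uu) (laplacian_mxD g openU s1 s2 Uu).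
rewrite (laplacian_mxZ openU Uu (gIs u) _ sX) (laplacian_mxZ openU Uu (gIs u) _ sY).
rewrite (laplacian_mxZ openU Uu (gIs u) _ sS) (lapXE Uu) (lapYE Uu) (lapSE Uu).
rewrite combE; move: (X u) (Y u) (S u) (kR) (sR) => X1 Y1 S1 k1 s1'.
exact: (collect_combination (real_complex R)).
Qed.

End Hypersurface.

Lemma projector_pair_free (K : numFieldType) (m : nat) (X Y : 'M[K]_m.+1) (x a b d e : K) :
  (1 < m)%N -> x != 0 -> 1 - x != 0 ->
  X *m X = X -> Y *m Y = Y -> X *m Y *m X = x *: X -> Y *m X *m Y = x *: Y ->
  \tr X = 1 -> \tr Y = 1 -> \tr (X *m Y) = x ->
  a *: X + b *: Y + d *: (X *m Y + Y *m X) + e *: 1%:M = 0 ->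
  [/\ a = 0, b = 0 & d = 0].
Proof.
move=> m1 x0 x1 XX YY XYX YXY tX tY tXY A0.
have tYX : \tr (Y *m X) = x by rewrite mxtrace_mulC.
have t0 : a + b + 2 * x * d + m.+1%:R * e = 0.
  have := congr1 mxtrace A0; rewrite !mxtraceD !mxtraceZ mxtraceD tX tY tXY tYX.
  by rewrite mxtrace1 mxtrace0 => <-; ring.
have t1 : a + x * b + 2 * x * d + e = 0.
  have := congr1 (fun B => \tr (B *m X)) A0.
  rewrite !(mulmxDl, =^~ scalemxAl) mul1mx mul0mx mxtrace0 XX XYX -(mulmxA Y) XX.
  by rewrite !mxtraceD !mxtraceZ !mxtraceD mxtraceZ tX tYX => <-; ring.
have t2 : x * a + b + 2 * x * d + e = 0.
  have := congr1 (fun B => \tr (B *m Y)) A0.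
  rewrite !(mulmxDl, =^~ scalemxAl) mul1mx mul0mx mxtrace0 YY YXY -(mulmxA X) YY.
  by rewrite !mxtraceD !mxtraceZ !mxtraceD mxtraceZ tY tXY => <-; ring.
have t3 : x * (a + b) + (x ^+ 2 + x) * d + x * e = 0.
  have := congr1 (fun B => \tr (B *m (X *m Y))) A0.
  rewrite !(mulmxDl, =^~ scalemxAl) mul1mx mul0mx mxtrace0 !mulmxA XX XYX -(mulmxA Y X X) XX.
  rewrite YXY -scalemxAl.
  by rewrite !mxtraceD !mxtraceZ !mxtraceD !mxtraceZ tY tXY => <-; ring.
have ab : b = a.
  apply/eqP; rewrite eq_sym -subr_eq0 -(mulIr_eq0 _ (mulIf x1)); apply/eqP.
  by transitivity (0 - 0 : K); [rewrite -{1}t1 -t2; ring|rewrite subr0].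
rewrite ab in t0 t1 t3.
have da : d = - a.
  apply/eqP; rewrite -addr_eq0 -(mulIr_eq0 _ (mulIf (mulf_neq0 x0 x1))); apply/eqP.
  by transitivity (0 - x * 0 : K); [rewrite -{1}t3 -t1; ring|rewrite mulr0 subr0].
rewrite da in t0 t1 t3 *.
have e' : e = - (a * (1 - x)).
  by apply/eqP; rewrite -addr_eq0; apply/eqP; rewrite -[RHS]t1; ring.
have a0 : a = 0.
  have m1' : (1 - m%:R : K) != 0 by rewrite subr_eq0 eq_sym (eqr_nat _ m 1) gtn_eqF.
  apply/eqP; rewrite -(mulIr_eq0 _ (mulIf (mulf_neq0 m1' x1))); apply/eqP.
  by rewrite -[RHS]t0 e' -natr1; ring.
by rewrite ab a0 oppr0.
Qed.

Section Level.
Context {R : realType} (c : R) {m : nat}.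
Local Notation vec := 'cV[R[i]]_m.+1.
Local Notation mat := 'M[R[i]]_m.+1.
Local Notation Cc := (c%:C%C : R[i]).
Local Notation Psi := (Psi_form Cc).
Local Notation outer := (outer Cc).
Hypotheses (cc : c * c = 1).
Variable T : mat.
Local Notation J := (antilinear T).
Hypothesis TT : T *m map_mx Num.conj T = 1%:M.
Hypothesis PsiJJ : forall u v, Psi (J u) (J v) = Psi v u.

Let cJ : Cc^* = Cc.
Proof. exact: conjCR. Qed.

Let ccC : Cc * Cc = 1.
Proof. by rewrite -rmorphM cc. Qed.

Lemma projector_adjoint (z v w : vec) :
  Psi (projector c z *m v) w = Psi v (projector c z *m w).
Proof.
rewrite projectorE -!scalemxAl !outer_mulv !scalerA PsiZl PsiZr.
move: (PsiJ cJ z v) (PsiJ cJ v z) => e1 e2; rewrite rmorphM /= cJ e1.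
exact: mulrAC.
Qed.

Lemma conj_mx_adjoint (A : mat) :
  (forall v w, Psi (A *m v) w = Psi v (A *m w)) ->
  forall v w, Psi (conj_mx T A *m v) w = Psi v (conj_mx T A *m w).
Proof.
move=> AA v w; rewrite !conj_mx_mulv (Psi_antilinear TT PsiJJ) -AA.
by rewrite -(PsiJJ (J v)) antilinearK.
Qed.

Lemma combination_hermitian a b d e (A : mat) :
  Psi_hermitian c A -> Psi_hermitian c (combination T a b d e A).
Proof.
move=> hA v w; rewrite !Psi_formC.
have AA u u' : Psi (A *m u) u' = Psi u (A *m u') by rewrite -!Psi_formC hA.
have := conj_mx_adjoint AA; rewrite /combination; move: (conj_mx T A) => B BB.
rewrite !(mulmxDl, =^~ scalemxAl, mul1mx, PsiDl, PsiZl, PsiDr, PsiZr) !conjCR.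
by rewrite -!mulmxA !(AA, BB) [in LHS](addrC (Psi v (B *m (A *m w)))).
Qed.

Section Point.
Variable z : @hyperquadric R c m.
Local Notation X := (projector c (set_val z)).

Lemma projector_hermitian : Psi_hermitian c X.
Proof. by move=> v w; rewrite !Psi_formC projector_adjoint. Qed.

Lemma projector_idem : X *m X = X.
Proof.
rewrite projectorE -scalemxAl -scalemxAr outerM Psi_hyperquadric !scalerA.
by rewrite -mulrA ccC mulr1.
Qed.

Lemma tr_projector : \tr X = 1.
Proof. by rewrite projectorE mxtraceZ tr_outer Psi_hyperquadric ccC. Qed.

Lemma projector_sandwich (A : mat) : X *m A *m X = \tr (X *m A) *: X.
Proof.
rewrite [X]projectorE -!scalemxAl -!scalemxAr scalerA (mxtraceZ _) (mxtrace_mulC _ A).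
rewrite tr_mulmx_outer -mulmxA mulmx_outer outerM !scalerA.
by congr (_ *: _); rewrite mulrAC.
Qed.

Lemma tr_projector_conj :
  \tr (X *m conj_mx T X) = Psi (J (set_val z)) (set_val z) *
    (Psi (J (set_val z)) (set_val z))^*.
Proof.
rewrite projectorE conj_mxZ cJ (conj_mx_outer TT PsiJJ) -scalemxAl -scalemxAr.
rewrite scalerA ccC scale1r outerM mxtraceZ tr_outer mulrC.
by rewrite (PsiJ cJ).
Qed.

End Point.
End Level.

(** * Spectral decomposition *)

Lemma scale_combination (K0 K : comPzRingType) (f : {rmorphism K0 -> K}) p
    (l a b d e : K0) (X Y S I : 'M[K]_p) :
  f (l * a) *: X + f (l * b) *: Y + f (l * d) *: S + f (l * e) *: I =
  f l *: (f a *: X + f b *: Y + f d *: S + f e *: I).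
Proof. by rewrite !scalerDr !scalerA !rmorphM. Qed.

Section Spectrum.
Context {R : realType} (c : R) {m : nat}.
Local Notation vec := 'cV[R[i]]_m.+1.
Local Notation mat := 'M[R[i]]_m.+1.
Local Notation Cc := (c%:C%C : R[i]).
Local Notation Psi := (Psi_form Cc).
Hypotheses (cc : c * c = 1) (m1 : (1 < m)%N).
Variable T : mat.
Local Notation J := (antilinear T).
Hypothesis TT : T *m map_mx Num.conj T = 1%:M.
Hypothesis PsiJJ : forall u v, Psi (J u) (J v) = Psi v u.
Variables (x : R) (M : set (CQ c m)).
Hypotheses (x_gt0 : 0 < x) (x1 : 1 - x != 0).
Hypotheses (surfM : real_hypersurface M) (M0 : M !=set0).
Hypothesis level : forall p, M p -> \tr (Phi p *m conj_mx T (Phi p)) = x%:C%C.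

Local Notation kap := (c / (1 - x)).
Local Notation sig := (2 * kap * ((m%:R + 1) * x - 1) / x).

Let x0 : x != 0.
Proof. by rewrite gt_eqF. Qed.

Lemma chart_level zeta U u : local_param zeta M U -> U u -> M (chart zeta u).
Proof.
move=> [oU _ _ _ /(_ U oU (fun _ h => h))[W _ e]] Uu.
by have : (chart zeta @` U) (chart zeta u) by [exists u]; rewrite e => -[].
Qed.

Let phi_chart a b d e zeta : (fun p : CQ c m => combination T a b d e (Phi p)) \o chart zeta =
  fun u => combination T a b d e (projector c (set_val (zeta u))).
Proof. by apply/funext => u /=; rewrite Phi_cq. Qed.

Lemma has_laplacian_eigen a b d e lam :
  kap * (4 * m%:R - 2) * a + 2 * kap * b - (8 * c + 2 * sig * x) * d = lam * a ->
  kap * (4 * m%:R - 2) * b + 2 * kap * a - (8 * c + 2 * sig * x) * d = lam * b ->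
  (8 * m%:R * kap - 2 * sig) * d - sig * (a + b) = lam * d ->
  - (4 * c * (a + b)) = lam * e ->
  has_laplacian M (fun p : CQ c m => combination T a b d e (Phi p))
    (fun p : CQ c m => lam%:C%C *: combination T a b d e (Phi p)).
Proof.
move=> ea eb ed ee zeta U lp; have inM u := chart_level lp (u := u).
case: lp => oU sZ Efree _ _; rewrite phi_chart; split=> [|u Uu].
  exact: (smooth_combination T oU sZ).
have lev v : U v -> Psi (J (set_val (zeta v))) (set_val (zeta v)) *
    (Psi (J (set_val (zeta v))) (set_val (zeta v)))^* = x%:C%C.
  move=> /inM /level; rewrite Phi_cq => <-.
  by rewrite (tr_projector_conj cc TT PsiJJ).
rewrite (laplacian_combination cc (ltnW m1) TT PsiJJ oU sZ Efree x0 x1 lev _ _ _ _ Uu).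
rewrite ea eb ed ee Phi_cq.
exact: (scale_combination (real_complex R)).
Qed.

Lemma combination_Phi_eq0 a b d e p : M p -> combination T a b d e (Phi p) = 0 ->
  [/\ a = 0, b = 0 & d = 0].
Proof.
move=> /level; rewrite /Phi; move: (repr p) => z tXY.
have PP := projector_idem cc z; have t1 := tr_projector cc z.
have XYX := projector_sandwich z (conj_mx T (projector c (set_val z))).
rewrite tXY in XYX; move: (projector c _) PP t1 XYX tXY => X XX tX XYX tXY comb0.
have YY : conj_mx T X *m conj_mx T X = conj_mx T X by rewrite -(conj_mxM TT) XX.
have YXY : conj_mx T X *m X *m conj_mx T X = x%:C%C *: conj_mx T X.
  have := congr1 (conj_mx T) XYX; rewrite (conj_mxM TT (X *m _)) (conj_mxM TT X) (conj_mxK TT) => ->.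
  by rewrite conj_mxZ conjCR.
have tY : \tr (conj_mx T X) = 1.
  rewrite /conj_mx mxtrace_mulC mulmxA map_conj_mul1C // mul1mx -[LHS]/(\tr (map_mx _ X)).
  by rewrite trace_map_mx tX rmorph1.
have xC0 : x%:C%C != 0 :> R[i] by rewrite -(rmorph0 (real_complex R)) (inj_eq (fmorph_inj _)).
have xC1 : 1 - x%:C%C != 0 :> R[i].
  rewrite -(rmorph1 (real_complex R)) -rmorphB -(rmorph0 (real_complex R)).
  by rewrite (inj_eq (fmorph_inj _)).
have [a0 b0 d0] := projector_pair_free m1 xC0 xC1 XX YY XYX YXY tX tY tXY comb0.
by split; apply: (fmorph_inj (real_complex R)); rewrite rmorph0.
Qed.

Lemma eigen_nonconstant a b d e lam : lam != 0 -> ~ [/\ a = 0, b = 0 & d = 0] ->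
  has_laplacian M (fun p : CQ c m => combination T a b d e (Phi p))
    (fun p : CQ c m => lam%:C%C *: combination T a b d e (Phi p)) ->
  exists p q, [/\ M p, M q &
    combination T a b d e (Phi p) <> combination T a b d e (Phi q)].
Proof.
move=> lam0 abd lap; apply: contrapT => /forallNP const; apply: abd.
have [p Mp] := M0; have [zeta [U [u [lp Uu _]]]] := surfM Mp.
have Mu v := chart_level lp (u := v).
apply: (combination_Phi_eq0 (e := e) (Mu u Uu)).
have [_ /(_ u Uu)] := lap zeta U lp.
have oU : open U by case: lp.
have constU : {in U, (fun p : CQ c m => combination T a b d e (Phi p)) \o chart zeta =1
    fun=> combination T a b d e (Phi (chart zeta u))}.
  move=> v; rewrite inE => /Mu Mv; apply: contrapT => ne.
  by apply: (const (chart zeta v)); exists (chart zeta u); split=> //; exact: Mu.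
rewrite (laplacian_mx_eq _ oU Uu constU) laplacian_mx_cst => /esym/eqP.
rewrite scaler_eq0 -(rmorph0 (real_complex R)) (inj_eq (fmorph_inj _)) (negPf lam0) /=.
by move/eqP.
Qed.

Lemma spectral_of_coefficients k (lam a b d : 'I_k -> R) : injective lam ->
  (forall i, lam i != 0) -> (forall i, ~ [/\ a i = 0, b i = 0 & d i = 0]) ->
  (forall i, kap * (4 * m%:R - 2) * a i + 2 * kap * b i -
     (8 * c + 2 * sig * x) * d i = lam i * a i) ->
  (forall i, kap * (4 * m%:R - 2) * b i + 2 * kap * a i -
     (8 * c + 2 * sig * x) * d i = lam i * b i) ->
  (forall i, (8 * m%:R * kap - 2 * sig) * d i - sig * (a i + b i) = lam i * d i) ->
  \sum_i a i = 1 -> \sum_i b i = 0 -> \sum_i d i = 0 ->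
  mass_symmetric M /\ of_type M k.
Proof.
move=> lam_inj lam0 abd ea eb ed sa sb sd.
have M1 : m%:R + 1 != 0 :> R by rewrite natr1 pnatr_eq0.
pose e i := - (a i + b i + 2 * x * d i) / (m%:R + 1).
have ee i : - (4 * c * (a i + b i)) = lam i * e i.
  have E : lam i * (a i + b i + 2 * x * d i) = 4 * c * (m%:R + 1) * (a i + b i).
    rewrite !mulrDr (mulrCA (lam i)) -ea -eb -ed.
    by field; rewrite x1 x0.
  by rewrite /e mulrA mulrN E; field.
have lap i := has_laplacian_eigen (ea i) (eb i) (ed i) (ee i).
pose xt i (p : CQ c m) := combination T (a i) (b i) (d i) (e i) (Phi p).
have dec : spectral_decomposition M (m.+1%:R^-1)%:M lam xt.
  split=> //.
  - move=> z w; rewrite !mul_scalar_mx !Psi_formC PsiZl PsiZr.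
    by rewrite fmorphV rmorph_nat.
  - move=> i p Mp; apply: (combination_hermitian TT PsiJJ).
    exact: projector_hermitian.
  - by move=> i; exact: (eigen_nonconstant (lam0 i) (abd i) (lap i)).
  split=> // p Mp; rewrite /xt /combination; move: (Phi p) => X.
  rewrite !big_split /= -!scaler_suml -!rmorph_sum /= sa sb sd.
  have -> : \sum_i e i = - (m%:R + 1)^-1.
    rewrite -mulr_suml sumrN !big_split /= -mulr_sumr sa sb sd.
    by rewrite mulr0 !addr0 mulN1r.
  have -> : (- (m%:R + 1)^-1)%:C%C = - m.+1%:R^-1 :> R[i].
    by rewrite natr1 rmorphN fmorphV rmorph_nat.
  rewrite rmorph1 rmorph0 scale1r !scale0r !addr0.
  by rewrite scaleNr scale_scalar_mx mulr1 addrCA subrr addr0.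
split; last by exists (m.+1%:R^-1)%:M, lam, xt.
by exists k, (m.+1%:R^-1)%:M, lam, xt; split=> //; left.
Qed.

Let cE : c = kap * (1 - x).
Proof. by rewrite divfK. Qed.

Let kap0 : kap != 0.
Proof.
rewrite mulf_neq0 ?invr_eq0 //; apply: contra_eq_neq cc => ->.
by rewrite mul0r eq_sym oner_eq0.
Qed.

Let mR : 1 < m%:R :> R.
Proof. by rewrite (ltr_nat _ 1). Qed.

(* lp and lm are the roots of the characteristic polynomial of Delta on the plane
   spanned by (X + Y) / 2 - I / (m + 1) and S / 2 - x I / (m + 1). *)
Let D := (1 - 3 * x) ^+ 2 + 4 * (m%:R ^+ 2 - 1) * x ^+ 3.

Let D_gt0 : 0 < D.
Proof.
rewrite /D ltr_wpDl ?sqr_ge0 // mulr_gt0 ?exprn_gt0 // mulr_gt0 // subr_gt0.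
by rewrite expr_gt1 // ltW // (lt_trans _ mR).
Qed.

Let lp := 2 * kap / x * ((2 * m%:R - 1) * x + 1 + Num.sqrt D).
Let lm := 2 * kap / x * ((2 * m%:R - 1) * x + 1 - Num.sqrt D).

Let tau := 12 * m%:R * kap - 2 * sig.

Let lpm : lp + lm = tau.
Proof. by rewrite /lp /lm /tau; move: (kap) => k; field. Qed.

Let lpmM : lp * lm =
  4 * m%:R * kap * (tau - 4 * m%:R * kap) - (8 * c + 2 * sig * x) * (2 * sig).
Proof.
have S2 : Num.sqrt D ^+ 2 = D by rewrite sqr_sqrtr // ltW.
transitivity ((2 * kap / x) ^+ 2 * (((2 * m%:R - 1) * x + 1) ^+ 2 - D)).
  by rewrite /lp /lm -{3}S2; ring.
have -> : 8 * c = 8 * (kap * (1 - x)) by rewrite -cE.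
by rewrite /tau /D; move: (kap) => k; field.
Qed.

Let eigen_a l l' w : l + l' = tau -> l * l' = lp * lm ->
  let p := (4 * m%:R * kap - l') / w / 2 in
  kap * (4 * m%:R - 2) * p + 2 * kap * p - (8 * c + 2 * sig * x) * (- sig / w) = l * p.
Proof.
move=> lD lM p; rewrite lpmM in lM.
transitivity ((4 * m%:R * kap * l - l * l') / w / 2); last by rewrite /p; ring.
by rewrite lM -lD /p; move: (w^-1) (sig) (kap) => iw s k; field.
Qed.

Let eigen_d l l' w : l + l' = tau ->
  let p := (4 * m%:R * kap - l') / w / 2 in
  (8 * m%:R * kap - 2 * sig) * (- sig / w) - sig * (p + p) = l * (- sig / w).
Proof.
move=> lD p; have -> : l = tau - l' by rewrite -lD addrK.
by rewrite /p /tau; move: (w^-1) (sig) (kap) => iw s k; field.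
Qed.

(* The eigenvalue of X - Y. *)
Let l0 := 4 * (m%:R - 1) * kap.

Let l0_neq0 : l0 != 0.
Proof.
rewrite /l0; move: (kap) kap0 => k k0.
by rewrite !mulf_neq0 ?pnatr_eq0 ?subr_eq0 // gt_eqF.
Qed.

Let lpm_neq0 : lp * lm != 0.
Proof.
have -> : lp * lm = 16 * kap ^+ 2 * (m%:R + 1) * (1 - x) * (1 + (m%:R - 1) * x) / x.
  rewrite lpmM; have -> : 8 * c = 8 * (kap * (1 - x)) by rewrite -cE.
  by rewrite /tau; move: (kap) => k; field.
move: (kap) kap0 => k k0.
rewrite !mulf_neq0 ?invr_eq0 ?expf_neq0 ?natr1 ?pnatr_eq0 //.
by rewrite gt_eqF // addr_gt0 // mulr_gt0 // subr_gt0.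
Qed.

Let lp_neq0 : lp != 0.
Proof. by apply: contra_neq lpm_neq0 => ->; rewrite mul0r. Qed.

Let lm_neq0 : lm != 0.
Proof. by apply: contra_neq lpm_neq0 => ->; rewrite mulr0. Qed.

Let lpmB : lp - lm != 0.
Proof.
have -> : lp - lm = 4 * kap / x * Num.sqrt D by rewrite /lp /lm; ring.
move: (kap) kap0 => k k0.
by rewrite !mulf_neq0 ?invr_eq0 ?pnatr_eq0 // gt_eqF // sqrtr_gt0.
Qed.

Let k2x : 2 * kap / x != 0.
Proof.
by move: (kap) kap0 => k k0; rewrite !mulf_neq0 ?invr_eq0 ?pnatr_eq0.
Qed.

Let l0_lp : l0 != lp.
Proof.
rewrite -subr_eq0 -oppr_eq0.
have -> : - (l0 - lp) = 2 * kap / x * (1 + x + Num.sqrt D).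
  by rewrite /l0 /lp; move: (Num.sqrt D) (kap) => r k; field.
by rewrite mulf_neq0 // gt_eqF // ltr_wpDr ?sqrtr_ge0 // addr_gt0.
Qed.

Let l0_lm : (l0 == lm) = ((m%:R ^+ 2 - 1) * x ^+ 2 + 2 * x - 2 == 0).
Proof.
rewrite -subr_eq0 -oppr_eq0.
have -> : - (l0 - lm) = 2 * kap / x * (1 + x - Num.sqrt D).
  by rewrite /l0 /lm; move: (Num.sqrt D) (kap) => r k; field.
rewrite mulf_eq0 (negPf k2x) /= subr_eq0.
have x1_ge0 : 0 <= 1 + x by rewrite addr_ge0 // ltW.
rewrite -{1}(ger0_norm x1_ge0) -sqrtr_sqr eqr_sqrt ?sqr_ge0 ?ltW //.
rewrite -subr_eq0 -oppr_eq0.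
have -> : - ((1 + x) ^+ 2 - D) = 4 * x * ((m%:R ^+ 2 - 1) * x ^+ 2 + 2 * x - 2).
  by rewrite /D; ring.
by rewrite !mulf_eq0 pnatr_eq0 (negPf x0).
Qed.

Let ap := (4 * m%:R * kap - lm) / (lp - lm) / 2.
Let am := (4 * m%:R * kap - lp) / (lm - lp) / 2.
Let dp := - sig / (lp - lm).
Let dm := - sig / (lm - lp).

Let apm : ap + am = 2^-1.
Proof.
rewrite /ap /am; move: (lp) (lm) (kap) lpmB => u v k uv.
have vu : v - u != 0 by rewrite -oppr_eq0 opprB.
by field; rewrite uv vu.
Qed.

Let dpm : dp + dm = 0.
Proof. by rewrite /dp /dm -[lm - lp]opprB invrN mulrN subrr. Qed.

Let eap : kap * (4 * m%:R - 2) * ap + 2 * kap * ap - (8 * c + 2 * sig * x) * dp = lp * ap.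
Proof. exact: eigen_a. Qed.

Let eam : kap * (4 * m%:R - 2) * am + 2 * kap * am - (8 * c + 2 * sig * x) * dm = lm * am.
Proof. by apply: eigen_a; rewrite 1?addrC // mulrC. Qed.

Let edp : (8 * m%:R * kap - 2 * sig) * dp - sig * (ap + ap) = lp * dp.
Proof. exact: eigen_d. Qed.

Let edm : (8 * m%:R * kap - 2 * sig) * dm - sig * (am + am) = lm * dm.
Proof. by apply: eigen_d; rewrite addrC. Qed.

Let sig_neq0 : (m%:R + 1) * x != 1 -> sig != 0.
Proof.
move: (kap) kap0 => k k0 h.
by rewrite !mulf_neq0 ?invr_eq0 ?subr_eq0 ?pnatr_eq0.
Qed.

Let ord3 (P : 'I_3 -> Prop) : P ord0 -> P 1 -> P ord_max -> forall i, P i.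
Proof.
move=> p0 p1 p2 [[|[|[|i]]] hi] //.
- by rewrite (_ : Ordinal hi = ord0); last exact: val_inj.
- by rewrite (_ : Ordinal hi = 1); last exact: val_inj.
by rewrite (_ : Ordinal hi = ord_max); last exact: val_inj.
Qed.

Let ord2 (P : 'I_2 -> Prop) : P ord0 -> P ord_max -> forall i, P i.
Proof.
move=> p0 p1 [[|[|i]] hi] //.
- by rewrite (_ : Ordinal hi = ord0); last exact: val_inj.
by rewrite (_ : Ordinal hi = ord_max); last exact: val_inj.
Qed.

Lemma three_type : (m%:R + 1) * x != 1 ->
  (m%:R ^+ 2 - 1) * x ^+ 2 + 2 * x - 2 != 0 -> mass_symmetric M /\ of_type M 3.
Proof.
move=> s0; rewrite -l0_lm => l0m; have sig0 := sig_neq0 s0.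
pose lam (i : 'I_3) : R := [:: l0; lp; lm]`_i.
pose a (i : 'I_3) := [:: 2^-1; ap; am]`_i.
pose b (i : 'I_3) := [:: - 2^-1; ap; am]`_i.
pose d (i : 'I_3) : R := [:: 0; dp; dm]`_i.
have lpm' : lp != lm by rewrite -subr_eq0.
apply: (@spectral_of_coefficients 3 lam a b d).
- do 2![apply: ord3]; rewrite /lam //= => /eqP; rewrite ?(negPf l0_lp) ?(negPf l0m) ?(negPf lpm') //.
  + by rewrite eq_sym (negPf l0_lp).
  + by rewrite eq_sym (negPf l0m).
  + by rewrite eq_sym (negPf lpm').
- exact: ord3.
- apply: ord3; rewrite /a /b /d /= => -[]; first by move=> /eqP; rewrite invr_eq0 pnatr_eq0.
    by move=> _ _ /eqP; rewrite mulf_eq0 oppr_eq0 invr_eq0 (negPf sig0) (negPf lpmB).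
  by move=> _ _ /eqP; rewrite mulf_eq0 oppr_eq0 invr_eq0 (negPf sig0) -oppr_eq0 opprB (negPf lpmB).
- apply: ord3; [rewrite /lam /a /b /d /= mulr0 subr0 /l0|exact: eap|exact: eam].
  by move: (kap) => k; field.
- apply: ord3; [rewrite /lam /a /b /d /= mulr0 subr0 /l0|exact: eap|exact: eam].
  by move: (kap) => k; field.
- apply: ord3; [by rewrite /= subrr !mulr0 subr0|exact: edp|exact: edm].
- rewrite !big_ord_recr big_ord0 /= add0r -[LHS]/(2^-1 + ap + am) -addrA apm.
  by field.
- rewrite !big_ord_recr big_ord0 /= add0r -[LHS]/(- 2^-1 + ap + am) -addrA apm.
  by rewrite addrC subrr.
- by rewrite !big_ord_recr big_ord0 /= add0r -[LHS]/(0 + dp + dm) add0r dpm.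
Qed.

Lemma two_type_vanishing : (m%:R + 1) * x = 1 -> mass_symmetric M /\ of_type M 2.
Proof.
move=> s0; have sig0 : sig = 0 by rewrite s0 subrr mulr0 mul0r.
pose lam (i : 'I_2) : R := [:: l0; 4 * m%:R * kap]`_i.
pose a (i : 'I_2) : R := 2^-1.
pose b (i : 'I_2) : R := [:: - 2^-1; 2^-1]`_i.
pose d (i : 'I_2) : R := 0.
have h0 : 2^-1 != 0 :> R by rewrite invr_eq0 pnatr_eq0.
have l1 : l0 != 4 * m%:R * kap.
  have e : 4 * m%:R * kap - l0 = 4 * kap by rewrite /l0; ring.
  by rewrite -subr_eq0 -oppr_eq0 opprB e mulf_neq0 // pnatr_eq0.
apply: (@spectral_of_coefficients 2 lam a b d).
- do 2![apply: ord2]; rewrite /lam //= => /eqP; first by rewrite (negPf l1).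
  by rewrite eq_sym (negPf l1).
- apply: ord2 => //=; rewrite /lam /= mulf_neq0 // mulf_neq0 ?pnatr_eq0 //.
  by rewrite -lt0n ltnW.
- by apply: ord2 => -[] /eqP; rewrite (negPf h0).
- by apply: ord2; rewrite /lam /b /a /d /= /l0 mulr0 subr0; move: (kap) => k; field.
- by apply: ord2; rewrite /lam /b /a /d /= /l0 mulr0 subr0; move: (kap) => k; field.
- by apply: ord2; rewrite sig0 /d !mulr0 mul0r subr0.
- by rewrite /a !big_ord_recr big_ord0 /= add0r; field.
- rewrite !big_ord_recr big_ord0 /= add0r -[LHS]/(- 2^-1 + 2^-1).
  by rewrite addrC subrr.
- by rewrite big1.
Qed.

Lemma two_type_merged : (m%:R ^+ 2 - 1) * x ^+ 2 + 2 * x - 2 = 0 -> mass_symmetric M /\ of_type M 2.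
Proof.
move=> e; have s0 : (m%:R + 1) * x != 1.
  apply: contra_eqN e => /eqP s0.
  have -> : (m%:R ^+ 2 - 1) * x ^+ 2 + 2 * x - 2 =
    (m%:R - 1) * x * ((m%:R + 1) * x) + 2 * x - 2 by ring.
  have -> : (m%:R - 1) * x * ((m%:R + 1) * x) + 2 * x - 2 = (m%:R + 1) * x - 2.
    by transitivity ((m%:R - 1) * x * 1 + 2 * x - 2); [rewrite s0|ring].
  by rewrite s0 subr_eq0 (eqr_nat _ 1 2).
move: e => /eqP; rewrite -l0_lm => /eqP l0m.
have sig0 := sig_neq0 s0.
pose lam (i : 'I_2) : R := [:: lp; lm]`_i.
pose a (i : 'I_2) := [:: ap; 2^-1 + am]`_i.
pose b (i : 'I_2) := [:: ap; - 2^-1 + am]`_i.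
pose d (i : 'I_2) := [:: dp; dm]`_i.
have lpm' : lp != lm by rewrite -subr_eq0.
apply: (@spectral_of_coefficients 2 lam a b d).
- do 2![apply: ord2]; rewrite /lam //= => /eqP; first by rewrite (negPf lpm').
  by rewrite eq_sym (negPf lpm').
- exact: ord2.
- apply: ord2; rewrite /a /b /d /= => -[] _ _ /eqP.
    by rewrite mulf_eq0 oppr_eq0 invr_eq0 (negPf sig0) (negPf lpmB).
  by rewrite mulf_eq0 oppr_eq0 invr_eq0 (negPf sig0) -oppr_eq0 opprB (negPf lpmB).
- apply: ord2; [exact: eap|rewrite /lam /a /b /d /=].
  by rewrite mulrDr [RHS]mulrDr -eam -l0m /l0; move: (kap) => k; field.
- apply: ord2; [exact: eap|rewrite /lam /a /b /d /=].
  by rewrite mulrDr [RHS]mulrDr -eam -l0m /l0; move: (kap) => k; field.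
- apply: ord2; [exact: edp|rewrite /lam /a /b /d /= -edm].
  by congr (_ - _ * _); ring.
- rewrite !big_ord_recr big_ord0 /= add0r -[LHS]/(ap + (2^-1 + am)) addrCA apm.
  by field.
- rewrite !big_ord_recr big_ord0 /= add0r -[LHS]/(ap + (- 2^-1 + am)) addrCA apm.
  by rewrite addrC subrr.
- by rewrite !big_ord_recr big_ord0 /= add0r -[LHS]/(dp + dm) dpm.
Qed.

End Spectrum.

(** * Unit normals and tubes *)

Section PlaneRotation.
Context {K : numClosedFieldType} (c : K) {m : nat}.
Local Notation vec := 'cV[K]_m.+1.
Local Notation Psi := (Psi_form c).
Hypothesis cJ : c^* = c.

Definition signature (k : 'I_m.+1) : K := if k == ord0 then c else 1.
Local Notation g := signature.

Lemma signatureJ k : (g k)^* = g k.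
Proof. by rewrite /g; case: ifP => // _; rewrite rmorph1. Qed.

Lemma Psi_sum (z w : vec) : Psi z w = \sum_k g k * (z k 0)^* * w k 0.
Proof.
rewrite PsiE mxE; apply: eq_bigr => k _.
by rewrite starE mulrC [X in _ * X]mulrC mulrC.
Qed.

Definition conjv (z : vec) : vec := map_mx Num.conj z.

Lemma conjvE (z : vec) k : conjv z k 0 = (z k 0)^*.
Proof. by rewrite mxE. Qed.

Lemma conjvK : involutive conjv.
Proof. by move=> z; apply/matrixP => k l; rewrite !mxE conjCK. Qed.

Lemma Psi_conjv (z w : vec) : Psi (conjv z) (conjv w) = Psi w z.
Proof.
rewrite !Psi_sum; apply: eq_bigr => k _; rewrite !conjvE conjCK.
by rewrite mulrAC.
Qed.

Lemma Psi_conjvC (z w : vec) : Psi (conjv z) w = Psi (conjv w) z.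
Proof. by rewrite -{1}[w]conjvK Psi_conjv. Qed.

Definition plane_rotation (i j : 'I_m.+1) (C S : K) (z : vec) : vec :=
  \col_k (if k == i then C * z i 0 + S * g j * z j 0
          else if k == j then C * z j 0 - S * g i * z i 0 else z k 0).

Lemma conjv_plane_rotation i j C S z : C^* = C -> S^* = S ->
  conjv (plane_rotation i j C S z) = plane_rotation i j C S (conjv z).
Proof.
move=> CJ SJ; apply/matrixP => k l; rewrite !mxE.
case: ifP => _; first by rewrite rmorphD !rmorphM /= CJ SJ signatureJ.
by case: ifP => _ //; rewrite rmorphB !rmorphM /= CJ SJ signatureJ.
Qed.

Lemma Psi_plane_rotation i j C S z w : j != i -> C^* = C -> S^* = S ->
  C ^+ 2 + g i * g j * S ^+ 2 = 1 ->
  Psi (plane_rotation i j C S z) (plane_rotation i j C S w) = Psi z w.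
Proof.
move=> ji CJ SJ CS; rewrite !Psi_sum; under eq_bigr => k _.
  by rewrite -conjvE conjv_plane_rotation // over.
rewrite (bigD1 i) // (bigD1 j) //= [in RHS](bigD1 i) // [in RHS](bigD1 j) //=.
rewrite !addrA; congr (_ + _); last first.
  apply: eq_bigr => k /andP[/negPf ki /negPf kj].
  by rewrite !mxE ki kj.
rewrite !mxE eqxx (negPf ji) eqxx.
move: (g i) (g j) CS => p q CS.
rewrite -[RHS]mul1r -CS; ring.
Qed.

Lemma normal_equation (z v : vec) : Psi z z = c -> Psi z v = 0 ->
  (forall i j, j != i -> z j 0 * (v i 0)^* - z i 0 * (v j 0)^* +
    ((z j 0)^* * v i 0 - (z i 0)^* * v j 0) = 0) ->
  c *: v = Psi (conjv z) v *: conjv z - Psi (conjv z) z *: conjv v.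
Proof.
move=> zz zv ev; have vz : Psi v z = 0 by rewrite -(PsiJ cJ) zv rmorph0.
apply/matrixP => i l; rewrite !mxE ord1 -[X in X * _ = _]zz !Psi_sum !mulr_suml.
apply/eqP; rewrite -subr_eq0 opprB addrA -big_split -sumrB /=; apply/eqP.
(* contract the relations with g_k z_k *)
transitivity (\sum_k g k * z k 0 * (z k 0 * (v i 0)^* - z i 0 * (v k 0)^* +
    ((z k 0)^* * v i 0 - (z i 0)^* * v k 0)) + z i 0 * Psi v z).
  rewrite Psi_sum mulr_sumr -big_split /=; apply: eq_bigr => k _.
  by rewrite !conjvE conjCK; ring.
rewrite vz mulr0 addr0 big1 // => k _.
have [->|/ev ->] := eqVneq k i; last by rewrite mulr0.
by rewrite !subrr addr0 mulr0.
Qed.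

End PlaneRotation.

Lemma rotation_curve (R : realType) (e : R) : e = 1 \/ e = -1 ->
  exists C S : R -> R,
  [/\ forall t, derivable C t 1 /\ derivable S t 1,
      C 0 = 1 /\ S 0 = 0, 'D_1 C 0 = 0 /\ 'D_1 S 0 = 1 &
      forall t, C t ^+ 2 + e * S t ^+ 2 = 1].
Proof.
case=> ->.
  exists cos, sin; split=> [t|||t].
  - by split.
  - by rewrite cos0 sin0.
  - have [_ ->] := is_derive_cos (0 : R); have [_ ->] := is_derive_sin (0 : R).
    by rewrite sin0 cos0 oppr0.
  - by rewrite mul1r cos2Dsin2.
have dN (t : R) : is_derive t 1 (fun t : R => expR (- t)) (- expR (- t)).
  have d1 : is_derive (- t) 1 expR (expR (- t)) by exact: is_derive_expR.
  have d2 : is_derive t 1 (-%R : R -> R) (-1) by exact: is_deriveNid.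
  by have := is_derive1_comp d1 d2; rewrite mulrN1.
pose C (t : R) : R := 2^-1 *: (expR t + expR (- t)).
pose S (t : R) : R := 2^-1 *: (expR t - expR (- t)).
have dC (t : R) : is_derive t 1 C (2^-1 * (expR t - expR (- t))).
  exact: is_deriveZ.
have dS (t : R) : is_derive t 1 S (2^-1 * (expR t + expR (- t))).
  have h : is_derive t 1 (fun t : R => expR t - expR (- t)) (expR t - - expR (- t)).
    exact: is_deriveB.
  by have := is_deriveZ 2^-1 h; rewrite opprK.
exists C, S; split=> [t|||t].
- by have [hC _] := dC t; have [hS _] := dS t; split; [exact: hC|exact: hS].
- by rewrite /C /S oppr0 expR0 subrr scaler0; split=> //; rewrite -[LHS]/(2^-1 * (1 + 1)); field.
- have [_ ->] := dC 0; have [_ ->] := dS 0; rewrite oppr0 expR0 subrr mulr0.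
  by split=> //; field.
have E : expR t * expR (- t) = 1 by rewrite -expRD subrr expR0.
transitivity (expR t * expR (- t)); last exact: E.
rewrite /C /S -[LHS]/((2^-1 * (expR t + expR (- t))) ^+ 2 +
  -1 * (2^-1 * (expR t - expR (- t))) ^+ 2).
by field.
Qed.

Section UnitNormal.
Context {R : realType} (c : R) {m : nat}.
Local Notation Cc := (c%:C%C : R[i]).
Local Notation vec := 'cV[R[i]]_m.+1.
Local Notation Psi := (Psi_form Cc).
Local Notation g := (signature Cc).
Hypothesis cc : c = 1 \/ c = -1.

Let cJ : Cc^* = Cc.
Proof. exact: conjCR. Qed.

Let signature_real (i : 'I_m.+1) : exists2 e : R, g i = e%:C%C & e = 1 \/ e = -1.
Proof. by rewrite /g; case: ifP => _; [exists c | exists 1; [|left]]. Qed.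

Let signature_pair (i j : 'I_m.+1) : exists2 e : R, g i * g j = e%:C%C & e = 1 \/ e = -1.
Proof.
have [a -> ha] := signature_real i; have [b -> hb] := signature_real j.
exists (a * b); first by rewrite rmorphM.
by case: ha hb => -> [] ->; rewrite ?mulN1r ?mul1r ?opprK; [left|right|right|left].
Qed.

Lemma velocity_linear (gam : R -> @hyperquadric R c m) (C S : R -> R) (a b d : vec) :
  (forall t, derivable C t 1 /\ derivable S t 1) ->
  (forall t, set_val (gam t) = (C t)%:C%C *: a + (S t)%:C%C *: b + d) ->
  'D_1 C 0 = 0 -> 'D_1 S 0 = 1 -> derivable_curve gam /\ velocity gam 0 = b.
Proof.
move=> dCS gamE C0 S0.
have dlin (p q s t : R) : is_derive t 1 (fun t => C t * p + S t * q + s)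
    (p * 'D_1 C t + q * 'D_1 S t).
  have [dC dS] := dCS t.
  have hM (f : R -> R) (r : R) : derivable f t 1 ->
      is_derive t 1 (fun t => f t * r) (r * 'D_1 f t).
    move=> /derivableP df; have := is_deriveM df (is_derive_cst r t 1).
    by rewrite scaler0 add0r; exact.
  have hC := hM _ p dC; have hS := hM _ q dS.
  have hd : is_derive t 1 (fun=> s : R) 0 by exact: is_derive_cst.
  have := is_deriveD (is_deriveD hC hS) hd; rewrite addr0; exact.
have re i j : (fun t => complex.Re (set_val (gam t) i j)) =
    (fun t => C t * complex.Re (a i j) + S t * complex.Re (b i j) + complex.Re (d i j)).
  by apply/funext => t; rewrite gamE !mxE !ReD !ReZ.
have im i j : (fun t => complex.Im (set_val (gam t) i j)) =
    (fun t => C t * complex.Im (a i j) + S t * complex.Im (b i j) + complex.Im (d i j)).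
  by apply/funext => t; rewrite gamE !mxE !ImD !ImZ.
split.
  move=> t i j; rewrite re im.
  by split; [have [h _] := dlin (complex.Re (a i j)) (complex.Re (b i j)) (complex.Re (d i j)) t|
             have [h _] := dlin (complex.Im (a i j)) (complex.Im (b i j)) (complex.Im (d i j)) t]; exact: h.
apply/matrixP => i j; rewrite mxE re im.
have [_ ->] := dlin (complex.Re (a i j)) (complex.Re (b i j)) (complex.Re (d i j)) 0.
have [_ ->] := dlin (complex.Im (a i j)) (complex.Im (b i j)) (complex.Im (d i j)) 0.
by rewrite C0 S0 !mulr0 !add0r !mulr1; case: (b i j).
Qed.

Lemma Re_eq0_conj (x : R[i]) : complex.Re x = 0 -> x + x^* = 0.
Proof.
case: x => a b /= ->; apply/eqP; rewrite eq_complex /=.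
by rewrite !addr0 subrr eqxx.
Qed.

Lemma unit_normalE (S : set (CQ c m)) (z : @hyperquadric R c m) (v : vec) :
  unit_normal S z v ->
  (forall i j (C s : R) (w : @hyperquadric R c m), j != i ->
     set_val w = plane_rotation Cc i j C%:C%C s%:C%C (set_val z) ->
     C%:C%C ^+ 2 + g i * g j * s%:C%C ^+ 2 = 1 -> S (cq w)) ->
  Cc *: v = Psi (conjv (set_val z)) v *: conjv (set_val z) -
            Psi (conjv (set_val z)) (set_val z) *: conjv v.
Proof.
move=> [zv vv crit] inv.
have zz := Psi_hyperquadric z.
rewrite Psi_formC in zv; apply: (normal_equation cJ zz zv) => i j ji.
have [e ge e1] := signature_pair i j.
have [C [s [dCs [C0 s0] [dC0 ds0] CS]]] := rotation_curve e1.
have CSC t : (C t)%:C%C ^+ 2 + g i * g j * (s t)%:C%C ^+ 2 = 1.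
  by rewrite ge -!rmorphXn -rmorphM -rmorphD CS rmorph1.
pose rot t := plane_rotation Cc i j (C t)%:C%C (s t)%:C%C (set_val z).
have rotP t : hyperquadric c (rot t).
  rewrite /hyperquadric /= Psi_formC Psi_plane_rotation //; exact: conjCR.
pose gam t : @hyperquadric R c m := SigSub (mem_set (rotP t)).
pose a : vec := \col_k (if k == i then set_val z i 0 else
  if k == j then set_val z j 0 else 0).
pose b : vec := \col_k (if k == i then g j * set_val z j 0 else
  if k == j then - (g i * set_val z i 0) else 0).
pose d : vec := \col_k (if k == i then 0 else if k == j then 0 else set_val z k 0).
have gamE t : set_val (gam t) = (C t)%:C%C *: a + (s t)%:C%C *: b + d.
  apply/matrixP => k l; rewrite (ord1 l) !mxE.
  case: ifP => _; first by rewrite addr0 mulrA.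
  case: ifP => _; first by rewrite addr0 mulrN mulrA.
  by rewrite !mulr0 !add0r.
have [dgam vel] := velocity_linear dCs gamE dC0 ds0.
have gam0 : gam 0 = z.
  apply: val_inj; apply/matrixP => k l; rewrite (ord1 l) mxE C0 s0.
  rewrite rmorph1 rmorph0 !mul1r !mul0r subr0 addr0.
  by case: eqP => [->//|_]; case: eqP => [->|].
have := crit gam dgam _ gam0; rewrite vel Psi_formC => re0.
have {}re0 : complex.Re (Psi v b) = 0.
  by apply: re0 => t; apply: (inv i j (C t) (s t)).
have Pvb : Psi v b = e%:C%C * ((set_val z j 0) * (v i 0)^* - (set_val z i 0) * (v j 0)^*).
  rewrite Psi_sum (bigD1 i) // (bigD1 j) //= big1 => [|k /andP[/negPf ki /negPf kj]].
    rewrite !mxE eqxx (negPf ji) eqxx addr0 -ge; move: (g i) (g j) => p q.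
    by ring.
  by rewrite mxE ki kj mulr0.
have e0 : e != 0 by case: e1 => ->; rewrite ?oppr_eq0 oner_eq0.
move: re0; rewrite Pvb ReZ => /eqP; rewrite mulf_eq0 (negPf e0) /= => /eqP.
by move/Re_eq0_conj; rewrite rmorphB !rmorphM /= !conjCK.
Qed.

End UnitNormal.

Section TubeLevel.
Context {R : realType} (c : R) {m : nat}.
Local Notation Cc := (c%:C%C : R[i]).
Local Notation vec := 'cV[R[i]]_m.+1.
Local Notation mat := 'M[R[i]]_m.+1.
Local Notation Psi := (Psi_form Cc).
Local Notation hyp := (@hyperquadric R c m).
Hypothesis cc : c * c = 1.

Let cJ : Cc^* = Cc.
Proof. exact: conjCR. Qed.

Let ccC : Cc * Cc = 1.
Proof. by rewrite -rmorphM cc. Qed.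

Lemma cq_eq (z w : hyp) : cq z = cq w -> exists2 a : R[i], `|a| = 1 & set_val w = a *: set_val z.
Proof. by move=> /eqmodP /asboolP. Qed.

Section Unitary.
Variable A : mat.
Hypothesis unitA : Psi_unitary c A.

Let A_Psi z w : Psi (A *m z) (A *m w) = Psi z w.
Proof. by rewrite -!Psi_formC unitA. Qed.

Lemma Psi_unitary_unit : A \in unitmx.
Proof.
suff /mulmx1_unit[] : padj Cc A *m A = 1%:M by [].
apply: mx_eqv => v; rewrite mul1mx -mulmxA.
apply/matrixP => k l; rewrite (ord1 l).
have e : Psi (padj Cc A *m (A *m v)) (delta_mx k 0) = Psi v (delta_mx k 0).
  by rewrite Psi_padj // A_Psi.
have gk : signature Cc k != 0.
  rewrite /signature; case: ifP => _; last exact: oner_neq0.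
  by apply: contra_eq_neq ccC => ->; rewrite mul0r eq_sym oner_eq0.
have P u : Psi u (delta_mx k 0) = signature Cc k * (u k 0)^*.
  rewrite Psi_sum (bigD1 k) //= big1 => [|i /negPf ik].
    by rewrite mxE !eqxx mulr1 addr0.
  by rewrite mxE ik mulr0.
by move: e; rewrite !P => /(mulfI gk) /(can_inj (@conjCK _)).
Qed.

Definition real_structure : mat := A *m map_mx Num.conj (invmx A).

Lemma real_structureK : real_structure *m map_mx Num.conj real_structure = 1%:M.
Proof.
rewrite /real_structure map_mxM (map_conj_mxK (invmx A)) mulmxA.
rewrite -(mulmxA A (map_mx _ (invmx A))) -map_mxM mulVmx ?Psi_unitary_unit //.
by rewrite map_mx1 mulmx1 mulmxV ?Psi_unitary_unit.
Qed.

Lemma real_structure_mulv (z : vec) : antilinear real_structure (A *m z) = A *m conjv z.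
Proof.
rewrite /antilinear /real_structure map_mxM -mulmxA; congr (_ *m _).
by rewrite mulmxA -map_mxM mulVmx ?Psi_unitary_unit // map_mx1 mul1mx.
Qed.

Lemma real_structure_Psi u v :
  Psi (antilinear real_structure u) (antilinear real_structure v) = Psi v u.
Proof.
have E w : w = A *m (invmx A *m w) by rewrite mulKVmx ?Psi_unitary_unit.
by rewrite (E _ u) (E _ v) !real_structure_mulv !A_Psi Psi_conjv.
Qed.

Lemma isometry_image_level (S : set (CQ c m)) x :
  (forall z : hyp, S (cq z) ->
     Psi (conjv (set_val z)) (set_val z) * (Psi (conjv (set_val z)) (set_val z))^* = x) ->
  forall p, isometry_image A S p ->
    \tr (Phi p *m conj_mx real_structure (Phi p)) = x.
Proof.
move=> lev p [z [w [Sz wE ->]]]; rewrite Phi_cq.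
rewrite (tr_projector_conj cc real_structureK real_structure_Psi) wE.
by rewrite real_structure_mulv A_Psi lev.
Qed.

End Unitary.

Lemma conjvZ (a : R[i]) (z : vec) : conjv (a *: z) = a^* *: conjv z.
Proof. exact: map_mxZ. Qed.

Lemma tube_level (S : set (CQ c m)) r x :
  (forall (z y : hyp) v, S (cq z) -> unit_normal S z v ->
     set_val y = (gcos c r)%:C%C *: set_val z + (gsin c r)%:C%C *: v ->
     Psi (conjv (set_val y)) (set_val y) * (Psi (conjv (set_val y)) (set_val y))^* = x) ->
  forall z : hyp, tube S r (cq z) ->
    Psi (conjv (set_val z)) (set_val z) * (Psi (conjv (set_val z)) (set_val z))^* = x.
Proof.
move=> lev z [z0 [y [v [Sz nv yE /esym/cq_eq[a a1 ->]]]]].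
rewrite -(lev z0 y v Sz nv yE) conjvZ PsiZl PsiZr conjCK.
have aa : a * a^* = 1 by rewrite -normCK a1 expr1n.
move: (Psi _ _) => P; rewrite !rmorphM /=.
by transitivity ((a * a^*) ^+ 2 * (P * P^*)); [ring|rewrite aa expr1n mul1r].
Qed.

End TubeLevel.

Section Families.
Context {R : realType} (c : R) {m : nat}.
Local Notation Cc := (c%:C%C : R[i]).
Local Notation vec := 'cV[R[i]]_m.+1.
Local Notation Psi := (Psi_form Cc).
Local Notation hyp := (@hyperquadric R c m).
Local Notation square z := (Psi (conjv z) z).

Let cJ : Cc^* = Cc.
Proof. exact: conjCR. Qed.

Lemma conjC_real (x : R[i]) : complex.Im x = 0 <-> x^* = x.
Proof.
case: x => a b /=; split=> [->|/eqP].
  by apply/eqP; rewrite eq_complex /= oppr0 !eqxx.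
rewrite eq_complex /= eqxx /= -subr_eq0 -opprD oppr_eq0 -mulr2n mulrn_eq0 /=.
by move/eqP.
Qed.

Lemma norm1_conj (a : R[i]) : `|a| = 1 -> a * a^* = 1.
Proof. by move=> a1; rewrite -normCK a1 expr1n. Qed.

Lemma cq_scale (a : R[i]) (z w : hyp) :
  `|a| = 1 -> set_val w = a *: set_val z -> cq z = cq w.
Proof. by move=> a1 e; apply/eqmodP/asboolP; exists a. Qed.

Lemma real_formP (z : hyp) : real_form c m (cq z) <->
  exists2 a : R[i], `|a| = 1 & conjv (set_val z) = a ^+ 2 *: set_val z.
Proof.
split=> [[z' rz' /cq_eq[a a1 e]]|[a a1 e]].
  exists a => //; have e' : conjv (set_val z') = set_val z'.
    by apply/matrixP => k l; rewrite (ord1 l) conjvE; apply/conjC_real.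
  move: e'; rewrite e conjvZ => /(congr1 (fun u => a *: u)).
  by rewrite !scalerA norm1_conj // scale1r expr2.
have az : hyperquadric c (a *: set_val z).
  rewrite /hyperquadric /= Psi_formC PsiZl PsiZr mulrA Psi_hyperquadric.
  by rewrite [a^* * a]mulrC norm1_conj // mul1r.
exists (SigSub (mem_set az)); last exact: (cq_scale a1).
move=> k; apply/conjC_real; rewrite -conjvE -[set_val _]/(a *: set_val z).
rewrite conjvZ e scalerA expr2 mulrA [a^* * a]mulrC norm1_conj //.
by rewrite mul1r.
Qed.

Lemma plane_rotationZ i j C S (a : R[i]) (z : vec) :
  plane_rotation Cc i j C S (a *: z) = a *: plane_rotation Cc i j C S z.
Proof.
apply/matrixP => k l; rewrite !mxE; case: ifP => _; first by ring.
by case: ifP => _ //; ring.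
Qed.

Lemma square_combination (C S : R) (z v : vec) :
  square (C%:C%C *: z + S%:C%C *: v) = C%:C%C ^+ 2 * square z +
    2 * C%:C%C * S%:C%C * Psi (conjv z) v + S%:C%C ^+ 2 * square v.
Proof.
have -> : conjv (C%:C%C *: z + S%:C%C *: v) = C%:C%C *: conjv z + S%:C%C *: conjv v.
  by rewrite /conjv map_mxD -!/(conjv _) !conjvZ !conjCR.
rewrite PsiDl !PsiDr !PsiZl !PsiZr !conjCR (Psi_conjvC _ v z).
by move: (Psi _ z) (Psi _ v) (Psi _ v) => p q s; ring.
Qed.

End Families.

Section Quadric.
Context {R : realType} {m : nat}.
Local Notation vec := 'cV[R[i]]_m.+1.
Local Notation Psi := (Psi_form (1%:C%C : R[i])).
Local Notation hyp := (@hyperquadric R 1 m).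

Lemma complex_quadricP (z : hyp) : complex_quadric 1 m (cq z) <->
  Psi (conjv (set_val z)) (set_val z) = 0.
Proof.
have E (u : vec) : Psi (conjv u) u = \sum_j (u j 0) ^+ 2.
  rewrite Psi_sum; apply: eq_bigr => k _; rewrite /signature conjvE conjCK.
  by rewrite rmorph1 if_same mul1r expr2.
rewrite E; split=> [[z' z'0 /cq_eq[a a1 e]]|z0]; last by exists z.
move: z'0; rewrite e; under eq_bigr do rewrite mxE exprMn.
rewrite -mulr_sumr => /eqP; rewrite mulf_eq0 expf_eq0 /= -normr_eq0 a1 oner_eq0.
by move/eqP.
Qed.

Lemma quadric_tube_square r (z y : hyp) v : complex_quadric 1 m (cq z) ->
  unit_normal (complex_quadric 1 m) z v ->
  set_val y = (gcos 1 r)%:C%C *: set_val z + (gsin 1 r)%:C%C *: v ->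
  Psi (conjv (set_val y)) (set_val y) * (Psi (conjv (set_val y)) (set_val y))^* =
    (sin (2 * r) ^+ 2)%:C%C.
Proof.
move=> /complex_quadricP z0 nv yE.
have one : (1%:C%C : R[i])^* = 1%:C%C by exact: conjCR.
have zz : Psi (set_val z) (set_val z) = 1.
  by rewrite Psi_hyperquadric rmorph1.
have := unit_normalE (or_introl erefl) nv.
case: nv => _; rewrite Psi_formC => vv _; rewrite z0 scale0r subr0 rmorph1 scale1r.
set b := Psi _ v => vE; have {}vE : v = b *: conjv (set_val z).
  apply: vE => i j C s w ji wE CS; apply/complex_quadricP.
  by rewrite wE conjv_plane_rotation ?conjCR // Psi_plane_rotation ?conjCR.
have bb : b * b^* = 1.
  by rewrite -[RHS]vv vE PsiZl PsiZr Psi_conjv zz mulr1 mulrC.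
have v0 : Psi (conjv v) v = 0.
  rewrite vE conjvZ PsiZl PsiZr conjvK -(PsiJ one) z0.
  by rewrite rmorph0 !mulr0.
rewrite yE square_combination z0 v0 !mulr0 add0r addr0 -/b /gcos /gsin ltr01.
have -> : sin (2 * r) = 2 * (cos r * sin r) by rewrite !mulr_natl sin_mulr2n.
rewrite !rmorphXn !rmorphM /= !conjCR !rmorph_nat.
move: (cos r)%:C%C (sin r)%:C%C => C S.
by transitivity ((2 * (C * S)) ^+ 2 * (b * b^*)); [ring|rewrite bb mulr1].
Qed.

End Quadric.

Section RealForm.
Context {R : realType} {m : nat}.
Local Notation vec := 'cV[R[i]]_m.+1.
Local Notation Psi := (Psi_form ((-1)%:C%C : R[i])).
Local Notation hyp := (@hyperquadric R (-1) m).

Lemma real_form_tube_square r (z y : hyp) v : real_form (-1) m (cq z) ->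
  unit_normal (real_form (-1) m) z v ->
  set_val y = (gcos (-1) r)%:C%C *: set_val z + (gsin (-1) r)%:C%C *: v ->
  Psi (conjv (set_val y)) (set_val y) * (Psi (conjv (set_val y)) (set_val y))^* =
    ((gcos (-1) r ^+ 2 + gsin (-1) r ^+ 2) ^+ 2)%:C%C.
Proof.
move=> /real_formP[a a1 ze] nv yE.
have mone : ((-1)%:C%C : R[i])^* = (-1)%:C%C by exact: conjCR.
have zz : Psi (set_val z) (set_val z) = -1.
  by rewrite Psi_hyperquadric rmorphN1.
have := unit_normalE (or_intror erefl) nv.
case: nv; rewrite !Psi_formC => zv vv _.
set e := a ^+ 2 in ze *; have ee : e * e^* = 1.
  by rewrite /e rmorphXn /= -exprMn norm1_conj // expr1n.
have sq : Psi (conjv (set_val z)) (set_val z) = - e^*.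
  by rewrite ze PsiZl zz mulrN1.
have b0 : Psi (conjv (set_val z)) v = 0 by rewrite ze PsiZl zv mulr0.
have N1 : (-1)%:C%C *: v = - v by rewrite rmorphN1 scaleN1r.
rewrite sq b0 scale0r sub0r N1 => vE.
have {}vE : conjv v = - (e *: v).
  have v_eq : v = - (e^* *: conjv v).
    have h : - v = - (- e^* *: conjv v).
      apply: vE => i j C s w ji wE CS; apply/real_formP; exists a => //.
      rewrite wE conjv_plane_rotation ?conjCR // ze.
      exact: plane_rotationZ.
    by rewrite -[LHS]opprK h scaleNr opprK.
  by rewrite {2}v_eq scalerN scalerA ee scale1r opprK.
clearbody e.
have v1 : Psi (conjv v) v = - e^* by rewrite vE PsiNl PsiZl vv mulr1.
rewrite yE square_combination sq v1 b0 mulr0 addr0.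
have -> : ((gcos (-1) r ^+ 2 + gsin (-1) r ^+ 2) ^+ 2)%:C%C =
    ((gcos (-1) r)%:C%C ^+ 2 + (gsin (-1) r)%:C%C ^+ 2) ^+ 2 :> R[i].
  by rewrite [LHS]rmorphXn rmorphD -!rmorphXn.
have CJ := conjCR (gcos (-1) r); have SJ := conjCR (gsin (-1) r).
move: (gcos _ r)%:C%C (gsin _ r)%:C%C CJ SJ => C S CJ SJ.
have -> : C ^+ 2 * - e^* + S ^+ 2 * - e^* = - (C ^+ 2 + S ^+ 2) * e^* by ring.
rewrite rmorphM rmorphN rmorphD !rmorphXn /= conjCK CJ SJ.
by transitivity ((C ^+ 2 + S ^+ 2) ^+ 2 * (e * e^*)); [ring|rewrite ee mulr1].
Qed.

End RealForm.

(** * The exceptional radii *)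

Section ExceptionalRadii.
Context {R : realType}.
Implicit Types (u x r : R).

Lemma sin_double_acot u : sin (2 * acot u) = 2 * u / (1 + u ^+ 2).
Proof.
have u1 : 0 < 1 + u ^+ 2 by rewrite ltr_pwDl // sqr_ge0.
have c0 : cos (atan u) != 0 by rewrite cos_atan invr_eq0 gt_eqF // sqrtr_gt0.
have sE : sin (atan u) = u * cos (atan u).
  by rewrite -[in X in X * _](atanK u) /tan mulfVK.
have -> : acot u = - (atan u - pi / 2) by rewrite opprB.
rewrite mulr_natl sin_mulr2n sinN cosN sinBpihalf cosBpihalf opprK sE.
have -> : u * cos (atan u) * cos (atan u) = u * cos (atan u) ^+ 2 by ring.
by rewrite cos_atan exprVn sqr_sqrtr ?ltW // -mulr_natl mulrA.
Qed.

Lemma acot_lt_pi4 u : 1 < u -> 0 < acot u < pi / 4.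
Proof.
move=> /lt_atan; rewrite atan1 => u1; have := atan_ltpi2 u.
rewrite /acot => u2; apply/andP; split; first by rewrite subr_gt0.
by move: u1 u2; move: (atan u) (pi : R) => a p; lra.
Qed.

Lemma sin_double_itv r : 0 < r < pi / 4 -> 0 < sin (2 * r) < 1.
Proof.
move=> /andP[r0 r4]; have r2 : 0 < 2 * r < pi / 2.
  by move: r0 r4; move: (pi : R) => p; lra.
rewrite sin_gt0_pihalf //= lt_neqAle sin_le1 andbT; apply/eqP => s1.
have : 2 * r = pi / 2.
  apply: sin_inj; rewrite ?sin_pihalf // in_itv /=.
    by move: r2; move: (pi : R) => p; lra.
  by have := pi_gt0 R; move: (pi : R) => p; lra.
by move: r2; move: (pi : R) => p; lra.
Qed.

Lemma sin_double_inj r r' : 0 < r < pi / 4 -> 0 < r' < pi / 4 ->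
  sin (2 * r) ^+ 2 = sin (2 * r') ^+ 2 -> r = r'.
Proof.
move=> hr hr'; have /andP[s0 _] := sin_double_itv hr.
have /andP[s0' _] := sin_double_itv hr'.
move=> /eqP; rewrite eqrXn2 ?ltW // => /eqP /sin_inj e.
apply: (mulfI (_ : 2 != 0 :> R)); rewrite ?pnatr_eq0 // e //.
  by move: hr; rewrite in_itv /=; move: (pi : R) => p; lra.
by move: hr'; rewrite in_itv /=; move: (pi : R) => p; lra.
Qed.

Variable m : nat.
Hypothesis m1 : (1 < m)%N.
Local Notation M := (m%:R : R).
Local Notation r1 := (acot (Num.sqrt M + Num.sqrt m.+1%:R)).
Local Notation r2 := (acot (Num.sqrt (Num.sqrt (2 * M ^+ 2 - 1) +
                                      Num.sqrt (2 * M ^+ 2 - 2)))).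

Let M1 : 1 < M.
Proof. by rewrite (ltr_nat _ 1). Qed.

Lemma radius1_itv : 0 < r1 < pi / 4.
Proof.
apply: acot_lt_pi4; rewrite ltr_pwDr ?sqrtr_gt0 ?ltr0n //.
by rewrite -[leLHS]sqrtr1 ler_wsqrtr // ltW.
Qed.

Lemma radius1E : (M + 1) * sin (2 * r1) ^+ 2 = 1.
Proof.
rewrite sin_double_acot.
have h1 : Num.sqrt M ^+ 2 = M by rewrite sqr_sqrtr ?ler0n.
have h2 : Num.sqrt m.+1%:R ^+ 2 = M + 1 by rewrite sqr_sqrtr ?ler0n // natr1.
have a0 : 0 < Num.sqrt M by rewrite sqrtr_gt0 ltr0n ltnW.
have b0 : 0 < Num.sqrt m.+1%:R :> R by rewrite sqrtr_gt0 ltr0n.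
move: (Num.sqrt M) (Num.sqrt m.+1%:R) h1 h2 a0 b0 => a b h1 h2 a0 b0.
have ba : b ^+ 2 = 1 + a ^+ 2 by rewrite h1 h2 addrC.
have -> : 1 + (a + b) ^+ 2 = 2 * b * (a + b).
  have -> : 2 * b * (a + b) = b ^+ 2 + b ^+ 2 + 2 * a * b by ring.
  by rewrite {1}ba; ring.
rewrite -h2; field.
by rewrite !gt_eqF // addr_gt0.
Qed.

Let W0 : 0 < 2 * M ^+ 2 - 2.
Proof. by have := M1; move: M => p; nra. Qed.

Let W1 : 1 < 2 * M ^+ 2 - 1.
Proof. by have := M1; move: M => p; nra. Qed.

Lemma radius2_itv : 0 < r2 < pi / 4.
Proof.
apply: acot_lt_pi4; rewrite -[ltLHS]sqrtr1 ltr_sqrt ?addr_gt0 ?sqrtr_gt0 //.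
  rewrite ltr_pwDr ?sqrtr_gt0 //.
  by rewrite -[leLHS]sqrtr1 ler_wsqrtr // ltW.
by rewrite (lt_trans _ W1).
Qed.

Lemma radius2E : let x := sin (2 * r2) ^+ 2 in
  (M ^+ 2 - 1) * x ^+ 2 + 2 * x - 2 = 0.
Proof.
move=> x; pose s := Num.sqrt (2 * M ^+ 2 - 1); pose d := Num.sqrt (2 * M ^+ 2 - 2).
have s2 : s ^+ 2 = 2 * M ^+ 2 - 1 by rewrite sqr_sqrtr // ltW // (lt_trans _ W1).
have d2 : d ^+ 2 = 2 * M ^+ 2 - 2 by rewrite sqr_sqrtr // ltW.
have s0 : 0 < s by rewrite sqrtr_gt0 (lt_trans _ W1).
have d0 : 0 < d by rewrite sqrtr_gt0.
have xE : x = 2 / (1 + s).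
  rewrite /x sin_double_acot -/s -/d.
  have w2 : Num.sqrt (s + d) ^+ 2 = s + d by rewrite sqr_sqrtr // addr_ge0 // ltW.
  have -> : 2 * Num.sqrt (s + d) / (1 + Num.sqrt (s + d) ^+ 2) =
    2 * Num.sqrt (s + d) / (1 + (s + d)) by rewrite w2.
  rewrite expr_div_n exprMn w2.
  have -> : (1 + (s + d)) ^+ 2 = 2 * (s + d) * (1 + s).
    have -> : (1 + (s + d)) ^+ 2 =
      2 * (s + d) * (1 + s) + (1 + d ^+ 2 - s ^+ 2) by ring.
    by rewrite s2 d2; ring.
  by field; rewrite !gt_eqF // addr_gt0.
have -> : M ^+ 2 - 1 = (s ^+ 2 - 1) / 2 by rewrite s2; field.
by rewrite xE; field; rewrite gt_eqF // addr_gt0.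
Qed.

Lemma radius1_unique r : 0 < r < pi / 4 ->
  (M + 1) * sin (2 * r) ^+ 2 = 1 -> r = r1.
Proof.
move=> hr; rewrite -[RHS]radius1E => /mulfI e.
apply: sin_double_inj hr radius1_itv _; apply: e.
by rewrite natr1 pnatr_eq0.
Qed.

Lemma radius2_unique r : 0 < r < pi / 4 -> let x := sin (2 * r) ^+ 2 in
  (M ^+ 2 - 1) * x ^+ 2 + 2 * x - 2 = 0 -> r = r2.
Proof.
move=> hr /= e; apply: (sin_double_inj hr radius2_itv).
have e2 := radius2E; rewrite /= in e2.
have /andP[x0 _] := sin_double_itv hr; have /andP[y0 _] := sin_double_itv radius2_itv.
move: (sin (2 * r)) (sin (2 * r2)) e e2 x0 y0 => p q e e2 p0 q0.
have x0 : 0 < p ^+ 2 by rewrite exprn_gt0.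
have y0 : 0 < q ^+ 2 by rewrite exprn_gt0.
move: (p ^+ 2) (q ^+ 2) e e2 x0 y0 => x y e e2 x0 y0.
have M2 : 0 < M ^+ 2 - 1 by have := W0; lra.
have /eqP : (x - y) * ((M ^+ 2 - 1) * (x + y) + 2) = 0.
  transitivity ((M ^+ 2 - 1) * x ^+ 2 + 2 * x - 2 -
    ((M ^+ 2 - 1) * y ^+ 2 + 2 * y - 2)); [ring|by rewrite e e2 subrr].
rewrite mulf_eq0 => /orP[|]; first by rewrite subr_eq0 => /eqP.
by rewrite gt_eqF // addr_gt0 // mulr_gt0 // addr_gt0.
Qed.

End ExceptionalRadii.

Lemma tube_portion_level (R : realType) (c : R) (m : nat) (S : set (CQ c m)) r (x : R) M :
  c * c = 1 ->
  (forall (z y : @hyperquadric R c m) v, S (cq z) -> unit_normal S z v ->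
     set_val y = (gcos c r)%:C%C *: set_val z + (gsin c r)%:C%C *: v ->
     Psi_form (c%:C%C : R[i]) (conjv (set_val y)) (set_val y) *
     (Psi_form (c%:C%C : R[i]) (conjv (set_val y)) (set_val y))^* = x%:C%C) ->
  tube_portion S r M ->
  exists T : 'M[R[i]]_m.+1,
  [/\ T *m map_mx Num.conj T = 1%:M,
      forall u v, Psi_form (c%:C%C : R[i]) (antilinear T u) (antilinear T v) =
                  Psi_form (c%:C%C : R[i]) v u &
      forall p, M p -> \tr (Phi p *m conj_mx T (Phi p)) = x%:C%C].
Proof.
move=> cc lev [_ _ [A unitA [W _ ->]]]; exists (real_structure A); split.
- exact: (real_structureK cc unitA).
- exact: (real_structure_Psi cc unitA).
by move=> p [Sp _]; exact: (isometry_image_level cc unitA (tube_level lev)).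
Qed.

Theorem lemma7 (R : realType) (m : nat) (hm : (2 <= m)%N) :
  (forall (r : R) (M : set (CQ (-1) m)), 0 < r ->
     tube_portion (real_form (-1) m) r M ->
     mass_symmetric M /\ of_type M 3) /\
  (let r1 : R := acot (Num.sqrt m%:R + Num.sqrt m.+1%:R) in
   let r2 : R := acot (Num.sqrt (Num.sqrt (2 * m%:R ^+ 2 - 1) +
                                 Num.sqrt (2 * m%:R ^+ 2 - 2))) in
   (forall (r : R) (M : set (CQ 1 m)), 0 < r < pi / 4 -> r <> r1 -> r <> r2 ->
      tube_portion (complex_quadric 1 m) r M ->
      mass_symmetric M /\ of_type M 3) /\
   (forall (r : R) (M : set (CQ 1 m)), r = r1 \/ r = r2 ->
      tube_portion (complex_quadric 1 m) r M ->
      mass_symmetric M /\ of_type M 2)).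
Proof.
have m1 : 1 < m%:R :> R by rewrite (ltr_nat _ 1).
split=> [r M r0 tM|r1 r2].
  have cc : (-1) * (-1) = 1 :> R by rewrite mulrNN mulr1.
  have [T [TT PT lev]] := tube_portion_level cc (@real_form_tube_square R m r) tM.
  case: tM => surfM M0 _.
  have x1 : 1 < (gcos (-1) r ^+ 2 + gsin (-1) r ^+ 2) ^+ 2.
    have E : expR r * expR (- r) = 1 by rewrite -expRD subrr expR0.
    have r1 : expR (- r) < expR r by rewrite ltr_expR; lra.
    have -> : gcos (-1) r ^+ 2 + gsin (-1) r ^+ 2 = 1 + 2 * gsin (-1) r ^+ 2.
      by rewrite /gcos /gsin oppr_gt0 ltr10 -{3}E; field.
    rewrite exprn_egt1 // ltrDl mulr_gt0 // exprn_gt0 //.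
    by rewrite /gsin oppr_gt0 ltr10 divr_gt0 // subr_gt0.
  move: (_ ^+ 2) x1 lev => x x1 lev.
  apply: (three_type cc hm TT PT _ _ surfM M0 lev).
  - by rewrite (lt_trans _ x1).
  - by rewrite subr_eq0 lt_eqF.
  - by rewrite gt_eqF //; nra.
  - have M2 : 0 < m%:R ^+ 2 - 1 :> R by rewrite subr_gt0 exprn_egt1.
    have x2 : 0 < (m%:R ^+ 2 - 1) * x ^+ 2.
      by rewrite mulr_gt0 // exprn_gt0 // (lt_trans _ x1).
    by rewrite gt_eqF //; lra.
have cc : 1 * 1 = 1 :> R by rewrite mulr1.
have x_itv r : 0 < r < pi / 4 ->
    0 < sin (2 * r) ^+ 2 /\ 1 - sin (2 * r) ^+ 2 != 0 :> R.
  move=> /sin_double_itv/andP[s0 s1]; split; first by rewrite exprn_gt0.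
  by rewrite subr_eq0 gt_eqF // expr_lt1 // ltW.
split=> [r M hr rr1 rr2 tM|r M rE tM];
  have [T [TT PT lev]] := tube_portion_level cc (@quadric_tube_square R m r) tM;
  case: tM => surfM M0 _.
  have [x0 x1] := x_itv r hr; apply: (three_type cc hm TT PT x0 x1 surfM M0 lev).
    by apply/eqP => /(radius1_unique hm hr).
  by apply/eqP => /(radius2_unique hm hr).
case: rE => rE; rewrite rE in lev.
  have [x0 x1] := x_itv _ (radius1_itv hm).
  exact: (two_type_vanishing cc hm TT PT x0 x1 surfM M0 lev (radius1E hm)).
have [x0 x1] := x_itv _ (radius2_itv hm).
exact: (two_type_merged cc hm TT PT x0 x1 surfM M0 lev (radius2E hm)).
Qed.
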